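(* Let $n\ge3$ and let $X=\mathcal O_2^n$ (all transpositions in $\mathbb S_n$), or let $n=4$ and $X=\mathcal O_4^4$ (all $4$-cycles in $\mathbb S_4$). Let $\lambda\in\Bbbk$, $H=\mathfrak B(X,-1)\#\Bbbk\mathbb S_n$, $\eta=\frac{\lambda}{3}\sum_{\mu,\tau\in X}d_\tau\otimes d_\mu$, and let $\sigma=e^{\tilde\eta}$, which is a multiplicative $2$-cocycle for $H$. (i) If $X=\mathcal O_2^n$, then $H_\sigma\simeq\mathcal H(\mathcal Q_3^{-1}[(0,\lambda)])$ for $n=3$, and $H_\sigma\simeq\mathcal H(\mathcal Q_n^{-1}[(2\lambda,3\lambda)])$ for $n\ge4$. (ii) If $X=\mathcal O_4^4$, then $H_\sigma\simeq\mathcal H(\mathcal D[(\lambda,3\lambda)])$. (All isomorphisms are of Hopf algebras.) In particular, $\mathcal H(\mathcal Q_3^{-1}[(0,\lambda)])$ is a cocycle deformation of $\mathfrak B(\mathcal O_2^3,-1)\#\Bbbk\mathbb S_3$ for all $\lambda\in\Bbbk$.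
   Context: $\Bbbk$ is an algebraically closed field of characteristic zero. Permutations are composed from right to left, $\theta\triangleright\tau=\theta\tau\theta^{-1}$, $e$ is the identity of $\mathbb S_n$, and $h_\theta$ denotes the element of $\Bbbk\mathbb S_n$ corresponding to $\theta\in\mathbb S_n$. Nichols algebras. $\Bbbk X$ is the vector space with basis $\{x_\tau\}_{\tau\in X}$, made into a Yetter-Drinfeld module over $\Bbbk\mathbb S_n$ by $\delta(x_\tau)=h_\tau\otimes x_\tau$ and $h_\theta\cdot x_\tau=\mathrm{sgn}(\theta)\,x_{\theta\triangleright\tau}$; its braiding is $c(x_\sigma\otimes x_\tau)=-x_{\sigma\triangleright\tau}\otimes x_\sigma$. $\mathfrak B(X,-1)$ is its Nichols algebra (the quotient of $T(\Bbbk X)$ by the largest homogeneous two-sided ideal, generated in degrees $\ge 2$, that is also a coideal). The paper recalls from the literature, and uses, that these Nichols algebras are given as follows: $\mathfrak B(\mathcal O_2^n,-1)$ is generated by $x_{(\ell m)}$, $1\le\ell<m\le n$, with relations $x_{(ab)}^2=0$, $x_{(ab)}x_{(ef)}+x_{(ef)}x_{(ab)}=0$, $x_{(ab)}x_{(bc)}+x_{(bc)}x_{(ac)}+x_{(ac)}x_{(ab)}=0$ for $1\le a<b<c\le n$, $1\le e<f\le n$, $\{a,b\}\cap\{e,f\}=\emptyset$; $\mathfrak B(\mathcal O_4^4,-1)$ is generated by $x_i$, $i\in\mathcal O_4^4$, with relations $x_i^2=0$, $x_ix_{i^{-1}}+x_{i^{-1}}x_i=0$, $x_ix_j+x_kx_i+x_jx_k=0$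 for $ij=ki$, $j\ne i\ne k$. The $d_\tau$ are the dual functionals on $\Bbbk X$: $d_\tau(x_\mu)=\delta_{\tau,\mu}$. Bosonization, lifting and exponential. For $V$ a Yetter-Drinfeld module over a Hopf algebra $K$, $A=\mathfrak B(V)\#K$ is the bosonization, graded by $A_n=\mathfrak B^n(V)\#K$. For a $K$-invariant $\eta:V\otimes V\to\Bbbk$ ($\eta(h_{(1)}\cdot x,h_{(2)}\cdot y)=\varepsilon(h)\eta(x,y)$), $\tilde\eta:A\otimes A\to\Bbbk$ is defined by $\tilde\eta(A_a\otimes A_b)=0$ for $(a,b)\ne(1,1)$ and $\tilde\eta(x\#h,y\#h')=\eta(x,h\cdot y)\varepsilon(h')$ for $x,y\in V$, $h,h'\in K$; $e^{\tilde\eta}=\sum_{i\ge0}\tilde\eta^{*i}/i!$ (convolution powers). Cocycle deformation. A multiplicative $2$-cocycle on a Hopf algebra $A$ is a convolution invertible $\sigma:A\otimes A\to\Bbbk$ with $\sigma(b_{(1)},c_{(1)})\sigma(a,b_{(2)}c_{(2)})=\sigma(a_{(1)},b_{(1)})\sigma(a_{(2)}b_{(2)},c)$ and $\sigma(a,1)=\varepsilon(a)=\sigma(1,a)$. $A_\sigma$ is the Hopf algebra equal to $A$ as a coalgebra with product $a\cdot_\sigma b=\sigma(a_{(1)},b_{(1)})a_{(2)}b_{(2)}\sigma^{-1}(a_{(3)},b_{(3)})$. A cocycle deformation of $A$ is a Hopf algebra isomorphic to $A_\sigma$ for some multiplicative $2$-cocycle $\sigma$. Quadratic algebras, for $\Lambda,\Gamma\in\Bbbk$.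 $\mathcal H(\mathcal Q_n^{-1}[(\Lambda,\Gamma)])$ is the algebra generated by $a_i$ ($i\in\mathcal O_2^n$), $h_r$ ($r\in\mathbb S_n$) with relations $h_e=1$, $h_rh_s=h_{rs}$, $h_ja_i=-a_{j\triangleright i}h_j$ for $j\in\mathcal{O}_2^n$ (equivalently $h_ja_i=\mathrm{sgn}(j)a_{j\triangleright i}h_j$ for all $j\in\mathbb S_n$), $a_{(12)}^2=0$, $a_{(12)}a_{(34)}+a_{(34)}a_{(12)}=\Lambda(1-h_{(12)}h_{(34)})$ (this relation is absent for $n=3$), $a_{(12)}a_{(23)}+a_{(23)}a_{(13)}+a_{(13)}a_{(12)}=\Gamma(1-h_{(12)}h_{(23)})$. $\mathcal H(\mathcal D[(\Lambda,\Gamma)])$ is the algebra generated by $a_i$ ($i\in\mathcal O_4^4$), $h_r$ ($r\in\mathbb S_4$) with relations $h_e=1$, $h_rh_s=h_{rs}$, $h_ja_i=-a_{j\triangleright i}h_j$ for $j\in\mathcal{O}_4^4$ (equivalently $h_ja_i=\mathrm{sgn}(j)a_{j\triangleright i}h_j$ for all $j\in\mathbb S_4$), $a_{(1234)}^2=\Lambda(1-h_{(13)}h_{(24)})$, $a_{(1234)}a_{(1432)}+a_{(1432)}a_{(1234)}=0$, $a_{(1234)}a_{(1243)}+a_{(1243)}a_{(1423)}+a_{(1423)}a_{(1234)}=\Gamma(1-h_{(12)}h_{(13)})$. Both are Hopf algebras with $\Delta(h_r)=h_r\otimes h_r$, $\Delta(a_i)=a_i\otimes1+h_i\otimes a_i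$.
   Formalization: In the recalled presentation of B(O_2^n,-1), the three-term relation is imposed for all pairwise distinct a, b, c and not only a<b<c, since otherwise the ideal is not stable under S_n and the bosonization is undefined. *)

(* Defs.v *)
From HB Require Import structures.
From mathcomp Require Import all_boot all_order all_fingroup all_algebra.
From mathcomp Require Import finmap.
From mathcomp Require Import boolp classical_sets fsbigop.
From mathcomp Require Import monalg.

Set Implicit Arguments.
Unset Strict Implicit.
Unset Printing Implicit Defensive.

Import GRing.Theory.

Local Open Scope ring_scope.
Local Open Scope quotient_scope.

(* An element of A (x) A is represented by a finite list of pairs
   [:: (a_1, b_1); ...; (a_m, b_m)], standing for \sum_i a_i (x) b_i.  Two lists
   represent the same tensor iff every bilinear map out of A x A takes the same
   value on them ([tensor_eq], the universal property of A (x) A).  Hence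
   Sweedler's a_(1) (x) a_(2) is literally a sum over p <- cop a, with
   a_(1) = p.1 and a_(2) = p.2. *)

Section Hopf.
Variable k : fieldType.

Definition bilinear_map (U V W : lmodType k) (f : U -> V -> W) : Prop :=
  (forall v, linear (fun u => f u v)) /\ (forall u, linear (f u)).

Definition bilinear_form (U V : lmodType k) (f : U -> V -> k) : Prop :=
  bilinear_map (W := k^o) f.

Definition trilinear_map (U V X W : lmodType k) (f : U -> V -> X -> W) : Prop :=
  [/\ forall v x, linear (fun u => f u v x),
      forall u x, linear (fun v => f u v x)
    & forall u v, linear (f u v)].

Definition tensor_eq (U V : lmodType k) (s t : seq (U * V)) : Prop :=
  forall (W : lmodType k) (f : U -> V -> W), bilinear_map f ->
    \sum_(p <- s) f p.1 p.2 = \sum_(p <- t) f p.1 p.2.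

(* Bare structure maps; the axioms are in [is_hopf]. *)
Record hopf_data := HopfData {
  hcar :> lmodType k;
  hmul : hcar -> hcar -> hcar;
  hone : hcar;
  cop : hcar -> seq (hcar * hcar);
  eps : hcar -> k
}.

Definition is_algebra (A : hopf_data) : Prop :=
  [/\ bilinear_map (@hmul A), associative (@hmul A),
      left_id (hone A) (@hmul A) & right_id (hone A) (@hmul A)].

Definition is_coalgebra (A : hopf_data) : Prop :=
  [/\ forall (c : k) (x y : A),
        tensor_eq (cop (c *: x + y))
                  ([seq (c *: p.1, p.2) | p <- cop x] ++ cop y),
      scalar (@eps A),
      forall (x : A) (W : lmodType k) (f : A -> A -> A -> W), trilinear_map f ->
        \sum_(p <- cop x) \sum_(q <- cop p.1) f q.1 q.2 p.2 =
        \sum_(p <- cop x) \sum_(q <- cop p.2) f p.1 q.1 q.2,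
      forall x : A, \sum_(p <- cop x) eps p.1 *: p.2 = x
    & forall x : A, \sum_(p <- cop x) eps p.2 *: p.1 = x].

Definition is_hopf (A : hopf_data) : Prop :=
  [/\ is_algebra A, is_coalgebra A,
      tensor_eq (cop (hone A)) [:: (hone A, hone A)] /\
      (forall x y : A, tensor_eq (cop (hmul x y))
         [seq (hmul p.1 q.1, hmul p.2 q.2) | p <- cop x, q <- cop y]),
      eps (hone A) = 1 /\ (forall x y : A, eps (hmul x y) = eps x * eps y)
    & exists S : A -> A,
        [/\ linear S,
            forall x : A, \sum_(p <- cop x) hmul (S p.1) p.2 = eps x *: hone A
          & forall x : A, \sum_(p <- cop x) hmul p.1 (S p.2) = eps x *: hone A]].

(* A bialgebra isomorphism automatically commutes with the antipodes. *)
Definition hopf_isomorphic (A B : hopf_data) : Prop :=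
  [/\ is_hopf A, is_hopf B
    & exists phi : A -> B,
        [/\ linear phi, bijective phi,
            phi (hone A) = hone B /\ {morph phi : x y / hmul x y >-> hmul x y},
            forall x, tensor_eq (cop (phi x)) [seq (phi p.1, phi p.2) | p <- cop x]
          & forall x, eps (phi x) = eps x]].

Section Cocycles.
Variable A : hopf_data.
Implicit Types (f g s : A -> A -> k).

Definition conv f g : A -> A -> k := fun x y =>
  \sum_(p <- cop x) \sum_(q <- cop y) f p.1 q.1 * g p.2 q.2.

Definition conv_unit : A -> A -> k := fun x y => eps x * eps y.

Definition conv_pow f (i : nat) : A -> A -> k := iter i (conv f) conv_unit.

(* The sum is over the finitely many indices with a nonzero term. *)
Definition conv_exp f : A -> A -> k := fun x y =>
  \sum_(i \in [set: nat]) (conv_pow f i x y / i`!%:R).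

Definition is_conv_inverse f g : Prop :=
  [/\ bilinear_form g, conv f g =2 conv_unit & conv g f =2 conv_unit].

Definition conv_inv f : A -> A -> k :=
  xget (fun _ _ => 0) [set g | is_conv_inverse f g]%classic.

Definition mult_cocycle s : Prop :=
  [/\ bilinear_form s,
      exists g, is_conv_inverse s g,
      forall a b c : A,
        \sum_(q <- cop b) \sum_(r <- cop c) s q.1 r.1 * s a (hmul q.2 r.2) =
        \sum_(p <- cop a) \sum_(q <- cop b) s p.1 q.1 * s (hmul p.2 q.2) c
    & forall a : A, s a (hone A) = eps a /\ s (hone A) a = eps a].

(* (p.1, p'.1, p'.2) runs over a_(1) (x) a_(2) (x) a_(3). *)
Definition deform_mul s (a b : A) : A :=
  \sum_(p <- cop a) \sum_(p' <- cop p.2)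
  \sum_(q <- cop b) \sum_(q' <- cop q.2)
    (s p.1 q.1 * conv_inv s p'.2 q'.2) *: hmul p'.1 q'.1.

Definition deform s : hopf_data :=
  HopfData (deform_mul s) (hone A) (@cop A) (@eps A).

Definition is_cocycle_deformation (L : hopf_data) : Prop :=
  is_hopf A /\ exists s, mult_cocycle s /\ hopf_isomorphic (deform s) L.

End Cocycles.
End Hopf.

Notation free_alg k I := {malg k[{fmonom I}]}.

Definition gen (k : fieldType) (I : choiceType) (i : I) : free_alg k I :=
  << fmu i >>.

(* Linear extension to the free algebra of a tensor-valued map on words. *)
Definition lin_ext (k : fieldType) (I : choiceType) (U V : lmodType k)
    (D : seq I -> seq (U * V)) (t : free_alg k I) : seq (U * V) :=
  [seq (t@_w *: p.1, p.2) | w <- msupp t, p <- D w].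

Section Presented.
Variables (k : fieldType) (I : choiceType).
Local Notation F := (free_alg k I).
Implicit Types (J R : F -> Prop).

Definition two_sided_ideal J : Prop :=
  [/\ J 0, forall x y, J x -> J y -> J (x + y)
    & forall x y z, J y -> J (x * y * z)].

Definition gen_ideal R (x : F) : Prop :=
  forall J, two_sided_ideal J -> (forall r, R r -> J r) -> J x.

Definition gen_idealb R : {pred F} := fun x => `[< gen_ideal R x >].

Lemma gen_idealP R x : reflect (gen_ideal R x) (x \in gen_idealb R).
Proof. exact: asboolP. Qed.

Lemma gen_ideal_two_sided R : two_sided_ideal (gen_ideal R).
Proof.
split=> [J [J0 _ _] _ //|x y Rx Ry J HJ RJ|x y z Ry J HJ RJ].
- by case: (HJ) => _ JD _; apply: JD; [apply: Rx|apply: Ry].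
- by case: (HJ) => _ _ JM; apply: JM; apply: Ry.
Qed.

Lemma gen_idealMl R x y : y \in gen_idealb R -> x * y \in gen_idealb R.
Proof.
move=> /gen_idealP Ry; apply/gen_idealP; rewrite -[x * y]mulr1.
by case: (gen_ideal_two_sided R) => _ _; apply.
Qed.

Lemma gen_idealMr R x y : x \in gen_idealb R -> x * y \in gen_idealb R.
Proof.
move=> /gen_idealP Rx; apply/gen_idealP; rewrite -[x]mul1r.
by case: (gen_ideal_two_sided R) => _ _; apply.
Qed.

Lemma gen_idealb_zmod R : zmod_closed (gen_idealb R).
Proof.
have [I0 ID IM] := gen_ideal_two_sided R.
split=> [|x y /gen_idealP Rx Ry]; apply/gen_idealP => //.
by apply: ID => //; apply/gen_idealP; rewrite -mulN1r; apply: gen_idealMl.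
Qed.

HB.instance Definition _ R :=
  GRing.isZmodClosed.Build F (gen_idealb R) (gen_idealb_zmod R).

(* The algebra generated by I with relations r = 0 for all r such that R r. *)
Definition presented R := Quotient.quot (gen_idealb R).

Section Quotient.
Variable R : F -> Prop.
Local Notation Q := (presented R).

HB.instance Definition _ := GRing.Zmodule.on Q.

Definition proj (x : F) : Q := \pi_Q x.
Definition rep (x : Q) : F := generic_quotient.repr x.

Lemma repK : cancel rep proj. Proof. exact: reprK. Qed.

Lemma projE x y : proj x = proj y <-> gen_ideal R (x - y).
Proof.
rewrite /proj; split=> [/eqmodP|Rxy]; first by move/asboolP.
by apply/eqmodP/asboolP.
Qed.

Lemma projD : {morph proj : x y / x + y}.
Proof. by move=> x y; rewrite /proj Quotient.pi_add. Qed.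

Definition qone : Q := proj 1.
Definition qmul (x y : Q) : Q := proj (rep x * rep y).
Definition qscale (c : k) (x : Q) : Q := proj (c *: rep x).

Lemma rep_proj x : rep (proj x) - x \in gen_idealb R.
Proof. by apply/gen_idealP/projE; rewrite repK. Qed.

Lemma projM x y : proj (x * y) = qmul (proj x) (proj y).
Proof.
apply/esym/projE; set x' := rep _; set y' := rep _.
have -> : x' * y' - x * y = (x' - x) * y' + x * (y' - y).
  by rewrite mulrBl mulrBr addrA subrK.
apply/gen_idealP; rewrite rpredD //.
  by rewrite gen_idealMr ?rep_proj.
by rewrite gen_idealMl ?rep_proj.
Qed.

Lemma projZ c x : proj (c *: x) = qscale c (proj x).
Proof.
apply/esym/projE/gen_idealP; rewrite -scalerBr -[_ - _]mul1r scalerAl.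
exact: gen_idealMl (rep_proj _).
Qed.

Lemma qmulA : associative qmul.
Proof. by move=> x y z; rewrite -[x]repK -[y]repK -[z]repK -!projM mulrA. Qed.

Lemma qmul1l : left_id qone qmul.
Proof. by move=> x; rewrite -[x]repK -projM mul1r. Qed.

Lemma qmul1r : right_id qone qmul.
Proof. by move=> x; rewrite -[x]repK -projM mulr1. Qed.

Lemma qmulDl : left_distributive qmul +%R.
Proof.
move=> x y z; rewrite -[x]repK -[y]repK -[z]repK.
by rewrite -projD -!projM mulrDl projD.
Qed.

Lemma qmulDr : right_distributive qmul +%R.
Proof.
move=> x y z; rewrite -[x]repK -[y]repK -[z]repK.
by rewrite -projD -!projM mulrDr projD.
Qed.

HB.instance Definition _ :=
  GRing.Zmodule_isPzRing.Build Q qmulA qmul1l qmul1r qmulDl qmulDr.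

Lemma qscaleA a b v : qscale a (qscale b v) = qscale (a * b) v.
Proof. by rewrite -[v]repK -!projZ scalerA. Qed.

Lemma qscale1 : left_id 1 qscale.
Proof. by move=> v; rewrite -[v]repK -projZ scale1r. Qed.

Lemma qscaleDr : right_distributive qscale +%R.
Proof.
by move=> a u v; rewrite -[u]repK -[v]repK -projD -!projZ scalerDr projD.
Qed.

Lemma qscaleDl v : {morph qscale^~ v : a b / a + b}.
Proof. by move=> a b; rewrite -[v]repK -!projZ scalerDl projD. Qed.

HB.instance Definition _ :=
  GRing.Zmodule_isLmodule.Build k Q qscaleA qscale1 qscaleDr qscaleDl.

(* The comultiplication and counit that are the algebra maps given on the
   generators by d and e. *)
Variables (d : I -> seq (F * F)) (e : I -> k).

Definition cop_word : seq I -> seq (F * F) :=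
  foldr (fun i s => [seq (p.1 * q.1, p.2 * q.2) | p <- d i, q <- s]) [:: (1, 1)].

Definition presented_hopf : hopf_data k :=
  @HopfData k Q *%R 1
    (fun x => [seq (proj p.1, proj p.2) | p <- lin_ext cop_word (rep x)])
    (fun x => \sum_(w <- msupp (rep x)) (rep x)@_w * \prod_(i <- (w : seq I)) e i).

End Quotient.
End Presented.

(* MathComp composes permutations from left to right; the convention here is
   right to left.  In MathComp's product the rack operation s t s^-1 is t ^ s. *)
Definition pmul n (s t : 'S_n) : 'S_n := (t * s)%g.
Definition rack n (s t : 'S_n) : 'S_n := (t ^ s)%g.

Definition cycles n m : {set 'S_n} :=
  [set s : 'S_n | [exists c : m.-tuple 'I_n, uniq c && [forall i, s i == next c i]]].

(* s is the cycle (c_1 c_2 ... c_m), the points being numbered from 1 to n. *)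
Definition is_cyc n (c : seq nat) (s : 'S_n) : Prop :=
  forall i : 'I_n, (s i).+1 = next c i.+1.

Section Bosonization.
Variables (k : fieldType) (n : nat) (X : {set 'S_n}).

(* Indices of the basis x_tau of kX. *)
Definition idx : Type := {s : 'S_n | s \in X}.
HB.instance Definition _ := Finite.on idx.

(* The default value is irrelevant when X is stable under conjugation. *)
Definition rack_idx (s : 'S_n) (i : idx) : idx := insubd i (rack s (val i)).

Definition sgn (s : 'S_n) : k := (-1) ^+ odd_perm s.

Local Notation V := {ffun idx -> k^o}.
Local Notation T := (free_alg k idx).

Definition xV (i : idx) : V := [ffun j => (i == j)%:R].
Definition actV (s : 'S_n) (v : V) : V :=
  \sum_i v i *: (sgn s *: xV (rack_idx s i)).

Definition xT (i : idx) : T := gen k i.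

Definition wordT (w : seq idx) : T := \prod_(i <- w) xT i.

Definition actT (s : 'S_n) (t : T) : T :=
  \sum_(w <- msupp t) t@_w *: \prod_(i <- (w : seq idx)) (sgn s *: xT (rack_idx s i)).

Definition degT (w : seq idx) : 'S_n := foldr (fun i g => pmul (val i) g) 1%g w.

(* Braided comultiplication of T on words: x_i is primitive and
   (x_i (x) 1 + 1 (x) x_i)(u (x) v) = x_i u (x) v + (h_i . u) (x) x_i v.
   The second components stay words, so that their coaction can be read off. *)
Fixpoint bcop_word (w : seq idx) : seq (T * seq idx) :=
  if w is i :: w' then
    [seq (xT i * p.1, p.2) | p <- bcop_word w'] ++
    [seq (actT (val i) p.1, i :: p.2) | p <- bcop_word w']
  else [:: (1, [::])].

Definition bcop : T -> seq (T * T) :=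
  lin_ext (fun w => [seq (p.1, wordT p.2) | p <- bcop_word w]).

Definition hcomp (m : nat) (t : T) : T :=
  \sum_(w <- msupp t | size w == m) << t@_w *g w >>.

(* The last condition says that the comultiplication maps J to
   J (x) T + T (x) J, the kernel of T (x) T -> T/J (x) T/J. *)
Definition nichols_candidate (J : T -> Prop) : Prop :=
  [/\ two_sided_ideal J,
      forall t, J t -> forall m, J (hcomp m t),
      forall t, J t -> hcomp 0 t = 0 /\ hcomp 1 t = 0
    & forall t, J t -> forall (W : lmodType k) (f : T -> T -> W),
        bilinear_map f -> (forall u v, J u \/ J v -> f u v = 0) ->
        \sum_(p <- bcop t) f p.1 p.2 = 0].

(* The defining ideal of the Nichols algebra is the one generated by
   [nichols_rel], i.e. the sum of all the candidates, which is the largest one. *)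
Definition nichols_rel (t : T) : Prop := exists2 J, nichols_candidate J & J t.

(* R is a set of defining relations for B(X, -1).  The presentation of B(X, -1)
   by the relations rel is a result from the literature which is not proved here
   (and which is open for the transpositions of S_n, n >= 6).  Both readings
   are therefore allowed: either the presented algebra itself, with no assumption,
   or the Nichols algebra proper, when it has that presentation. *)
Definition defines_B (rel R : T -> Prop) : Prop :=
  R = rel \/
  (R = nichols_rel /\ forall t, gen_ideal nichols_rel t <-> gen_ideal rel t).

(* B # kS_n = B (x) kS_n, for B = T/(R), is the space of functions S_n -> B; b # g
   is the function supported at g with value b. *)

Variable R : T -> Prop.
Local Notation B := (presented R).
Local Notation H := {ffun 'S_n -> B}.

Definition smash (b : B) (g : 'S_n) : H := [ffun g' => if g' == g then b else 0].

Definition actB (g : 'S_n) (b : B) : B := proj R (actT g (rep b)).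

(* (a # g)(b # h) = a (g . b) # g h *)
Definition bos_mul (x y : H) : H :=
  \sum_g \sum_h smash (x g * actB g (y h)) (pmul g h).

(* Delta(b # g) = b^(1) # (b^(2))_(-1) g (x) (b^(2))_(0) # g *)
Definition bos_cop (x : H) : seq (H * H) :=
  flatten [seq lin_ext
      (fun w => [seq (smash (proj R p.1) (pmul (degT p.2) g),
                      smash (proj R (wordT p.2)) g) | p <- bcop_word w])
      (rep (x g)) | g <- enum 'S_n].

Definition bos_eps (x : H) : k := \sum_g (rep (x g))@_(fmone _).

Definition bosonization : hopf_data k :=
  @HopfData k H bos_mul (smash 1 1%g) bos_cop bos_eps.

Definition dual (i : idx) (v : V) : k := v i.

Definition eta (lam : k) (v w : V) : k :=
  lam / 3%:R * \sum_(i : idx) \sum_(j : idx) dual j v * dual i w.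

Definition degree1 (b : B) : V := [ffun i => (rep b)@_(fmu i)].

(* Only the components in B^1 # kS_n contribute. *)
Definition eta_tilde (lam : k) (x y : bosonization) : k :=
  \sum_g \sum_h eta lam (degree1 (x g)) (actV g (degree1 (y h))).

End Bosonization.

Section Relations.
Variable k : fieldType.

(* The three-term relation is imposed for all distinct a, b, c: with a < b < c
   only, one would miss half of them and the ideal would not be S_n-stable. *)
Inductive transp_rel n : free_alg k (idx (cycles n 2)) -> Prop :=
| transp_sq i : transp_rel (xT k i ^+ 2)
| transp_comm i j a b e f :
    uniq [:: a; b; e; f] -> val i = tperm a b -> val j = tperm e f ->
    transp_rel (xT k i * xT k j + xT k j * xT k i)
| transp_braid i j l a b c :
    uniq [:: a; b; c] ->
    val i = tperm a b -> val j = tperm b c -> val l = tperm a c ->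
    transp_rel (xT k i * xT k j + xT k j * xT k l + xT k l * xT k i).

Inductive fourcyc_rel n : free_alg k (idx (cycles n 4)) -> Prop :=
| fourcyc_sq i : fourcyc_rel (xT k i ^+ 2)
| fourcyc_inv i j : val j = (val i)^-1%g ->
    fourcyc_rel (xT k i * xT k j + xT k j * xT k i)
| fourcyc_braid i j l :
    pmul (val i) (val j) = pmul (val l) (val i) -> j != i -> i != l ->
    fourcyc_rel (xT k i * xT k j + xT k l * xT k i + xT k j * xT k l).

End Relations.

Section Quadratic.
Variables (k : fieldType) (n : nat) (X : {set 'S_n}).

(* Generators a_i, i in X, and h_r, r in S_n. *)
Definition quad_gen : choiceType := (idx X + 'S_n)%type.
Local Notation F := (free_alg k quad_gen).

Definition ga (i : idx X) : F := gen k (inl i : quad_gen).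
Definition gh (r : 'S_n) : F := gen k (inr r : quad_gen).

Inductive common_rel : F -> Prop :=
| rel_one : common_rel (gh 1%g - 1)
| rel_mul r s : common_rel (gh r * gh s - gh (pmul r s))
| rel_cross j i : j \in cycles n 2 ->
    common_rel (gh j * ga i + ga (rack_idx j i) * gh j).

Definition quad_cop (g : quad_gen) : seq (F * F) :=
  match g with
  | inl i => [:: (ga i, 1); (gh (val i), ga i)]
  | inr r => [:: (gh r, gh r)]
  end.

Definition quad_eps (g : quad_gen) : k := if g is inl _ then 0 else 1.

Definition quad_hopf (R : F -> Prop) : hopf_data k :=
  presented_hopf R quad_cop quad_eps.

End Quadratic.

Section QuadraticAlgebras.
Variables (k : fieldType) (Lam Gam : k).

(* For n = 3 there is no s in S_n with is_cyc [:: 3; 4] s, so that the second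
   relation is absent. *)
Inductive Q_rel n : free_alg k (quad_gen (cycles n 2)) -> Prop :=
| Q_common r : common_rel r -> Q_rel r
| Q_sq i : is_cyc [:: 1; 2] (val i) -> Q_rel (ga k i ^+ 2)
| Q_comm i j : is_cyc [:: 1; 2] (val i) -> is_cyc [:: 3; 4] (val j) ->
    Q_rel (ga k i * ga k j + ga k j * ga k i
           - Lam *: (1 - gh k _ (val i) * gh k _ (val j)))
| Q_braid i j l :
    is_cyc [:: 1; 2] (val i) -> is_cyc [:: 2; 3] (val j) ->
    is_cyc [:: 1; 3] (val l) ->
    Q_rel (ga k i * ga k j + ga k j * ga k l + ga k l * ga k i
           - Gam *: (1 - gh k _ (val i) * gh k _ (val j))).

Definition H_Q n : hopf_data k := quad_hopf (@Q_rel n).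

Inductive D_rel : free_alg k (quad_gen (cycles 4 4)) -> Prop :=
| D_common r : common_rel r -> D_rel r
| D_sq i (u v : 'S_4) :
    is_cyc [:: 1; 2; 3; 4] (val i) -> is_cyc [:: 1; 3] u -> is_cyc [:: 2; 4] v ->
    D_rel (ga k i ^+ 2 - Lam *: (1 - gh k _ u * gh k _ v))
| D_inv i j :
    is_cyc [:: 1; 2; 3; 4] (val i) -> is_cyc [:: 1; 4; 3; 2] (val j) ->
    D_rel (ga k i * ga k j + ga k j * ga k i)
| D_braid i j l (u v : 'S_4) :
    is_cyc [:: 1; 2; 3; 4] (val i) -> is_cyc [:: 1; 2; 4; 3] (val j) ->
    is_cyc [:: 1; 4; 2; 3] (val l) -> is_cyc [:: 1; 2] u -> is_cyc [:: 1; 3] v ->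
    D_rel (ga k i * ga k j + ga k j * ga k l + ga k l * ga k i
           - Gam *: (1 - gh k _ u * gh k _ v)).

Definition H_D : hopf_data k := quad_hopf D_rel.

End QuadraticAlgebras.

(* Main.v *)
Require Import Defs.
From mathcomp Require Import all_boot all_order all_fingroup all_algebra.
From mathcomp Require Import finmap.
From mathcomp Require Import boolp classical_sets fsbigop.
From mathcomp Require Import monalg ring.

Set Implicit Arguments.
Unset Strict Implicit.
Unset Printing Implicit Defensive.

Import GRing.Theory.
Local Open Scope ring_scope.

(** Let d be the sum of the functionals d_tau, extended to H by the counit of the group
algebra, let s be the sign character extended by zero on the positive degrees, and put
c = lambda / 3. Both s and d are matrix entries of a two-dimensional representation, in
which h_g acts by diag(sgn g, 1) and a_i by the strictly upper triangular unit. In the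
dual algebra of H they satisfy s * s = eps, s * d = - d * s and d * d = 0: together with
eps and s * d they span a copy of the four-dimensional Sweedler Hopf algebra
([skew_pair], [quad_skew_pair]).

With d' = d * s, the form eta~ is c d' (x) d ([eta_tilde_theta]). Its convolution square
vanishes because d * d = 0, so that sigma = eps (x) eps + c d' (x) d ([conv_exp_skew]);
replacing c by - c inverts sigma, and the cocycle identity is an expansion in which all
the terms in c^2 vanish ([skew_cocycle_is_cocycle]). The left and the right actions of d
and d' on H are skew derivations of square zero, and the deformed product is the original
one twisted by them, once on each side ([deform_mulE]). On generators it reads
a_i . a_j = a_i a_j + c (1 - h_i h_j), while products with an h_g on the left do not
change ([deform_mul_skew], [deform_mul_grouplike]).

Consider now a family of lists r of pairs (i, j), and let P_c be the algebra generated by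
the a_i and the h_g in which h_g a_i = sgn(g) a_(g |> i) h_g and, for all r, the sum of
the a_i a_j over r is c times the sum of the 1 - h_i h_j over r. It is a Hopf algebra as
soon as the products ij agree on each r and r is stable under the braiding
([quad_skew_primitive], [quad_is_hopf]). By the formula above, deforming P_b by sigma adds
c to the parameter: there is a map from P_(b + c) to the deformation of P_b, and the
same construction with - c gives its inverse, since both maps commute with the actions
of d ([quad_deform_iso]).

The bosonization is P_0 ([bosonization_hopf_iso]), hence H_sigma is P_(lambda / 3). The
substitution a_i |-> z a_i multiplies the parameter by z^2 ([quad_rescale]), and z^2 = 3
leads to P_lambda. The relations have one, two or three terms, for which the sums of the
1 - h_i h_j are 1 - h_i h_j itself, its double and its triple: this is where the constants
lambda, 2 lambda and 3 lambda come from ([quad_ok_two], [quad_ok_three]). For n = 3 there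
is no two-term relation and z = 1 gives 3 (lambda / 3) = lambda. Finally, the algebras of
the theorem are given by one relation in each orbit of the symmetric group, from which
the others follow by conjugation with the h_g ([quad_ok_conj], [transposition_orbits],
[four_cycle_orbits]). *)

Local Notation "x ** y" := (hmul x y) (at level 40, left associativity).

(** * Linear and bilinear maps *)

Section Linear.
Variables (k : fieldType) (U V : lmodType k) (f : U -> V).
Hypothesis fL : linear f.

Lemma lin0 : f 0 = 0.
Proof. by have := fL (-1) 0 0; rewrite scaleN1r oppr0 addr0 scaleN1r addNr. Qed.

Lemma linD x y : f (x + y) = f x + f y.
Proof. by have := fL 1 x y; rewrite !scale1r. Qed.

Lemma linZ c x : f (c *: x) = c *: f x.
Proof. by have := fL c x 0; rewrite lin0 !addr0. Qed.

Lemma linN x : f (- x) = - f x.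
Proof. by rewrite -scaleN1r linZ scaleN1r. Qed.

Lemma linB x y : f (x - y) = f x - f y.
Proof. by rewrite linD linN. Qed.

Lemma lin_sum (J : Type) (s : seq J) (P : pred J) (F : J -> U) :
  f (\sum_(j <- s | P j) F j) = \sum_(j <- s | P j) f (F j).
Proof. exact: (big_morph f linD lin0). Qed.

End Linear.

Section LinearOps.
Variables (k : fieldType) (U V W : lmodType k).

Lemma is_linear_id : linear (@id U). Proof. by []. Qed.

Lemma is_linear_comp (f : V -> W) (g : U -> V) :
  linear f -> linear g -> linear (fun u => f (g u)).
Proof. by move=> fL gL c x y; rewrite gL fL. Qed.

Lemma is_linear_sum (J : Type) (s : seq J) (f : J -> U -> V) :
  (forall j, linear (f j)) -> linear (fun u => \sum_(j <- s) f j u).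
Proof.
move=> fL c x y; rewrite scaler_sumr -big_split /=.
by apply: eq_bigr => j _; exact: fL.
Qed.

Lemma is_linear_scale c (f : U -> V) : linear f -> linear (fun u => c *: f u).
Proof.
by move=> fL b x y; rewrite fL scalerDr !scalerA mulrC.
Qed.

Lemma is_linear_add (f g : U -> V) :
  linear f -> linear g -> linear (fun u => f u + g u).
Proof. by move=> fL gL b x y; rewrite fL gL scalerDr addrACA. Qed.

Lemma linear_form_scale (f : U -> k) (v : V) :
  scalar f -> linear (fun u => f u *: v).
Proof. by move=> fL b x y; rewrite fL scalerDl scalerA. Qed.

End LinearOps.

Section BilinearOps.
Variables (k : fieldType) (U V W : lmodType k).

Lemma bilinear_comp (X' Y' : lmodType k) (f : X' -> Y' -> W) g h :
  bilinear_map f -> linear (g : U -> X') -> linear (h : V -> Y') ->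
  bilinear_map (fun u v => f (g u) (h v)).
Proof.
move=> [fl fr] gL hL; split=> [v|u].
  exact: (is_linear_comp (fl (h v)) gL).
exact: (is_linear_comp (fr (g u)) hL).
Qed.

Lemma bilinear_sum (J : Type) (s : seq J) (f : J -> U -> V -> W) :
  (forall j, bilinear_map (f j)) ->
  bilinear_map (fun u v => \sum_(j <- s) f j u v).
Proof.
move=> fB; split=> [v|u]; apply: is_linear_sum => j; first exact: (fB j).1.
exact: (fB j).2.
Qed.

Lemma bilinear_scalel (f : U -> k) : scalar f ->
  bilinear_map (fun (u : U) (v : V) => f u *: v).
Proof.
by move=> fL; split=> [v|u]; [exact: linear_form_scale|exact: is_linear_scale].
Qed.

Lemma bilinear_scaler (f : V -> k) : scalar f ->
  bilinear_map (fun (u : U) (v : V) => f v *: u).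
Proof.
by move=> fL; split=> [v|u]; [exact: is_linear_scale|exact: linear_form_scale].
Qed.

End BilinearOps.

(** * Sums over coproducts *)

Section Coproducts.
Variables (k : fieldType) (A : hopf_data k).
Implicit Types (W : lmodType k).

(** Evaluating a bilinear map on the coproduct: two tensors are equal as soon as
all these values agree, so that identities of tensors become identities of
vectors, which can be rewritten. *)
Definition copf W (f : A -> A -> W) (x : A) : W := \sum_(p <- cop x) f p.1 p.2.

Definition cop_linear : Prop := forall (c : k) (x y : A),
  tensor_eq (cop (c *: x + y)) ([seq (c *: p.1, p.2) | p <- cop x] ++ cop y).

Definition cop_morph_at (x y : A) : Prop :=
  tensor_eq (cop (x ** y)) [seq (p.1 ** q.1, p.2 ** q.2) | p <- cop x, q <- cop y].

Lemma copf_linear W (f : A -> A -> W) : cop_linear -> bilinear_map f ->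
  linear (copf f).
Proof.
move=> cL fB c x y; rewrite /copf (cL c x y W f fB) big_cat big_map /=.
by congr (_ + _); rewrite scaler_sumr; apply: eq_bigr => p _; rewrite (linZ (fB.1 _)).
Qed.

Lemma copfM W (f : A -> A -> W) x y : cop_morph_at x y -> bilinear_map f ->
  copf f (x ** y) =
  \sum_(p <- cop x) copf (fun u v => f (p.1 ** u) (p.2 ** v)) y.
Proof. by move=> cM fB; rewrite /copf (cM W f fB) big_allpairs_dep. Qed.

End Coproducts.

Section TensorEq.
Variables (k : fieldType).

Lemma tensor_eqE (U V W : lmodType k) (s t : seq (U * V)) (f : U -> V -> W) :
  tensor_eq s t -> bilinear_map f ->
  \sum_(p <- s) f p.1 p.2 = \sum_(p <- t) f p.1 p.2.
Proof. by move=> st /st. Qed.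

End TensorEq.

Section AlgebraTheory.
Variables (k : fieldType) (A : hopf_data k).
Hypothesis algA : is_algebra A.
Implicit Types (x y z : A).

Lemma hmulA x y z : x ** (y ** z) = x ** y ** z.
Proof. by case: algA. Qed.
Lemma hmul1l x : hone A ** x = x. Proof. by case: algA. Qed.
Lemma hmul1r x : x ** hone A = x. Proof. by case: algA. Qed.
Lemma hmul_linl y : linear (fun x => x ** y). Proof. by case: algA => -[]. Qed.
Lemma hmul_linr x : linear (fun y => x ** y). Proof. by case: algA => -[]. Qed.

Lemma hmul0l y : 0 ** y = 0. Proof. exact: lin0 (hmul_linl y). Qed.
Lemma hmul0r x : x ** 0 = 0. Proof. exact: lin0 (hmul_linr x). Qed.
Lemma hmulDl x y z : (x + y) ** z = x ** z + y ** z.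
Proof. exact: linD (hmul_linl z) _ _. Qed.
Lemma hmulDr x y z : x ** (y + z) = x ** y + x ** z.
Proof. exact: linD (hmul_linr x) _ _. Qed.
Lemma hmulNl x y : (- x) ** y = - (x ** y).
Proof. exact: linN (hmul_linl y) _. Qed.
Lemma hmulNr x y : x ** (- y) = - (x ** y).
Proof. exact: linN (hmul_linr x) _. Qed.
Lemma hmulBl x y z : (x - y) ** z = x ** z - y ** z.
Proof. exact: linB (hmul_linl z) _ _. Qed.
Lemma hmulBr x y z : x ** (y - z) = x ** y - x ** z.
Proof. exact: linB (hmul_linr x) _ _. Qed.
Lemma hmulZl c x y : (c *: x) ** y = c *: (x ** y).
Proof. exact: linZ (hmul_linl y) _ _. Qed.
Lemma hmulZr c x y : x ** (c *: y) = c *: (x ** y).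
Proof. exact: linZ (hmul_linr x) _ _. Qed.
Lemma hmul_suml (J : Type) (s : seq J) (F : J -> A) y :
  (\sum_(j <- s) F j) ** y = \sum_(j <- s) F j ** y.
Proof. exact: (lin_sum (hmul_linl y)). Qed.
Lemma hmul_sumr (J : Type) (s : seq J) (F : J -> A) x :
  x ** (\sum_(j <- s) F j) = \sum_(j <- s) x ** F j.
Proof. exact: (lin_sum (hmul_linr x)). Qed.

End AlgebraTheory.

(** * Hopf algebras from generators *)

Section Generators.
Variables (k : fieldType) (A : hopf_data k) (I : Type) (a : I -> A).

Definition generated : Prop := forall P : A -> Prop,
  P (hone A) -> (forall c x y, P x -> P y -> P (c *: x + y)) ->
  (forall i x, P x -> P (a i ** x)) -> forall x, P x.

Hypotheses (algA : is_algebra A) (genA : generated).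
Hypothesis copL : cop_linear A.
Hypothesis cop1 : tensor_eq (cop (hone A)) [:: (hone A, hone A)].
Hypothesis copMg : forall i y, cop_morph_at (a i) y.
Hypothesis epsL : scalar (@eps _ A).
Hypothesis eps1 : eps (hone A) = 1.
Hypothesis epsMg : forall i y, eps (a i ** y) = eps (a i) * eps y.

Lemma cop_morph_of_generators (x y : A) : cop_morph_at x y.
Proof.
move: x; apply: genA => [|c x x' Hx Hx'|i x Hx] W f fB.
- rewrite hmul1l // big_allpairs_dep.
  rewrite (tensor_eqE (f := fun u v => \sum_(q <- cop y) f (u ** q.1) (v ** q.2)) cop1).
    by rewrite big_seq1; apply: eq_bigr => q _; rewrite !hmul1l.
  by apply: bilinear_sum => q; apply: bilinear_comp => //; apply: hmul_linl.
- rewrite (hmul_linl algA) -[LHS]/(copf f _) (copf_linear copL) //.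
  rewrite /copf Hx // Hx' // !big_allpairs_dep /=.
  rewrite (tensor_eqE (f := fun u v => \sum_(q <- cop y) f (u ** q.1) (v ** q.2)) (copL _ _ _)).
    rewrite big_cat big_map /=; congr (_ + _); rewrite scaler_sumr.
    apply: eq_bigr => p _; rewrite scaler_sumr; apply: eq_bigr => q _.
    by rewrite (linZ (hmul_linl algA _)) (linZ (fB.1 _)).
  by apply: bilinear_sum => q; apply: bilinear_comp => //; apply: hmul_linl.
- rewrite -(hmulA algA) -[LHS]/(copf f _) (copfM (@copMg _ _)) // big_allpairs_dep.
  rewrite -[RHS]/(copf (fun u v => \sum_(q <- cop y) f (u ** q.1) (v ** q.2)) _).
  rewrite (copfM (@copMg _ _)); last first.
    by apply: bilinear_sum => q; apply: bilinear_comp => //; apply: hmul_linl.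
  apply: eq_bigr => p _; rewrite /copf.
  rewrite (tensor_eqE (f := fun u v => f (p.1 ** u) (p.2 ** v)) Hx); last first.
    by apply: bilinear_comp => //; apply: hmul_linr.
  rewrite big_allpairs_dep; apply: eq_bigr => q _; apply: eq_bigr => r _.
  by rewrite !(hmulA algA).
Qed.

Lemma eps_morph_of_generators (x y : A) : eps (x ** y) = eps x * eps y.
Proof.
move: x; apply: genA => [|c x x' Hx Hx'|i x Hx].
- by rewrite hmul1l // eps1 mul1r.
- by rewrite (hmul_linl algA) !epsL Hx Hx' mulrDl mulrA.
- by rewrite -(hmulA algA) !epsMg Hx mulrA.
Qed.

Definition coassoc_at (x : A) : Prop :=
  forall (W : lmodType k) (f : A -> A -> A -> W), trilinear_map f ->
  \sum_(p <- cop x) \sum_(q <- cop p.1) f q.1 q.2 p.2 =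
  \sum_(p <- cop x) \sum_(q <- cop p.2) f p.1 q.1 q.2.

Hypothesis coassocg : forall i, coassoc_at (a i).
Hypothesis counitlg : forall i, \sum_(p <- cop (a i)) eps p.1 *: p.2 = a i.
Hypothesis counitrg : forall i, \sum_(p <- cop (a i)) eps p.2 *: p.1 = a i.

Let copM := cop_morph_of_generators.
Let epsM := eps_morph_of_generators.

Lemma trilinear12 (W : lmodType k) (f : A -> A -> A -> W) v : trilinear_map f ->
  bilinear_map (fun x y => f x y v).
Proof. by case=> f1 f2 f3; split. Qed.

Lemma trilinear23 (W : lmodType k) (f : A -> A -> A -> W) v : trilinear_map f ->
  bilinear_map (f v).
Proof. by case=> f1 f2 f3; split. Qed.

Lemma trilinear_comp (W : lmodType k) (f : A -> A -> A -> W) (g1 g2 g3 : A -> A) :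
  trilinear_map f -> linear g1 -> linear g2 -> linear g3 ->
  trilinear_map (fun x y z => f (g1 x) (g2 y) (g3 z)).
Proof.
case=> f1 f2 f3 l1 l2 l3; split=> u v.
- exact: (is_linear_comp (f1 (g2 u) (g3 v)) l1).
- exact: (is_linear_comp (f2 (g1 u) (g3 v)) l2).
- exact: (is_linear_comp (f3 (g1 u) (g2 v)) l3).
Qed.

Lemma bilinear_copl (W : lmodType k) (f : A -> A -> A -> W) : trilinear_map f ->
  bilinear_map (fun x y => copf (fun u v => f u v y) x).
Proof.
move=> fT; split=> [v|u].
  by apply: copf_linear => //; apply: trilinear12.
by apply: is_linear_sum => p; case: fT.
Qed.

Lemma bilinear_copr (W : lmodType k) (f : A -> A -> A -> W) : trilinear_map f ->
  bilinear_map (fun x y => copf (f x) y).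
Proof.
move=> fT; split=> [v|u]; last by apply: copf_linear => //; apply: trilinear23.
by apply: is_linear_sum => p; case: fT.
Qed.

Lemma coassoc_of_generators (x : A) : coassoc_at x.
Proof.
move: x; apply: genA => [|c x x' Hx Hx'|i x Hx] W f fT.
- have fB := bilinear_copl fT; have fB' := bilinear_copr fT.
  rewrite (tensor_eqE cop1 fB) (tensor_eqE cop1 fB') !big_seq1 /= /copf.
  by rewrite (tensor_eqE cop1 (trilinear12 _ fT)) (tensor_eqE cop1 (trilinear23 _ fT)) !big_seq1.
- have fB := bilinear_copl fT; have fB' := bilinear_copr fT.
  rewrite -[LHS]/(copf (fun x y => copf (fun u v => f u v y) x) _).
  rewrite -[RHS]/(copf (fun x y => copf (f x) y) _) !copf_linear //.
  by rewrite /copf Hx // Hx'.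
- have fB := bilinear_copl fT; have fB' := bilinear_copr fT.
  rewrite -[LHS]/(copf (fun x y => copf (fun u v => f u v y) x) _).
  rewrite -[RHS]/(copf (fun x y => copf (f x) y) _) !(copfM (@copM _ _)) //.
  transitivity (\sum_(p <- cop (a i)) \sum_(p' <- cop p.1)
    \sum_(q <- cop x) \sum_(q' <- cop q.1)
       f (p'.1 ** q'.1) (p'.2 ** q'.2) (p.2 ** q.2)).
    apply: eq_bigr => p _; rewrite exchange_big /=; apply: eq_bigr => q _.
    by rewrite copfM //; apply: trilinear12.
  transitivity (\sum_(p <- cop (a i)) \sum_(p' <- cop p.2)
    \sum_(q <- cop x) \sum_(q' <- cop q.2)
       f (p.1 ** q.1) (p'.1 ** q'.1) (p'.2 ** q'.2)); last first.
    apply: eq_bigr => p _; rewrite exchange_big /=; apply: eq_bigr => q _.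
    by rewrite copfM //; apply: trilinear23.
  rewrite (@coassocg i W (fun u v w => \sum_(q <- cop x) \sum_(q' <- cop q.1)
       f (u ** q'.1) (v ** q'.2) (w ** q.2))); last first.
    case: fT => f1 f2 f3.
    split=> u v; apply: is_linear_sum => q; apply: is_linear_sum => q'.
    + exact: is_linear_comp (f1 _ _) (hmul_linl algA _).
    + exact: is_linear_comp (f2 _ _) (hmul_linl algA _).
    + exact: is_linear_comp (f3 _ _) (hmul_linl algA _).
  apply: eq_bigr => p _; apply: eq_bigr => p' _.
  rewrite (Hx W (fun u v w => f (p.1 ** u) (p'.1 ** v) (p'.2 ** w))) //.
  by apply: (trilinear_comp fT); apply: hmul_linr.
Qed.

Lemma bilinear_epsl : bilinear_map (fun x y : A => eps x *: y).
Proof. exact: bilinear_scalel. Qed.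

Lemma bilinear_epsr : bilinear_map (fun x y : A => eps y *: x).
Proof. exact: bilinear_scaler. Qed.

Lemma counitl_of_generators (x : A) : \sum_(p <- cop x) eps p.1 *: p.2 = x.
Proof.
rewrite -[LHS]/(copf (fun x y => eps x *: y) _); have fB := bilinear_epsl.
move: x; apply: genA => [|c x x' Hx Hx'|i x Hx].
- by rewrite /copf (tensor_eqE cop1 fB) big_seq1 eps1 scale1r.
- by rewrite copf_linear // Hx Hx'.
- rewrite (copfM (@copM _ _)) // -[in RHS]Hx -[in RHS](counitlg i).
  rewrite (lin_sum (hmul_linl algA _)); apply: eq_bigr => p _.
  rewrite (lin_sum (hmul_linr algA _)); apply: eq_bigr => q _.
  by rewrite epsM (linZ (hmul_linl algA _)) (linZ (hmul_linr algA _)) scalerA.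
Qed.

Lemma counitr_of_generators (x : A) : \sum_(p <- cop x) eps p.2 *: p.1 = x.
Proof.
rewrite -[LHS]/(copf (fun x y => eps y *: x) _); have fB := bilinear_epsr.
move: x; apply: genA => [|c x x' Hx Hx'|i x Hx].
- by rewrite /copf (tensor_eqE cop1 fB) big_seq1 eps1 scale1r.
- by rewrite copf_linear // Hx Hx'.
- rewrite (copfM (@copM _ _)) // -[in RHS]Hx -[in RHS](counitrg i).
  rewrite (lin_sum (hmul_linl algA _)); apply: eq_bigr => p _.
  rewrite (lin_sum (hmul_linr algA _)); apply: eq_bigr => q _.
  by rewrite epsM (linZ (hmul_linl algA _)) (linZ (hmul_linr algA _)) scalerA.
Qed.

Variable S : A -> A.
Hypotheses (SL : linear S) (S1 : S (hone A) = hone A).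
Hypothesis SM : forall x y, S (x ** y) = S y ** S x.
Hypothesis Slg : forall i, \sum_(p <- cop (a i)) S p.1 ** p.2 = eps (a i) *: hone A.
Hypothesis Srg : forall i, \sum_(p <- cop (a i)) p.1 ** S p.2 = eps (a i) *: hone A.

Lemma bilinear_hmul (B : hopf_data k) (g h : B -> A) : linear g -> linear h ->
  bilinear_map (fun x y => g x ** h y).
Proof. by move=> gL hL; apply: bilinear_comp => //; case: algA. Qed.

Lemma antipodel_of_generators (x : A) : \sum_(p <- cop x) S p.1 ** p.2 = eps x *: hone A.
Proof.
rewrite -[LHS]/(copf (fun x y => S x ** y) _).
have fB := bilinear_hmul SL (@is_linear_id _ A).
move: x; apply: genA => [|c x x' Hx Hx'|i x Hx].
- by rewrite /copf (tensor_eqE cop1 fB) big_seq1 S1 eps1 scale1r hmul1l.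
- by rewrite copf_linear // Hx Hx' epsL scalerDl scalerA.
- rewrite (copfM (@copM _ _)) // /copf exchange_big /=.
  transitivity (\sum_(q <- cop x) S q.1 ** ((eps (a i) *: hone A) ** q.2)).
    apply: eq_bigr => q _; rewrite -Slg (lin_sum (hmul_linl algA _)).
    rewrite (lin_sum (hmul_linr algA _)); apply: eq_bigr => p _.
    by rewrite SM !(hmulA algA).
  rewrite epsM -scalerA -Hx scaler_sumr; apply: eq_bigr => q _.
  by rewrite (linZ (hmul_linl algA _)) (linZ (hmul_linr algA _)) hmul1l.
Qed.

Lemma antipoder_of_generators (x : A) : \sum_(p <- cop x) p.1 ** S p.2 = eps x *: hone A.
Proof.
rewrite -[LHS]/(copf (fun x y => x ** S y) _).
have fB := bilinear_hmul (@is_linear_id _ A) SL.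
move: x; apply: genA => [|c x x' Hx Hx'|i x Hx].
- by rewrite /copf (tensor_eqE cop1 fB) big_seq1 S1 eps1 scale1r hmul1l.
- by rewrite copf_linear // Hx Hx' epsL scalerDl scalerA.
- rewrite (copfM (@copM _ _)) // /copf.
  transitivity (\sum_(p <- cop (a i)) p.1 ** ((eps x *: hone A) ** S p.2)).
    apply: eq_bigr => p _; rewrite -Hx (lin_sum (hmul_linl algA _)).
    rewrite (lin_sum (hmul_linr algA _)); apply: eq_bigr => q _.
    by rewrite SM !(hmulA algA).
  rewrite epsM mulrC -scalerA -Srg scaler_sumr; apply: eq_bigr => q _.
  by rewrite (linZ (hmul_linl algA _)) (linZ (hmul_linr algA _)) hmul1l.
Qed.

(** All the Hopf algebra axioms are identities between maps that are
multiplicative or anti-multiplicative, hence follow from their instances on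
generators. *)
Lemma hopf_of_generators : is_hopf A.
Proof.
split.
- exact: algA.
- split; [exact: copL|exact: epsL|exact: coassoc_of_generators
         |exact: counitl_of_generators|exact: counitr_of_generators].
- by split; [exact: cop1|exact: cop_morph_of_generators].
- by split; [exact: eps1|exact: eps_morph_of_generators].
- exists S; split; [exact: SL|exact: antipodel_of_generators
                   |exact: antipoder_of_generators].
Qed.

End Generators.

(** * Free algebras *)

Section Opposite.
Variable k : fieldType.

Definition opp_alg (B : hopf_data k) : hopf_data k :=
  @HopfData k B (fun x y => y ** x) (hone B) (@cop k B) (@eps k B).

Lemma opp_is_algebra B : is_algebra B -> is_algebra (opp_alg B).
Proof.
case=> -[bl br] mA m1l m1r; split; [by split| |exact: m1r|exact: m1l].
by move=> x y z; exact: esym (mA z y x).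
Qed.

End Opposite.

Lemma mul_regroup (L : pzRingType) (u x y z v : L) :
  u * (x * y * z) * v = u * x * y * (z * v).
Proof. by rewrite !mulrA. Qed.

Lemma mul_mid0 (L : pzRingType) (u v : L) : u * 0 * v = 0.
Proof. by rewrite mulr0 mul0r. Qed.

Lemma mul_midD (L : pzRingType) (u x y v : L) :
  u * (x + y) * v = u * x * v + u * y * v.
Proof. by rewrite mulrDr mulrDl. Qed.

Lemma mul_mid1 (L : pzRingType) (x : L) : 1 * x * 1 = x.
Proof. by rewrite mul1r mulr1. Qed.

Section SpannedByWords.
Variables (k : fieldType) (I : Type) (L : lalgType k) (g : I -> L).

Definition words_span : Prop := forall P : L -> Prop, P 1 ->
  (forall c x y, P x -> P y -> P (c *: x + y)) ->
  (forall i x, P x -> P (g i * x)) -> forall x, P x.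

Lemma mul_scale_sum (J : Type) (s : seq J) (b : J -> k) (v : J -> L) (z : L) (c : k) :
  (forall a j, z * (a *: v j) = a *: (z * v j)) ->
  z * (c *: \sum_(j <- s) b j *: v j) = c *: (z * \sum_(j <- s) b j *: v j).
Proof.
move=> zv; rewrite scaler_sumr !mulr_sumr scaler_sumr; apply: eq_bigr => j _.
by rewrite scalerA !zv scalerA.
Qed.

Hypothesis spanL : words_span.

(** The free algebra comes with the compatibility of scalars with the left factor of
a product; the one with the right factor is propagated from the generators. *)
Lemma scalerAr_of_gen : (forall i c (x : L), g i * (c *: x) = c *: (g i * x)) ->
  forall c (x y : L), x * (c *: y) = c *: (x * y).
Proof.
move=> gZ c x y; move: x; apply: spanL => [|b x x' Hx Hx'|i x Hx].
- by rewrite !mul1r.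
- by rewrite !mulrDl -!scalerAl Hx Hx' scalerDr !scalerA mulrC.
- by rewrite -!mulrA Hx gZ.
Qed.

Lemma morph_of_gen (A : hopf_data k) (a : I -> A) (f : L -> A) : is_algebra A ->
  linear f -> f 1 = hone A -> (forall i x, f (g i * x) = a i ** f x) ->
  forall x y, f (x * y) = f x ** f y.
Proof.
move=> algA fL f1 fg x y; move: x; apply: spanL => [|c x x' Hx Hx'|i x Hx].
- by rewrite mul1r f1 hmul1l.
- by rewrite mulrDl -scalerAl !fL Hx Hx' (hmul_linl algA).
- by rewrite -mulrA !fg Hx (hmulA algA).
Qed.

End SpannedByWords.

Section FreeAlgebra.
Variables (k : fieldType) (I : choiceType).
Local Notation F := (free_alg k I).

Definition word (w : seq I) : F := << FMonom w >>.

Lemma word_nil : word [::] = 1.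
Proof. by rewrite /word -fmoneE. Qed.

Lemma wordM u v : word u * word v = word (u ++ v).
Proof. by rewrite /word malgM_def fgmulUU mulr1 /mmul /= fmmulE. Qed.

Lemma word_cons i w : word (i :: w) = gen k i * word w.
Proof. by rewrite /gen fmuE wordM. Qed.

Lemma word_prod w : word w = \prod_(i <- w) gen k i.
Proof.
elim: w => [|i w IH]; first by rewrite big_nil word_nil.
by rewrite big_cons word_cons IH.
Qed.

Lemma free_algE (t : F) : t = \sum_(w <- msupp t) t@_w *: word w.
Proof.
rewrite [LHS]monalgE; apply: eq_bigr => w _; apply/malgP => v.
by rewrite mcoeffZ !mcoeffU fmK; case: (w == v); rewrite ?mulr1 ?mulr0.
Qed.

Lemma free_ind (P : F -> Prop) : P 1 -> (forall c x y, P x -> P y -> P (c *: x + y)) ->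
  (forall i x, P x -> P (gen k i * x)) -> forall x, P x.
Proof.
move=> P1 PL Pg t.
have P0 : P 0 by have := PL (-1) _ _ P1 P1; rewrite scaleN1r addNr.
rewrite [t]free_algE; elim: (X in \sum_(w <- X) _) => [|w s IH].
  by rewrite big_nil.
rewrite big_cons; apply: PL => //.
by elim: (w : seq I) => [|i v IHv]; rewrite ?word_nil // word_cons; apply: Pg.
Qed.

Lemma scale_word c w : c *: word w = << c *g FMonom w >>.
Proof.
apply/malgP => u; rewrite mcoeffZ (mcoeffU (FMonom w) 1) mcoeffU.
by case: (_ == u); rewrite /= ?mulr1 ?mulr0.
Qed.

Lemma gen_scale_word i c w : gen k i * (c *: word w) = c *: word (i :: w).
Proof. by rewrite !scale_word /gen fmuE malgM_def fgmulUU mul1r /mmul /= fmmulE. Qed.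

Lemma gen_scaler i c (x : F) : gen k i * (c *: x) = c *: (gen k i * x).
Proof.
rewrite [x]free_algE; apply: mul_scale_sum => b w.
by rewrite gen_scale_word word_cons.
Qed.

Lemma free_alg_span : @words_span k I F (@gen k I).
Proof. exact: free_ind. Qed.

Lemma free_scalerAr c (x y : F) : x * (c *: y) = c *: (x * y).
Proof. apply: scalerAr_of_gen; [exact: free_alg_span|exact: gen_scaler]. Qed.

Section Extension.
Variable W : lmodType k.
Implicit Types phi : seq I -> W.

(** Words form a basis of the free algebra: this is the linear map with values phi on it. *)
Definition wext phi (t : F) : W := \sum_(w <- msupp t) t@_w *: phi w.

Lemma wextEw phi (d : {fset {fmonom I}}) (t : F) : (msupp t `<=` d)%fset ->
  wext phi t = \sum_(w <- d) t@_w *: phi w.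
Proof.
move=> sub; rewrite /wext; apply: big_fset_incl => // w _ /mcoeff_outdom ->.
by rewrite scale0r.
Qed.

Lemma wext_linear phi : linear (wext phi).
Proof.
move=> c x y; pose d := (msupp x `|` msupp y)%fset.
rewrite !(@wextEw _ d) ?fsubsetUl ?fsubsetUr //; last first.
  apply: fsubset_trans (msuppD_le _ _) _; apply: fsetSU; exact: msuppZ_le.
rewrite scaler_sumr -big_split /=; apply: eq_bigr => w _.
by rewrite mcoeffD mcoeffZ scalerDl scalerA.
Qed.

Lemma wext_word phi w : wext phi (word w) = phi w.
Proof.
rewrite /wext /word msuppU oner_eq0 big_seq_fset1 mcoeffUU scale1r //.
Qed.

Lemma eq_linear_words (f g : F -> W) : linear f -> linear g ->
  (forall w, f (word w) = g (word w)) -> f =1 g.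
Proof.
move=> fL gL fg t; rewrite [t]free_algE (lin_sum fL) (lin_sum gL).
by apply: eq_bigr => w _; rewrite (linZ fL) (linZ gL) fg.
Qed.

Lemma eq_wext phi psi : phi =1 psi -> wext phi =1 wext psi.
Proof. by move=> E t; apply: eq_bigr => w _; rewrite E. Qed.

End Extension.

Lemma sum_lin_ext (U V W : lmodType k) (D : seq I -> seq (U * V))
    (f : U -> V -> W) t : bilinear_map f ->
  \sum_(p <- lin_ext D t) f p.1 p.2 =
  wext (fun w => \sum_(p <- D w) f p.1 p.2) t.
Proof.
move=> [fl _]; rewrite /lin_ext big_allpairs_dep; apply: eq_bigr => w _.
by rewrite scaler_sumr; apply: eq_bigr => p _; rewrite (linZ (fl _)).
Qed.

Section Eval.
Variables (A : hopf_data k) (a : I -> A).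

(** The algebra map out of the free algebra with given values on generators. *)
Definition ev : F -> A := wext (foldr (fun i => hmul (a i)) (hone A)).

Lemma ev_linear : linear ev. Proof. exact: wext_linear. Qed.

Lemma ev1 : ev 1 = hone A.
Proof. by rewrite -word_nil /ev wext_word. Qed.

Hypothesis algA : is_algebra A.

Lemma ev_genM i t : ev (gen k i * t) = a i ** ev t.
Proof.
move: t; apply: eq_linear_words => [c x y|c x y|w].
- by rewrite mulrDr free_scalerAr ev_linear.
- by rewrite ev_linear (hmul_linr algA).
- by rewrite -word_cons /ev !wext_word.
Qed.

Lemma evM s t : ev (s * t) = ev s ** ev t.
Proof.
move: s t; apply: morph_of_gen algA ev_linear ev1 ev_genM; exact: free_alg_span.
Qed.

Lemma ev_gen i : ev (gen k i) = a i.
Proof. by rewrite -[gen k i]mulr1 ev_genM ev1 hmul1r. Qed.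

End Eval.

Section EvalOpp.
Variables (A : hopf_data k) (a : I -> A).

(** The anti-multiplicative counterpart of [ev], used for antipodes. *)
Definition ev_opp : F -> A := @ev (opp_alg A) a.

End EvalOpp.

End FreeAlgebra.

(** * Presented algebras *)

Section PresentedAlg.
Variables (k : fieldType) (I : choiceType) (R : free_alg k I -> Prop).
Local Notation F := (free_alg k I).
Local Notation Q := (presented R).

Lemma proj_is_linear : linear (@proj k I R).
Proof. by move=> c x y; rewrite projD projZ. Qed.

Lemma proj1 : proj R 1 = 1. Proof. by []. Qed.

Lemma projMr x y : proj R (x * y) = proj R x * proj R y.
Proof. exact: projM. Qed.

Lemma projZr c x : c *: proj R x = proj R (c *: x).
Proof. by rewrite projZ. Qed.

Lemma qscalerAl (c : k) (x y : Q) : c *: (x * y) = c *: x * y.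
Proof.
rewrite -[x]repK -[y]repK -projMr projZr projZr -projMr.
by congr proj; exact: scalerAl.
Qed.

Lemma qscalerAr (c : k) (x y : Q) : c *: (x * y) = x * (c *: y).
Proof.
rewrite -[x]repK -[y]repK -projMr projZr projZr -projMr.
by congr proj; rewrite free_scalerAr.
Qed.

Lemma presented_is_algebra d e : is_algebra (presented_hopf R d e).
Proof.
split; [|exact: mulrA|exact: mul1r|exact: mulr1].
split=> u c x y; first by rewrite qscalerAl /= mulrDl.
by rewrite qscalerAr /= mulrDr.
Qed.

Definition qgen (i : I) : Q := proj R (gen k i).

Lemma proj_rel r : R r -> proj R r = 0.
Proof.
move=> Rr; rewrite -[0 in RHS](lin0 proj_is_linear); apply/projE.
by rewrite subr0 => J _; apply.
Qed.

Lemma pres_ind (P : Q -> Prop) : P 1 -> (forall c x y, P x -> P y -> P (c *: x + y)) ->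
  (forall i x, P x -> P (qgen i * x)) -> forall x, P x.
Proof.
move=> P1 PL Pg x; rewrite -[x]repK.
elim/free_ind: (rep x) => [|c y z|i y] //.
- by rewrite proj_is_linear; apply: PL.
- by rewrite projMr; apply: Pg.
Qed.

Lemma gen_ideal_mono (R' : F -> Prop) : (forall r, R r -> gen_ideal R' r) ->
  forall x, gen_ideal R x -> gen_ideal R' x.
Proof. by move=> sub x; apply => //; exact: gen_ideal_two_sided. Qed.

(** The t such that g kills all the x t y form a two-sided ideal. This also applies to
linear maps that are not multiplicative, such as the coproduct followed by a bilinear
map. *)
Lemma lin_kill (W : lmodType k) (g : F -> W) : linear g ->
  (forall r, R r -> forall u v, g (u * r * v) = 0) ->
  forall t, gen_ideal R t -> g t = 0.
Proof.
move=> gL gR t It.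
have K : two_sided_ideal (fun t => forall u v, g (u * t * v) = 0).
  split=> [u v|x y Hx Hy u v|x y z Hy u v].
  - rewrite mul_mid0; exact: lin0.
  - rewrite mul_midD (linD gL); exact: etrans (congr2 +%R (Hx u v) (Hy u v)) (addr0 0).
  - rewrite mul_regroup; exact: Hy.
rewrite -(mul_mid1 t); apply: (It _ K) => r Rr; exact: gR.
Qed.

Lemma lin_rep (W : lmodType k) (g : F -> W) : linear g ->
  (forall t, gen_ideal R t -> g t = 0) -> forall t, g (rep (proj R t)) = g t.
Proof.
move=> gL gR t; apply/eqP; rewrite -subr_eq0 -(linB gL) gR //.
exact/gen_idealP/rep_proj.
Qed.

Section Univ.
Variables (A : hopf_data k) (a : I -> A).
Hypothesis algA : is_algebra A.
Hypothesis aR : forall r, R r -> ev a r = 0.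

Lemma ev_ideal t : gen_ideal R t -> ev a t = 0.
Proof.
apply: lin_kill; first exact: ev_linear.
move=> r Rr u v; rewrite (evM a algA) (evM a algA) (aR Rr).
by rewrite hmul0r // hmul0l.
Qed.

Definition qev (x : Q) : A := ev a (rep x).

Lemma qev_proj t : qev (proj R t) = ev a t.
Proof. by apply: lin_rep; [exact: ev_linear|exact: ev_ideal]. Qed.

Lemma qev_linear : linear qev.
Proof.
move=> c x y; rewrite -[x]repK -[y]repK -proj_is_linear !qev_proj.
exact: ev_linear.
Qed.

Lemma qev1 : qev 1 = hone A. Proof. by rewrite -proj1 qev_proj ev1. Qed.

Lemma qevM x y : qev (x * y) = qev x ** qev y.
Proof. by rewrite -[x]repK -[y]repK -projMr !qev_proj evM. Qed.

Lemma qev_gen i : qev (qgen i) = a i.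
Proof. by rewrite qev_proj ev_gen. Qed.

End Univ.

Section UnivOpp.
Variables (A : hopf_data k) (a : I -> A).
Hypothesis algA : is_algebra A.
Hypothesis aR : forall r, R r -> ev_opp a r = 0.

Definition qev_opp (x : Q) : A := ev_opp a (rep x).

Lemma qev_opp_linear : linear qev_opp.
Proof. exact: (@qev_linear (opp_alg A) a (opp_is_algebra algA) aR). Qed.

Lemma qev_opp1 : qev_opp 1 = hone A.
Proof. exact: (@qev1 (opp_alg A) a (opp_is_algebra algA) aR). Qed.

Lemma qev_oppM x y : qev_opp (x * y) = qev_opp y ** qev_opp x.
Proof. exact: (@qevM (opp_alg A) a (opp_is_algebra algA) aR). Qed.

Lemma qev_opp_gen i : qev_opp (qgen i) = a i.
Proof. exact: (@qev_gen (opp_alg A) a (opp_is_algebra algA) aR). Qed.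

End UnivOpp.

End PresentedAlg.

Section AbstractCoproduct.
Variables (k : fieldType) (I : Type) (L : lalgType k) (g : I -> L).
Variables (A : hopf_data k) (d : I -> seq (L * L)) (pi : L -> A).
Implicit Types W : lmodType k.
Variable value : forall W : lmodType k, (A -> A -> W) -> L -> W.
Hypotheses (spanL : words_span g) (algA : is_algebra A).
Hypothesis scalerAr_of : forall c (x y : L), x * (c *: y) = c *: (x * y).
Hypothesis valueL : forall W f, linear (@value W f).
Hypothesis value1 : forall W f, @value W f 1 = f (hone A) (hone A).
Hypothesis value_genM : forall W (f : A -> A -> W) i t, bilinear_map f ->
  value f (g i * t) =
  \sum_(p <- d i) value (fun u v => f (pi p.1 ** u) (pi p.2 ** v)) t.
Hypothesis eq_value : forall W (f h : A -> A -> W), f =2 h -> value f =1 value h.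

Lemma bilinear_mull (W : lmodType k) (f : A -> A -> W) x y : bilinear_map f ->
  bilinear_map (fun u v => f (x ** u) (y ** v)).
Proof. by move=> fB; apply: bilinear_comp => //; apply: (hmul_linr algA). Qed.

Lemma bilinear_mulr (W : lmodType k) (f : A -> A -> W) x y : bilinear_map f ->
  bilinear_map (fun u v => f (u ** x) (v ** y)).
Proof. by move=> fB; apply: bilinear_comp => //; apply: (hmul_linl algA). Qed.

Lemma value_Mgen W (f : A -> A -> W) t i : bilinear_map f ->
  value f (t * g i) =
  \sum_(p <- d i) value (fun u v => f (u ** pi p.1) (v ** pi p.2)) t.
Proof.
move=> fB; move: t W f fB; apply: spanL => [|c x y Hx Hy|j x Hx] W f fB.
- rewrite mul1r -[g i]mulr1 value_genM //; apply: eq_bigr => p _.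
  by rewrite !value1 !hmul1l // !hmul1r.
- rewrite mulrDl -scalerAl valueL Hx // Hy // scaler_sumr -big_split.
  by apply: eq_bigr => q _; rewrite /= valueL.
- rewrite -mulrA value_genM //.
  transitivity (\sum_(p <- d j) \sum_(q <- d i)
      value (fun u v => f (pi p.1 ** (u ** pi q.1)) (pi p.2 ** (v ** pi q.2))) x).
    apply: eq_bigr => p _; rewrite (Hx _ (fun u v => f (pi p.1 ** u) (pi p.2 ** v))) //.
    exact: bilinear_mull.
  rewrite exchange_big; apply: eq_bigr => q _; rewrite value_genM; last first.
    exact: bilinear_mulr.
  apply: eq_bigr => p _; apply: eq_value => u v.
  by rewrite !(hmulA algA).
Qed.

(** Since the coproduct is multiplicative, these elements form a two-sided ideal; the
coproduct of a presented algebra is therefore well defined as soon as the relations are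
killed. *)
Definition killed (r : L) : Prop :=
  forall W (f : A -> A -> W), bilinear_map f -> value f r = 0.

Lemma value_Ml u r : killed r -> killed (u * r).
Proof.
move=> rK; move: u; apply: spanL => [|c x y Hx Hy|j x Hx] W f fB.
- by rewrite mul1r rK.
- by rewrite mulrDl -scalerAl valueL Hx // Hy // scaler0 addr0.
- rewrite -mulrA value_genM // big1 // => p _; apply: Hx.
  exact: bilinear_mull.
Qed.

Lemma value_Mr r v : killed r -> killed (r * v).
Proof.
move: v r; apply: spanL => [|c x y Hx Hy|j x Hx] r rK W f fB.
- by rewrite mulr1 rK.
- by rewrite mulrDr scalerAr_of valueL Hx // Hy // scaler0 addr0.
- rewrite mulrA; apply: Hx => // W' h hB.
  rewrite value_Mgen // big1 // => p _; apply: rK.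
  exact: bilinear_mulr.
Qed.

End AbstractCoproduct.

Section PresentedHopf.
Variables (k : fieldType) (I : choiceType) (R : free_alg k I -> Prop).
Variables (d : I -> seq (free_alg k I * free_alg k I)) (e : I -> k).
Local Notation F := (free_alg k I).
Local Notation A := (presented_hopf R d e).
Local Notation qg := (@qgen k I R).
Implicit Types W : lmodType k.

Lemma ev_proj t : ev (A := A) qg t = proj R t.
Proof.
move: t; apply: eq_linear_words => [||w]; [exact: ev_linear|exact: proj_is_linear|].
rewrite /ev wext_word; elim: w => [|i w IH]; first by rewrite word_nil.
by rewrite /= IH word_cons projMr.
Qed.

(** The ground field, as the target of the counit. *)
Definition base_alg : hopf_data k :=
  @HopfData k k^o *%R 1 (fun _ => [::]) (fun _ => 0).

Lemma base_is_algebra : is_algebra base_alg.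
Proof.
split; [|exact: mulrA|exact: mul1r|exact: mulr1].
split=> u c x y; rewrite /= /GRing.scale /= ?mulrDl ?mulrA //.
by rewrite mulrDr mulrCA mulrA.
Qed.

(** The coproduct of a presented algebra is computed on representatives chosen in the free
algebra; this is its value before that choice. *)
Definition free_copf W (f : A -> A -> W) : F -> W :=
  wext (fun w => \sum_(p <- cop_word d w) f (proj R p.1) (proj R p.2)).

Let algA : is_algebra A := presented_is_algebra R d e.

Lemma free_copf_linear W (f : A -> A -> W) : linear (free_copf f).
Proof. exact: wext_linear. Qed.

Lemma free_copf_word W (f : A -> A -> W) w : free_copf f (word k w) =
  \sum_(p <- cop_word d w) f (proj R p.1) (proj R p.2).
Proof. exact: wext_word. Qed.

Lemma free_copf1 W (f : A -> A -> W) : free_copf f 1 = f (hone A) (hone A).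
Proof. by rewrite -word_nil free_copf_word /= big_seq1. Qed.

Lemma free_copf_genM W (f : A -> A -> W) i t : bilinear_map f ->
  free_copf f (gen k i * t) =
  \sum_(p <- d i) free_copf (fun u v => f ((proj R p.1 : A) ** u) ((proj R p.2 : A) ** v)) t.
Proof.
move=> fB; move: t; apply: eq_linear_words => [c x y||w].
- by rewrite mulrDr free_scalerAr; exact: free_copf_linear.
- by apply: is_linear_sum => p; exact: free_copf_linear.
- rewrite -word_cons free_copf_word /= big_allpairs_dep.
  apply: eq_bigr => p _; rewrite free_copf_word; apply: eq_bigr => q _.
  exact: (congr2 f (projMr _ _ _) (projMr _ _ _)).
Qed.

Lemma free_copf_gen W (f : A -> A -> W) i : bilinear_map f ->
  free_copf f (gen k i) = \sum_(p <- d i) f (proj R p.1) (proj R p.2).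
Proof.
move=> fB; rewrite -[gen k i]mulr1 free_copf_genM //.
by apply: eq_bigr => p _; rewrite free_copf1 !(hmul1r algA).
Qed.

Lemma eq_free_copf W (f g : A -> A -> W) : f =2 g -> free_copf f =1 free_copf g.
Proof. by move=> fg; apply: eq_wext => w; apply: eq_bigr => p _; rewrite fg. Qed.

Hypothesis copR : forall W (f : A -> A -> W), bilinear_map f ->
  forall r, R r -> free_copf f r = 0.

Lemma free_copf_ideal W (f : A -> A -> W) t : bilinear_map f ->
  gen_ideal R t -> free_copf f t = 0.
Proof.
move=> fB; apply: lin_kill; first exact: free_copf_linear.
move=> r Rr u v; rewrite -mulrA.
have rK : killed (@free_copf) r by move=> W' h hB; exact: copR.
have rvK := value_Mr (@free_alg_span k I) algA (@free_scalerAr k I) free_copf_linear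
  free_copf1 free_copf_genM eq_free_copf v rK.
exact: (value_Ml (@free_alg_span k I) algA free_copf_linear free_copf_genM u rvK).
Qed.

Lemma copf_rep W (f : A -> A -> W) (x : A) : bilinear_map f ->
  copf f x = free_copf f (rep x).
Proof.
move=> fB; rewrite /copf /= big_map /=.
rewrite (sum_lin_ext _ _ (f := fun u v => f (proj R u) (proj R v))) //.
by apply: bilinear_comp => //; exact: proj_is_linear.
Qed.

Lemma copf_proj W (f : A -> A -> W) t : bilinear_map f ->
  copf f (proj R t : A) = free_copf f t.
Proof.
move=> fB; rewrite copf_rep //; apply: lin_rep; first exact: free_copf_linear.
by move=> s; exact: free_copf_ideal.
Qed.

Lemma presented_cop_linear : cop_linear A.
Proof.
move=> c x y W f fB; rewrite -[LHS]/(copf f _) -[x]repK -[y]repK.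
rewrite -(@proj_is_linear _ _ R c) copf_proj // free_copf_linear.
rewrite big_cat big_map -!copf_proj //= /copf; congr (_ + _).
by rewrite scaler_sumr; apply: eq_bigr => p _; rewrite (linZ (fB.1 _)).
Qed.

Lemma presented_cop_gen i : tensor_eq (cop (qg i : A))
  [seq (proj R p.1, proj R p.2) | p <- d i].
Proof.
move=> W f fB; rewrite -[LHS]/(copf f (proj R (gen k i) : A)) copf_proj //.
by rewrite free_copf_gen // big_map.
Qed.

Lemma presented_cop1 : tensor_eq (cop (hone A)) [:: (hone A, hone A)].
Proof.
move=> W f fB; rewrite -[LHS]/(copf f (proj R 1 : A)) copf_proj //.
by rewrite free_copf1 big_seq1.
Qed.

Lemma proj_hmul x y : proj R (x * y) = (proj R x : A) ** (proj R y : A).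
Proof. exact: projMr. Qed.

Lemma presented_cop_genM i (y : A) : cop_morph_at (qg i : A) y.
Proof.
move=> W f fB; rewrite -[y]repK -[LHS]/(copf f _) -proj_hmul copf_proj //.
rewrite free_copf_genM // big_allpairs_dep.
rewrite (tensor_eqE (f := fun u v => \sum_(q <- cop (proj R (rep y) : A))
  f (u ** q.1) (v ** q.2)) (presented_cop_gen i)); last first.
  by apply: bilinear_sum => q; apply: bilinear_comp => //; apply: (hmul_linl algA).
rewrite big_map; apply: eq_bigr => p _; rewrite -copf_proj //.
by apply: bilinear_comp => //; apply: (hmul_linr algA).
Qed.

Lemma eps_rep (x : A) : eps x = ev (A := base_alg) e (rep x).
Proof.
rewrite /eps /= /ev /wext; apply: eq_bigr => w _; congr (_ * _).
by elim: (w : seq I) => [|i v IH] /=; rewrite ?big_nil // big_cons IH.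
Qed.

Hypothesis epsR : forall r, R r -> ev (A := base_alg) e r = 0.

Lemma eps_qev (x : A) : eps x = qev (A := base_alg) e x.
Proof. exact: eps_rep. Qed.

Lemma presented_eps_proj t : eps (proj R t : A) = ev (A := base_alg) e t.
Proof. by rewrite eps_qev qev_proj //; exact: base_is_algebra. Qed.

Lemma presented_eps_linear : scalar (@eps _ A).
Proof.
move=> c x y; rewrite !eps_qev; exact: (qev_linear base_is_algebra epsR c x y).
Qed.

Lemma presented_epsM (x y : A) : eps (x ** y) = eps x * eps y.
Proof. rewrite !eps_qev; exact: (qevM base_is_algebra epsR x y). Qed.

Lemma presented_eps1 : eps (hone A) = 1.
Proof. rewrite eps_qev; exact: (qev1 base_is_algebra epsR). Qed.

Lemma presented_eps_gen i : eps (qg i : A) = e i.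
Proof. rewrite eps_qev; exact: (qev_gen base_is_algebra epsR i). Qed.

Lemma presented_generated : generated (A := A) qg.
Proof. exact: pres_ind. Qed.

Hypothesis coassocg : forall i, coassoc_at (qg i : A).
Hypothesis counitlg : forall i, \sum_(p <- d i) eps (proj R p.1 : A) *: proj R p.2 = qg i.
Hypothesis counitrg : forall i, \sum_(p <- d i) eps (proj R p.2 : A) *: proj R p.1 = qg i.

Variable S : I -> A.
Hypothesis SR : forall r, R r -> ev_opp S r = 0.
Let SS := qev_opp (R := R) S.
Hypothesis Slg : forall i,
  \sum_(p <- d i) SS (proj R p.1) ** (proj R p.2 : A) = e i *: hone A.
Hypothesis Srg : forall i,
  \sum_(p <- d i) (proj R p.1 : A) ** SS (proj R p.2) = e i *: hone A.

(** Every axiom is reduced to a property of the relations (the coproduct, the counit and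
the antipode kill them) or of the generators. *)
Lemma presented_is_hopf : is_hopf A.
Proof.
have SL : linear (SS : A -> A) := qev_opp_linear algA SR.
have epsL := presented_eps_linear.
apply: (hopf_of_generators algA presented_generated presented_cop_linear
  presented_cop1 presented_cop_genM epsL presented_eps1 _ coassocg _ _ SL) => [i y|i|i| |x y|i|i].
- exact: presented_epsM.
- rewrite (tensor_eqE (presented_cop_gen i) (bilinear_epsl epsL)) big_map.
  exact: counitlg.
- rewrite (tensor_eqE (presented_cop_gen i) (bilinear_epsr epsL)) big_map.
  exact: counitrg.
- exact: (qev_opp1 algA SR).
- exact: (qev_oppM algA SR).
- rewrite (tensor_eqE (presented_cop_gen i) (bilinear_hmul (B := A) algA SL (@is_linear_id _ A))).
  by rewrite big_map presented_eps_gen; exact: Slg.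
- rewrite (tensor_eqE (presented_cop_gen i) (bilinear_hmul (B := A) algA (@is_linear_id _ A) SL)).
  by rewrite big_map presented_eps_gen; exact: Srg.
Qed.

End PresentedHopf.

(** * Cycles in symmetric groups *)

Section Cycles.
Variable n : nat.
Implicit Types (s t g : 'S_n) (w : seq 'I_n).

Lemma cycles_conj m g t : t \in cycles n m -> rack g t \in cycles n m.
Proof.
rewrite !inE => /existsP[c /andP[cU /forallP ct]].
apply/existsP; exists (map_tuple g c).
rewrite /= (map_inj_uniq perm_inj) cU /=; apply/forallP => i.
rewrite -(permKV g i) /rack permJ (next_map perm_inj cU).
by rewrite (eqP (ct _)).
Qed.

(** All the orbit arguments rest on this transitivity. *)
Lemma perm_of_uniq w1 w2 : uniq w1 -> uniq w2 -> size w1 = size w2 ->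
  exists g, map g w1 = w2.
Proof.
elim: w1 w2 => [|x w1 IH] [|y w2] //; first by exists 1%g.
rewrite /= => /andP[xw1 U1] /andP[yw2 U2] [sz].
have [g gE] := IH _ U1 U2 sz.
exists (g * tperm (g x) y)%g; rewrite permM tpermL; congr (_ :: _).
rewrite -[RHS]gE; apply/eq_in_map => z zw1; rewrite permM tpermD //.
  by apply: contraNneq xw1 => /perm_inj ->.
by apply: contraNneq yw2 => ->; rewrite -gE map_f.
Qed.

Lemma is_cyc_next w s : uniq w ->
  is_cyc [seq (val x).+1 | x <- w] s <-> (forall i, s i = next w i).
Proof.
move=> wU.
have inj : injective (fun x : 'I_n => (val x).+1) by move=> x y [/val_inj].
have nE i := next_map inj wU i.
split=> sw i; last by rewrite nE -sw.
by apply: inj; rewrite /= sw -nE.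
Qed.

Lemma next_pair (x y z : 'I_n) : x != y -> next [:: x; y] z = tperm x y z.
Proof.
move=> xy; rewrite /=.
have [->|zx] := eqVneq z x; first by rewrite tpermL.
have [->|zy] := eqVneq z y; first by rewrite tpermR.
by rewrite tpermD // eq_sym.
Qed.

Lemma is_cyc_tperm s (x y : 'I_n) : x != y ->
  is_cyc [:: (val x).+1; (val y).+1] s <-> s = tperm x y.
Proof.
move=> xy.
have U : uniq [:: x; y] by rewrite /= inE xy.
split=> [/(is_cyc_next _ U) sE|->].
  by apply/permP => z; rewrite sE next_pair.
by apply/(is_cyc_next _ U) => z; rewrite next_pair.
Qed.

Lemma cycles2P s : s \in cycles n 2 -> exists x y : 'I_n, x != y /\ s = tperm x y.
Proof.
rewrite inE => /existsP[c /andP[cU /forallP sc]].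
case/tupleP: c cU sc => x c; case/tupleP: c => y c; rewrite (tuple0 c) {c} => cU sc.
have xy : x != y by move: cU; rewrite /= inE andbT.
by exists x, y; split=> //; apply/permP => z; rewrite (eqP (sc z)) next_pair.
Qed.

Lemma cycles2_odd s : s \in cycles n 2 -> odd_perm s.
Proof. by case/cycles2P => x [y [xy ->]]; rewrite odd_tperm xy. Qed.

Lemma next_four (a b c d : 'I_n) (w := [:: a; b; c; d]) : uniq w ->
  [/\ next w a = b, next w b = c, next w c = d & next w d = a].
Proof.
rewrite /= !inE !negb_or => /and4P[/and3P[ab ac ad] /andP[bc bd] cd _].
rewrite !eqxx; split=> //.
- by rewrite eq_sym (negPf ab).
- by rewrite eq_sym (negPf ac) eq_sym (negPf bc).
- by rewrite eq_sym (negPf ad) eq_sym (negPf bd) eq_sym (negPf cd).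
Qed.

(** For distinct points of a set of four elements this means s = (a b c d). Unlike an
equality with a product of transpositions, it is visibly stable under rotation and
conjugation. *)
Definition maps4 s (a b c d : 'I_n) : Prop := [/\ s a = b, s b = c, s c = d & s d = a].

Lemma maps4_rot s a b c d : maps4 s a b c d -> maps4 s b c d a.
Proof. by case. Qed.

Lemma maps4_conj g s a b c d : maps4 s a b c d ->
  maps4 (rack g s) (g a) (g b) (g c) (g d).
Proof. by case=> sa sb sc sd; split; rewrite /rack permJ ?sa ?sb ?sc ?sd. Qed.

Lemma cycles4P s : s \in cycles n 4 ->
  exists a b c d : 'I_n, uniq [:: a; b; c; d] /\ maps4 s a b c d.
Proof.
rewrite inE => /existsP[t /andP[tU /forallP st]].
case/tupleP: t tU st => a t; case/tupleP: t => b t; case/tupleP: t => c t.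
case/tupleP: t => d t; rewrite (tuple0 t) {t} => tU st.
exists a, b, c, d; split=> //.
by have [na nb nc nd] := next_four tU; split; rewrite (eqP (st _)).
Qed.

End Cycles.

Section CyclesOfLength4.
Implicit Types (s t g : 'S_4) (a b c d x : 'I_4).

Lemma mem_uniq4 a b c d x : uniq [:: a; b; c; d] -> x \in [:: a; b; c; d].
Proof.
move=> U.
have sub : {subset [:: a; b; c; d] <= enum 'I_4} by move=> y _; rewrite mem_enum.
have sz : (size (enum 'I_4) <= size [:: a; b; c; d])%N by rewrite size_enum_ord.
by rewrite (uniq_min_size U sub sz).2 mem_enum.
Qed.

Lemma eq_perm4 a b c d s t : uniq [:: a; b; c; d] ->
  s a = t a -> s b = t b -> s c = t c -> s d = t d -> s = t.
Proof.
move=> U sa sb sc sd; apply/permP => x; have := mem_uniq4 x U.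
by rewrite !inE => /or4P[] /eqP ->.
Qed.

(** Four distinct points exhaust the set. *)
Lemma maps4_inj a b c d s t : uniq [:: a; b; c; d] ->
  maps4 s a b c d -> maps4 t a b c d -> s = t.
Proof.
move=> U [sa sb sc sd] [ta tb tc td].
by apply: (eq_perm4 U); rewrite ?sa ?sb ?sc ?sd.
Qed.

Lemma maps4_odd a b c d s : uniq [:: a; b; c; d] -> maps4 s a b c d -> odd_perm s.
Proof.
move=> U [sa sb sc sd].
have := U; rewrite /= !inE !negb_or => /and4P[/and3P[ab ac ad] /andP[bc bd] cd _].
have cb : c != b by rewrite eq_sym.
have db : d != b by rewrite eq_sym.
have dc : d != c by rewrite eq_sym.
have -> : s = (tperm a b * tperm a c * tperm a d)%g.
  apply: (eq_perm4 U); rewrite !permM.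
  - by rewrite tpermL (tpermD ab cb) (tpermD ab db).
  - by rewrite tpermR tpermL (tpermD ac dc).
  - by rewrite (tpermD ac bc) tpermR tpermL.
  - by rewrite (tpermD ad bd) (tpermD ad cd) tpermR.
by rewrite !odd_permM !odd_tperm ab ac ad.
Qed.

Lemma cycles4_odd s : s \in cycles 4 4 -> odd_perm s.
Proof. by case/cycles4P => a [b [c [d [U sE]]]]; exact: maps4_odd U sE. Qed.

Lemma maps4_start s x : s \in cycles 4 4 ->
  exists b c d, uniq [:: x; b; c; d] /\ maps4 s x b c d.
Proof.
case/cycles4P => a [b [c [d [U sE]]]].
have r1 := maps4_rot sE; have r2 := maps4_rot r1; have r3 := maps4_rot r2.
have V m : uniq (rot m [:: a; b; c; d]) by rewrite rot_uniq.
have := mem_uniq4 x U; rewrite !inE => /or4P[] /eqP ->.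
- by exists b, c, d.
- by exists c, d, a; split=> //; exact: (V 1).
- by exists d, a, b; split=> //; exact: (V 2).
- by exists a, b, c; split=> //; exact: (V 3).
Qed.

Lemma is_cyc_maps4 s a b c d : uniq [:: a; b; c; d] ->
  is_cyc [:: (val a).+1; (val b).+1; (val c).+1; (val d).+1] s <-> maps4 s a b c d.
Proof.
move=> U; have [na nb nc nd] := next_four U.
split=> [/(is_cyc_next _ U) sE|[sa sb sc sd]]; first by split; rewrite sE.
apply/(is_cyc_next _ U) => x; have := mem_uniq4 x U.
by rewrite !inE => /or4P[] /eqP ->; rewrite ?na ?nb ?nc ?nd.
Qed.

End CyclesOfLength4.

(** * Algebras generated by a rack and the symmetric group *)

Section Racks.
Variables (n : nat) (X : {set 'S_n}).
Hypothesis X_conj : forall (g t : 'S_n), t \in X -> rack g t \in X.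
Implicit Types (i j : idx X) (g : 'S_n).

Lemma val_rack_idx g i : val (rack_idx g i) = rack g (val i).
Proof. by rewrite /rack_idx val_insubd X_conj //; exact: valP. Qed.

Lemma rack_idx_pmul g t i : rack_idx (pmul g t) i = rack_idx g (rack_idx t i).
Proof. by apply: val_inj; rewrite !val_rack_idx /rack /pmul conjgM. Qed.

Lemma rack_idx1 i : rack_idx 1%g i = i.
Proof. by apply: val_inj; rewrite !val_rack_idx /rack conjg1. Qed.

Lemma rack_idxK g : cancel (rack_idx g) (rack_idx (X := X) g^-1%g).
Proof. by move=> i; apply: val_inj; rewrite !val_rack_idx /rack conjgK. Qed.

Lemma pmul_rack g i : pmul g (val i) = pmul (val (rack_idx g i)) g.
Proof. by rewrite val_rack_idx /rack /pmul conjgE !mulgA mulgV mul1g. Qed.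

Lemma tperm_cycles (x y : 'I_n) : x != y -> tperm x y \in cycles n 2.
Proof.
move=> xy; rewrite inE; apply/existsP; exists [tuple x; y].
by rewrite /= inE xy; apply/forallP => z; rewrite -(next_pair z xy).
Qed.

Lemma sgn_pmul (k : fieldType) (g t : 'S_n) : sgn k (pmul g t) = sgn k g * sgn k t.
Proof. by rewrite /sgn /pmul odd_permM signr_addb mulrC. Qed.

Lemma sgn_V (k : fieldType) (g : 'S_n) : sgn k g^-1%g = sgn k g.
Proof. by rewrite /sgn odd_permV. Qed.

Lemma sgn_sq (k : fieldType) (g : 'S_n) : sgn k g * sgn k g = 1.
Proof. by rewrite /sgn -expr2 sqrr_sign. Qed.

Lemma sgn_transposition (k : fieldType) (j : 'S_n) : j \in cycles n 2 -> sgn k j = -1.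
Proof. by move=> /cycles2_odd jt; rewrite /sgn jt. Qed.

Section Elements.
Variables (k : fieldType) (A : hopf_data k) (a : idx X -> A) (h : 'S_n -> A).

(** The relations of [common_rel], for elements of an arbitrary algebra. *)
Record common_ok : Prop := CommonOk {
  ok_one : h 1%g = hone A;
  ok_mul : forall r s, h r ** h s = h (pmul r s);
  ok_cross : forall (j : 'S_n) i, j \in cycles n 2 ->
    h j ** a i = - (a (rack_idx j i) ** h j) }.

Hypotheses (algA : is_algebra A) (comm : common_ok).

(** It is imposed for transpositions, and these generate the symmetric group. *)
Lemma crossing g i : h g ** a i = sgn k g *: (a (rack_idx g i) ** h g).
Proof.
have [ts -> /allP] := prod_tpermP g.
elim: ts i => [|[x y] ts IH] i /= dts.
  by rewrite big_nil rack_idx1 (ok_one comm) hmul1l // hmul1r // /sgn odd_perm1 scale1r.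
have xy : x != y by apply: (dts (x, y)); rewrite mem_head.
have {}IH := IH _ (fun z zts => dts z (mem_behead (s := (x, y) :: ts) zts)).
rewrite big_cons /=; set s := (\prod_(j <- ts) _)%g.
have -> : (tperm x y * s)%g = pmul s (tperm x y) by [].
rewrite -(ok_mul comm) -hmulA // (ok_cross comm) ?tperm_cycles //.
rewrite hmulNr // hmulA // IH -/s sgn_pmul rack_idx_pmul hmulZl // -hmulA //.
by rewrite /sgn odd_tperm xy expr1 mulrN1 scaleNr.
Qed.

Lemma cross_cop_vanish (W : lmodType k) (f : A -> A -> W) (j : 'S_n) i :
  j \in cycles n 2 -> bilinear_map f ->
  f (h j ** a i) (h j ** hone A) + f (h j ** h (val i)) (h j ** a i) +
  (f (a (rack_idx j i) ** h j) (hone A ** h j) +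
   f (h (val (rack_idx j i)) ** h j) (a (rack_idx j i) ** h j)) = 0.
Proof.
move=> jt [fl fr]; rewrite hmul1l // hmul1r // (ok_cross comm) //.
rewrite !(ok_mul comm) -pmul_rack (linN (fl _)) (linN (fr _)).
by rewrite -opprD addNr.
Qed.

Lemma h_mulV g : h g ** h g^-1%g = hone A.
Proof. by rewrite (ok_mul comm) /pmul mulVg (ok_one comm). Qed.

Lemma h_Vmul g : h g^-1%g ** h g = hone A.
Proof. by rewrite (ok_mul comm) /pmul mulgV (ok_one comm). Qed.

Lemma crossingV g i : a i ** h g^-1%g = sgn k g *: (h g^-1%g ** a (rack_idx g i)).
Proof. by rewrite crossing rack_idxK sgn_V scalerA sgn_sq scale1r. Qed.

Hypothesis X_odd : forall i, odd_perm (val i).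

Lemma sgn_idx i : sgn k (val i) = -1.
Proof. by rewrite /sgn X_odd. Qed.

Variable c : k.

(** The list r collects the pairs (i, j) for which a_i a_j occurs in the relation. *)
Definition quad_ok (r : seq (idx X * idx X)) : Prop :=
  \sum_(p <- r) a p.1 ** a p.2 =
  c *: \sum_(p <- r) (hone A - h (val p.1) ** h (val p.2)).

(** The element 1 - h_i h_j is then the same for all the pairs, and it is skew-primitive for
the group-like element that also governs the quadratic part. *)
Definition same_product (r : seq (idx X * idx X)) : Prop :=
  exists g, forall p, p \in r -> pmul (val p.1) (val p.2) = g.

(** Invariance under the inverse braiding: together with [same_product] it makes
the quadratic expression skew-primitive. *)
Definition braid_closed (r : seq (idx X * idx X)) : Prop :=
  perm_eq [seq (rack_idx (val p.1) p.2, p.1) | p <- r] r.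

Variable r : seq (idx X * idx X).
Hypotheses (rprod : same_product r) (rbraid : braid_closed r) (rok : quad_ok r).

Lemma sum_braid (W : nmodType) (f : idx X * idx X -> W) :
  \sum_(p <- r) f (rack_idx (val p.1) p.2, p.1) = \sum_(p <- r) f p.
Proof.
transitivity (\sum_(p <- [seq (rack_idx (val p.1) p.2, p.1) | p <- r]) f p).
  by rewrite big_map.
exact: perm_big.
Qed.

(** In the coproduct of the sum of the a_i a_j, the terms a_i h_j (x) a_j and
h_i a_j (x) a_i cancel: moving h_i across a_j costs a sign, because i is odd, and the
pairs (i |> j, i) run through the same list. *)
Lemma quad_skew_primitive (W : lmodType k) (f : A -> A -> W) : bilinear_map f ->
  \sum_(p <- r) (f (a p.1 ** a p.2) (hone A) + f (a p.1 ** h (val p.2)) (a p.2) +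
    (f (h (val p.1) ** a p.2) (a p.1) + f (h (val p.1) ** h (val p.2)) (a p.1 ** a p.2)))
  = c *: \sum_(p <- r) (f (hone A) (hone A) -
      f (h (val p.1) ** h (val p.2)) (h (val p.1) ** h (val p.2))).
Proof.
case=> fl fr; rewrite big_split big_split /= big_split /=.
have -> : \sum_(p <- r) f (h (val p.1) ** a p.2) (a p.1) =
          - \sum_(p <- r) f (a p.1 ** h (val p.2)) (a p.2).
  rewrite -(sum_braid (fun p => f (a p.1 ** h (val p.2)) (a p.2))) -sumrN.
  apply: eq_bigr => p _ /=.
  by rewrite crossing sgn_idx scaleN1r (linN (fl _)).
rewrite addrA addrK; have [g rg] := rprod.
have hh p : p \in r -> h (val p.1) ** h (val p.2) = h g.
  by move=> pr; rewrite (ok_mul comm) rg.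
rewrite -(lin_sum (fl _)) rok.
have -> : \sum_(p <- r) f (h (val p.1) ** h (val p.2)) (a p.1 ** a p.2) =
          f (h g) (\sum_(p <- r) a p.1 ** a p.2).
  by rewrite (lin_sum (fr _)) !big_seq; apply: eq_bigr => p pr; rewrite hh.
rewrite rok (linZ (fl _)) (linZ (fr _)) -scalerDr; congr (_ *: _).
rewrite (lin_sum (fl _)) (lin_sum (fr _)) -big_split !big_seq.
apply: eq_bigr => p pr; rewrite /= hh // (linB (fl _)) (linB (fr _)).
by rewrite addrA subrK.
Qed.

Lemma quad_cop_vanish (W : lmodType k) (f : A -> A -> W) : bilinear_map f ->
  \sum_(p <- r) (f (a p.1 ** a p.2) (hone A ** hone A) +
                 f (a p.1 ** h (val p.2)) (hone A ** a p.2) +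
    (f (h (val p.1) ** a p.2) (a p.1 ** hone A) +
     f (h (val p.1) ** h (val p.2)) (a p.1 ** a p.2)))
  - c *: \sum_(p <- r) (f (hone A) (hone A) -
      f (h (val p.1) ** h (val p.2)) (h (val p.1) ** h (val p.2))) = 0.
Proof.
move=> fB; rewrite -quad_skew_primitive // -sumrB big1 // => p _.
by rewrite !hmul1l // hmul1r // subrr.
Qed.

(** The value of the antipode at a_i. *)
Definition anti_a i : A := - (h (val i)^-1%g ** a i).

(** The antipode reverses products, and pulling the h_i^-1 to the left turns the pairs of r
into their images under the braiding, which is where [braid_closed] enters again. *)
Lemma anti_quad : \sum_(p <- r) anti_a p.2 ** anti_a p.1 =
  c *: \sum_(p <- r) (hone A - h (val p.2)^-1%g ** h (val p.1)^-1%g).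
Proof.
have [g rg] := rprod.
have hh p : p \in r -> h (val p.1) ** h (val p.2) = h g.
  by move=> pr; rewrite (ok_mul comm) rg.
have hV p : p \in r -> h (val p.2)^-1%g ** h (val p.1)^-1%g = h g^-1%g.
  by move=> pr; rewrite (ok_mul comm) -(rg p pr) /pmul invMg.
transitivity (- (h g^-1%g ** \sum_(p <- r) a p.1 ** a p.2)).
  rewrite -(sum_braid (fun p => a p.1 ** a p.2)) /= hmul_sumr // -sumrN !big_seq.
  apply: eq_bigr => p pr; rewrite /anti_a hmulNl // hmulNr // opprK.
  rewrite -(hmulA algA) (hmulA algA (a p.2)) crossingV sgn_idx scaleN1r.
  by rewrite (hmulNl algA) (hmulNr algA) -(hV p pr) -!(hmulA algA).
rewrite rok hmulZr // -scalerN; congr (_ *: _).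
rewrite hmul_sumr // -sumrN !big_seq; apply: eq_bigr => p pr.
by rewrite hh // hV // hmulBr // h_Vmul hmul1r // opprB.
Qed.

End Elements.

Lemma anti_common (k : fieldType) (A : hopf_data k) (a : idx X -> A) (h : 'S_n -> A) :
  is_algebra A -> common_ok a h ->
  common_ok (A := opp_alg A) (anti_a a h) (fun g => h g^-1%g).
Proof.
move=> algA comm; split=> [|s t|j i jt] /=.
- by rewrite invg1 (ok_one comm).
- by rewrite (ok_mul comm) /pmul invMg.
- rewrite /anti_a hmulNl // hmulNr // opprK -hmulA // (crossingV algA comm).
  rewrite sgn_transposition // scaleN1r hmulNr // opprK !hmulA // !(ok_mul comm) /pmul -!invMg.
  by rewrite -/(pmul j (val i)) pmul_rack.
Qed.

End Racks.

(** * Hopf algebras defined by quadratic relations *)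

Section HopfTheory.
Variables (k : fieldType) (A : hopf_data k).
Hypothesis hopfA : is_hopf A.
Implicit Types (x y : A) (W : lmodType k).

Lemma hopf_algebra : is_algebra A. Proof. by case: hopfA. Qed.
Lemma hopf_cop_linear : cop_linear A.
Proof. by case: hopfA => _ [H _ _ _ _] _ _ _; exact: H. Qed.
Lemma hopf_eps_linear : scalar (@eps _ A). Proof. by case: hopfA => _ []. Qed.
Lemma hopf_coassoc x : coassoc_at x.
Proof. by case: hopfA => _ [_ _ H _ _] _ _ _; exact: H. Qed.
Lemma hopf_counitl x : copf (fun u v => eps u *: v) x = x.
Proof. by case: hopfA => _ [_ _ _ H _] _ _ _; exact: H. Qed.
Lemma hopf_counitr x : copf (fun u v => eps v *: u) x = x.
Proof. by case: hopfA => _ [_ _ _ _ H] _ _ _; exact: H. Qed.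
Lemma hopf_cop1 : tensor_eq (cop (hone A)) [:: (hone A, hone A)].
Proof. by case: hopfA => _ _ [H _] _ _; exact: H. Qed.
Lemma hopf_copM x y : cop_morph_at x y.
Proof. by case: hopfA => _ _ [_ H] _ _; exact: H. Qed.
Lemma hopf_eps1 : eps (hone A) = 1. Proof. by case: hopfA => _ _ _ []. Qed.
Lemma hopf_epsM x y : eps (x ** y) = eps x * eps y.
Proof. by case: hopfA => _ _ _ []. Qed.

Lemma hopf_copfL W (f : A -> A -> W) : bilinear_map f -> linear (copf f).
Proof. exact: copf_linear hopf_cop_linear. Qed.

End HopfTheory.

Section UpperTriangular.
Variable k : fieldType.

(** Upper triangular 2x2 matrices, as triples (top left, top right, bottom right). *)
Definition tri_mul (x y : k^o * k^o * k^o) : k^o * k^o * k^o :=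
  (x.1.1 * y.1.1, x.1.1 * y.1.2 + x.1.2 * y.2, x.2 * y.2).

Definition tri_alg : hopf_data k :=
  @HopfData k _ tri_mul (1, 0, 1) (fun _ => [::]) (fun _ => 0).

Lemma triple_eq (x y : k^o * k^o * k^o) :
  x.1.1 = y.1.1 -> x.1.2 = y.1.2 -> x.2 = y.2 -> x = y.
Proof. by case: x y => [[? ?] ?] [[? ?] ?] /= -> -> ->. Qed.

Lemma tri_is_algebra : is_algebra tri_alg.
Proof.
have El (c x y z : k) : (c * x + z) * y = c * (x * y) + z * y.
  by rewrite mulrDl mulrA.
have Er (c x y z : k) : x * (c * y + z) = c * (x * y) + x * z.
  by rewrite mulrDr mulrCA.
have Ea (x1 x2 y1 y2 y3 z2 z3 : k) : x1 * (y1 * z2 + y2 * z3) + x2 * (y3 * z3) =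
    x1 * y1 * z2 + (x1 * y2 + x2 * y3) * z3.
  by rewrite mulrDr mulrDl !mulrA addrA.
have E1 (x y : k) : 1 * x + 0 * y = x by rewrite mul1r mul0r addr0.
have E2 (x y : k) : y * 0 + x * 1 = x by rewrite mulr1 mulr0 add0r.
have Edl (c x y z t u w : k) : (c * x + z) * t + (c * y + w) * u =
  c * (x * t + y * u) + (z * t + w * u) by rewrite El El mulrDr addrACA.
have Edr (c x y z t u w : k) : t * (c * x + z) + u * (c * y + w) =
  c * (t * x + u * y) + (t * z + u * w)
  by rewrite (Er c t x z) (Er c u y w) mulrDr addrACA.
split.
- split=> [[[x1 x2] x3]|[[x1 x2] x3]] c [[y1 y2] y3] [[z1 z2] z3];
    apply: triple_eq;
    by [exact: El|exact: Er|exact: Edl|exact: Edr].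
- move=> [[x1 x2] x3] [[y1 y2] y3] [[z1 z2] z3].
  apply: triple_eq; [exact: mulrA|exact: Ea|exact: mulrA].
- move=> [[x1 x2] x3]; apply: triple_eq; [exact: mul1r|exact: E1|exact: mul1r].
- move=> [[x1 x2] x3]; apply: triple_eq; [exact: mulr1|exact: E2|exact: mulr1].
Qed.

End UpperTriangular.

Section QuadraticStructure.
Variables (n : nat) (X : {set 'S_n}) (k : fieldType).
Variables (Rel : seq (idx X * idx X) -> Prop).

(** The Hopf algebra P_c of the introduction apart from its universal property, which is
[quad_universal]. The arguments below are carried out for any such A, so that they never
look into a presentation. *)
Record quad_struct (c : k) (A : hopf_data k) (a : idx X -> A) (h : 'S_n -> A) : Prop :=
  QuadStruct {
  qs_hopf : is_hopf A;
  qs_common : common_ok a h;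
  qs_quad : forall r, Rel r -> quad_ok a h c r;
  qs_gen : generated (fun x : idx X + 'S_n =>
             match x with inl i => a i | inr g => h g end);
  qs_cop_a : forall i, tensor_eq (cop (a i)) [:: (a i, hone A); (h (val i), a i)];
  qs_cop_h : forall g, tensor_eq (cop (h g)) [:: (h g, h g)];
  qs_eps_a : forall i, eps (a i) = 0;
  qs_eps_h : forall g, eps (h g) = 1 }.

Definition quad_elt (c : k) (r : seq (idx X * idx X)) : free_alg k (quad_gen X) :=
  \sum_(p <- r) ga k p.1 * ga k p.2 -
  c *: \sum_(p <- r) (1 - gh k X (val p.1) * gh k X (val p.2)).

Inductive quad_rel (c : k) : free_alg k (quad_gen X) -> Prop :=
| quad_rel_common r : common_rel r -> quad_rel c r
| quad_rel_quad r : Rel r -> quad_rel c (quad_elt c r).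

Section Evaluation.
Variables (A : hopf_data k) (v : quad_gen X -> A).
Hypothesis algA : is_algebra A.
Local Notation a := (fun i : idx X => v (inl i)).
Local Notation h := (fun g : 'S_n => v (inr g)).

Lemma ev_gh g : ev v (gh k X g) = v (inr g). Proof. exact: ev_gen. Qed.

Lemma ev_gen2 x y : ev v (gen k x * gen k y) = v x ** v y.
Proof. by rewrite (evM v algA) (ev_gen v algA) (ev_gen v algA). Qed.

Lemma ev_rel_one : ev v (gh k X 1%g - 1) = v (inr 1%g) - hone A.
Proof. by rewrite (linB (ev_linear v)) ev_gh ev1. Qed.

Lemma ev_rel_mul r s : ev v (gh k X r * gh k X s - gh k X (pmul r s)) =
  v (inr r) ** v (inr s) - v (inr (pmul r s)).
Proof.
exact: etrans (linB (ev_linear v) _ _) (congr2 (fun x y => x - y) (ev_gen2 _ _) (ev_gh _)).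
Qed.

Lemma ev_rel_cross j i :
  ev v (gh k X j * ga k i + ga k (rack_idx j i) * gh k X j) =
  v (inr j) ** v (inl i) + v (inl (rack_idx j i)) ** v (inr j).
Proof.
exact: etrans (linD (ev_linear v) _ _) (congr2 +%R (ev_gen2 _ _) (ev_gen2 _ _)).
Qed.

Lemma ev_quad c r : ev v (quad_elt c r) =
  \sum_(p <- r) v (inl p.1) ** v (inl p.2) -
  c *: \sum_(p <- r) (hone A - v (inr (val p.1)) ** v (inr (val p.2))).
Proof.
rewrite /quad_elt (linB (ev_linear v)) (linZ (ev_linear v)).
rewrite (lin_sum (ev_linear v)) (lin_sum (ev_linear v)).
congr (_ - _ *: _); apply: eq_bigr => p _.
  exact: ev_gen2.
by rewrite (linB (ev_linear v)) ev1 ev_gen2.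
Qed.

Lemma ev_common : (forall r, common_rel r -> ev v r = 0) <-> common_ok a h.
Proof.
split=> [H|[h1 hM ha] _ [|r s|j i jt]].
- split=> [|r s|j i jt].
  + exact: subr0_eq (etrans (esym ev_rel_one) (H _ (@rel_one k n X))).
  + exact: subr0_eq (etrans (esym (ev_rel_mul _ _)) (H _ (@rel_mul k n X r s))).
  + have E := etrans (esym (ev_rel_cross _ _)) (H _ (@rel_cross k n X j i jt)).
    by apply/eqP; rewrite -addr_eq0 E.
- by rewrite ev_rel_one h1 subrr.
- by rewrite ev_rel_mul hM subrr.
- by rewrite ev_rel_cross ha // addNr.
Qed.

Lemma ev_quad_rel c : common_ok a h -> (forall r, Rel r -> quad_ok a h c r) ->
  forall r, quad_rel c r -> ev v r = 0.
Proof.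
move=> H1 H2 _ [r|r Rr]; first by move: r; apply/ev_common.
by rewrite ev_quad (H2 r Rr) subrr.
Qed.

End Evaluation.

Section Antipode.
Hypothesis X_conj : forall (g t : 'S_n), t \in X -> rack g t \in X.
Hypothesis X_odd : forall i : idx X, odd_perm (val i).
Hypothesis Rel_prod : forall r, Rel r -> same_product r.
Hypothesis Rel_braid : forall r, Rel r -> braid_closed r.
Variables (A : hopf_data k) (a : idx X -> A) (h : 'S_n -> A) (c : k).
Hypotheses (algA : is_algebra A) (comm : common_ok a h).
Hypothesis quad : forall r, Rel r -> quad_ok a h c r.

Definition anti (x : quad_gen X) : A :=
  match x with inl i => anti_a a h i | inr g => h g^-1%g end.

(** The anti-algebra map with the values of the antipode on generators respects the
relations, because the opposite algebra contains elements satisfying them. *)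
Lemma ev_opp_anti r : quad_rel c r -> ev_opp anti r = 0.
Proof.
apply: (ev_quad_rel (opp_is_algebra algA) (v := anti : _ -> opp_alg A)).
  exact: anti_common.
move=> s Rs; exact: (anti_quad X_conj algA comm X_odd (Rel_prod Rs) (Rel_braid Rs) (quad Rs)).
Qed.

Lemma anti_a_left i s t : s = anti_a a h i -> t = h (val i)^-1%g ->
  s ** hone A + t ** a i = 0 *: hone A.
Proof. by move=> -> ->; rewrite hmul1r // addNr scale0r. Qed.

Lemma anti_a_right i s t : s = hone A -> t = anti_a a h i ->
  a i ** s + h (val i) ** t = 0 *: hone A.
Proof.
move=> -> ->.
by rewrite hmul1r // hmulNr // hmulA // (h_mulV comm) hmul1l // subrr scale0r.
Qed.

Lemma anti_h_left g s : s = h g^-1%g -> s ** h g = 1 *: hone A.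
Proof. by move=> ->; rewrite (h_Vmul comm) scale1r. Qed.

Lemma anti_h_right g s : s = h g^-1%g -> h g ** s = 1 *: hone A.
Proof. by move=> ->; rewrite (h_mulV comm) scale1r. Qed.

End Antipode.
End QuadraticStructure.

Section SmallSums.
Variables (T : Type) (W : nmodType) (F : T -> T -> W).

Lemma sum11 x y : \sum_(p <- [:: x]) \sum_(q <- [:: y]) F p q = F x y.
Proof. by rewrite !big_seq1. Qed.

Lemma sum_one (G : T -> W) x : \sum_(p <- [:: x]) G p = G x.
Proof. by rewrite big_seq1. Qed.

Lemma sum_two (G : T -> W) x y : \sum_(p <- [:: x; y]) G p = G x + G y.
Proof. by rewrite big_cons big_seq1. Qed.

Lemma sum_three (G : T -> W) x y z :
  \sum_(p <- [:: x; y; z]) G p = G x + G y + G z.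
Proof. by rewrite big_cons sum_two addrA. Qed.

Lemma sum12 x y z : \sum_(p <- [:: x]) \sum_(q <- [:: y; z]) F p q = F x y + F x z.
Proof. by rewrite big_seq1 big_cons big_seq1. Qed.

Lemma sum21 x y z : \sum_(p <- [:: x; y]) \sum_(q <- [:: z]) F p q = F x z + F y z.
Proof. by rewrite big_cons !big_seq1. Qed.

Lemma sum22 x y z t : \sum_(p <- [:: x; y]) \sum_(q <- [:: z; t]) F p q =
  F x z + F x t + (F y z + F y t).
Proof. by rewrite big_cons big_seq1 !(big_cons, big_seq1) !big_nil !addr0. Qed.

End SmallSums.

Section SkewPrimitive.
Variables (k : fieldType) (A : hopf_data k) (x g : A).
Hypotheses (copL : cop_linear A) (cop1 : tensor_eq (cop (hone A)) [:: (hone A, hone A)]).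
Hypothesis copg : tensor_eq (cop g) [:: (g, g)].
Hypothesis copx : tensor_eq (cop x) [:: (x, hone A); (g, x)].

Lemma copf1 (W : lmodType k) (f : A -> A -> W) : bilinear_map f ->
  copf f (hone A) = f (hone A) (hone A).
Proof. by move=> fB; rewrite /copf (tensor_eqE cop1 fB) big_seq1. Qed.

Lemma copf_grouplike (W : lmodType k) (f : A -> A -> W) : bilinear_map f ->
  copf f g = f g g.
Proof. by move=> fB; rewrite /copf (tensor_eqE copg fB) big_seq1. Qed.

Lemma copf_skew (W : lmodType k) (f : A -> A -> W) : bilinear_map f ->
  copf f x = f x (hone A) + f g x.
Proof. by move=> fB; rewrite /copf (tensor_eqE copx fB) sum_two. Qed.

Lemma grouplike_coassoc : coassoc_at g.
Proof.
move=> W f fT; have fB := bilinear_copl copL fT; have fB' := bilinear_copr copL fT.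
rewrite -[LHS]/(copf (fun u v => copf (fun s t => f s t v) u) _).
rewrite -[RHS]/(copf (fun u v => copf (f u) v) _) !copf_grouplike //.
  exact: trilinear23.
exact: trilinear12.
Qed.

Lemma skew_coassoc : coassoc_at x.
Proof.
move=> W f fT; have fB := bilinear_copl copL fT; have fB' := bilinear_copr copL fT.
have f12 := trilinear12 _ fT; have f23 := trilinear23 _ fT.
rewrite -[LHS]/(copf (fun u v => copf (fun s t => f s t v) u) _).
rewrite -[RHS]/(copf (fun u v => copf (f u) v) _) (copf_skew fB) (copf_skew fB').
by rewrite (copf_skew (f12 _)) (copf_grouplike (f12 _)) (copf1 (f23 _)) (copf_skew (f23 _)) addrA.
Qed.

Lemma skew_counitl : eps x = 0 -> eps g = 1 -> eps x *: hone A + eps g *: x = x.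
Proof. by move=> -> ->; rewrite scale0r scale1r add0r. Qed.

Lemma skew_counitr : eps (hone A) = 1 -> eps x = 0 -> eps (hone A) *: x + eps x *: g = x.
Proof. by move=> -> ->; rewrite scale0r scale1r addr0. Qed.

Lemma grouplike_counit : eps g = 1 -> eps g *: g = g.
Proof. by move=> ->; rewrite scale1r. Qed.

End SkewPrimitive.

Section SkewPrimitiveProducts.
Variables (k : fieldType) (A : hopf_data k) (x g : A).
Hypothesis hopfA : is_hopf A.
Hypothesis copg : tensor_eq (cop g) [:: (g, g)].
Hypothesis copx : tensor_eq (cop x) [:: (x, hone A); (g, x)].
Variables (W : lmodType k) (f : A -> A -> W).
Hypothesis fB : bilinear_map f.
Let algA := hopf_algebra hopfA.

Let mulB y : bilinear_map (fun u v => \sum_(q <- cop y) f (u ** q.1) (v ** q.2)).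
Proof. by apply: bilinear_sum => q; apply: (bilinear_comp fB); exact: hmul_linl. Qed.

Lemma copf_grouplikeM y : copf f (g ** y) = copf (fun u v => f (g ** u) (g ** v)) y.
Proof.
rewrite (copfM (hopf_copM hopfA _ _) fB).
exact: (copf_grouplike copg (mulB y)).
Qed.

Lemma copf_skewM y : copf f (x ** y) =
  copf (fun u v => f (x ** u) v) y + copf (fun u v => f (g ** u) (x ** v)) y.
Proof.
rewrite (copfM (hopf_copM hopfA _ _) fB).
apply: etrans (copf_skew copx (mulB y)) _; congr (_ + _).
by apply: eq_bigr => q _; rewrite hmul1l.
Qed.

End SkewPrimitiveProducts.

Section QuadHopf.
Variables (n : nat) (X : {set 'S_n}) (k : fieldType).
Variable R : free_alg k (quad_gen X) -> Prop.
Local Notation A := (quad_hopf R).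

Definition qa (i : idx X) : A := qgen R (inl i : quad_gen X).
Definition qh (g : 'S_n) : A := qgen R (inr g : quad_gen X).

Lemma quad_hopf_algebra : is_algebra A. Proof. exact: presented_is_algebra. Qed.

Lemma ev_qgen t : ev (A := A) (qgen R) t = proj R t.
Proof. exact: ev_proj. Qed.

Lemma quad_hopf_common : (forall r, common_rel r -> R r) -> common_ok qa qh.
Proof.
move=> RR; apply/(ev_common (qgen R : quad_gen X -> A) quad_hopf_algebra) => r rR.
by rewrite ev_qgen proj_rel //; exact: RR.
Qed.

Lemma quad_hopf_quad c r : R (quad_elt c r) -> quad_ok qa qh c r.
Proof.
move=> Rr; apply: subr0_eq.
exact: etrans (esym (ev_quad _ quad_hopf_algebra _ _)) (etrans (ev_qgen _) (proj_rel Rr)).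
Qed.

Lemma quad_hopf_gen : generated (A := A) (fun x : idx X + 'S_n =>
  match x with inl i => qa i | inr g => qh g end).
Proof.
move=> P P1 PL Pg; apply: (@pres_ind _ _ R P P1 PL) => -[i|g] x Px.
  exact: (Pg (inl i)).
exact: (Pg (inr g)).
Qed.

Local Notation value := (free_copf (R := R) (d := @quad_cop k n X) (e := @quad_eps k n X)).

Lemma value_gen2 (W : lmodType k) (f : A -> A -> W) x y : bilinear_map f ->
  value f (gen k x * gen k y) =
  \sum_(p <- quad_cop k x) \sum_(q <- quad_cop k y)
    f ((proj R p.1 : A) ** (proj R q.1 : A)) ((proj R p.2 : A) ** (proj R q.2 : A)).
Proof.
move=> fB; rewrite free_copf_genM //; apply: eq_bigr => p _.
rewrite free_copf_gen //.
exact: bilinear_comp fB (hmul_linr quad_hopf_algebra _) (hmul_linr quad_hopf_algebra _).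
Qed.

Section Value.
Variables (W : lmodType k) (f : A -> A -> W).
Hypothesis fB : bilinear_map f.

Let FF (p q : free_alg k (quad_gen X) * free_alg k (quad_gen X)) : W :=
  f ((proj R p.1 : A) ** (proj R q.1 : A)) ((proj R p.2 : A) ** (proj R q.2 : A)).

Lemma value_h g : value f (gh k X g) = f (qh g) (qh g).
Proof. by rewrite free_copf_gen // big_seq1. Qed.

Lemma value_aa i j : value f (ga k i * ga k j) =
  f (qa i ** qa j) (hone A ** hone A) + f (qa i ** qh (val j)) (hone A ** qa j) +
  (f (qh (val i) ** qa j) (qa i ** hone A) +
   f (qh (val i) ** qh (val j)) (qa i ** qa j)).
Proof.
rewrite value_gen2 //.
exact: (sum22 FF (ga k i, 1) (gh k X (val i), ga k i) (ga k j, 1) (gh k X (val j), ga k j)).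
Qed.

Lemma value_hh g t : value f (gh k X g * gh k X t) =
  f (qh g ** qh t) (qh g ** qh t).
Proof.
rewrite value_gen2 //.
exact: (sum11 FF (gh k X g, gh k X g) (gh k X t, gh k X t)).
Qed.

Lemma value_ha g i : value f (gh k X g * ga k i) =
  f (qh g ** qa i) (qh g ** hone A) + f (qh g ** qh (val i)) (qh g ** qa i).
Proof.
rewrite value_gen2 //.
exact: (sum12 FF (gh k X g, gh k X g) (ga k i, 1) (gh k X (val i), ga k i)).
Qed.

Lemma value_ah i g : value f (ga k i * gh k X g) =
  f (qa i ** qh g) (hone A ** qh g) + f (qh (val i) ** qh g) (qa i ** qh g).
Proof.
rewrite value_gen2 //.
exact: (sum21 FF (ga k i, 1) (gh k X (val i), ga k i) (gh k X g, gh k X g)).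
Qed.

Lemma value_quad c r : value f (quad_elt c r) =
  \sum_(p <- r) (f (qa p.1 ** qa p.2) (hone A ** hone A) +
                 f (qa p.1 ** qh (val p.2)) (hone A ** qa p.2) +
    (f (qh (val p.1) ** qa p.2) (qa p.1 ** hone A) +
     f (qh (val p.1) ** qh (val p.2)) (qa p.1 ** qa p.2)))
  - c *: \sum_(p <- r) (f (hone A) (hone A) -
      f (qh (val p.1) ** qh (val p.2)) (qh (val p.1) ** qh (val p.2))).
Proof.
have vL := free_copf_linear (d := @quad_cop k n X) (e := @quad_eps k n X) f.
rewrite /quad_elt (linB vL) (linZ vL) (lin_sum vL) (lin_sum vL).
congr (_ - _ *: _); apply: eq_bigr => p _; first exact: value_aa.
by rewrite (linB vL) value_hh free_copf1.
Qed.

End Value.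

End QuadHopf.

Section QuadraticHopf.
Variables (n : nat) (X : {set 'S_n}) (k : fieldType).
Hypothesis X_conj : forall (g t : 'S_n), t \in X -> rack g t \in X.
Hypothesis X_odd : forall i : idx X, odd_perm (val i).
Variable Rel : seq (idx X * idx X) -> Prop.
Hypothesis Rel_prod : forall r, Rel r -> same_product r.
Hypothesis Rel_braid : forall r, Rel r -> braid_closed r.
Variable c : k.
Local Notation A := (quad_hopf (quad_rel Rel c)).
Local Notation a := (@qa n X k (quad_rel Rel c)).
Local Notation h := (@qh n X k (quad_rel Rel c)).
Local Notation value := (free_copf (R := quad_rel Rel c)
  (d := @quad_cop k n X) (e := @quad_eps k n X)).

Let algA : is_algebra A. Proof. exact: quad_hopf_algebra. Qed.

Lemma quad_common : common_ok a h.
Proof. by apply: quad_hopf_common => r; exact: quad_rel_common. Qed.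

Lemma quad_quad r : Rel r -> quad_ok a h c r.
Proof. by move=> Rr; apply: quad_hopf_quad; exact: quad_rel_quad. Qed.

Lemma quad_value_rel (W : lmodType k) (f : A -> A -> W) : bilinear_map f ->
  forall r, quad_rel Rel c r -> value f r = 0.
Proof.
move=> fB; have vL := free_copf_linear (R := quad_rel Rel c)
  (d := @quad_cop k n X) (e := @quad_eps k n X) f.
have [h1 hM ha] := quad_common.
move=> _ [_ [|g t|j i jt]|r Rr].
- by rewrite (linB vL) value_h // free_copf1 h1 subrr.
- by rewrite (linB vL) value_hh // value_h // hM subrr.
- exact: etrans (linD vL _ _) (etrans (congr2 +%R (value_ha fB _ _) (value_ah fB _ _))
    (cross_cop_vanish X_conj algA quad_common i jt fB)).
- rewrite value_quad //.
  exact: (quad_cop_vanish X_conj algA quad_common X_odd (Rel_prod Rr)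
    (Rel_braid Rr) (quad_quad Rr)).
Qed.

Lemma base_common : common_ok (A := base_alg k) (fun _ : idx X => 0 : k^o) (fun _ => 1).
Proof.
split=> // [r s|j i _]; rewrite /=; first by rewrite mulr1.
by rewrite mulr0 mul0r oppr0.
Qed.

Lemma quad_eps_rel r : quad_rel Rel c r -> ev (A := base_alg k) (@quad_eps k n X) r = 0.
Proof.
apply: (ev_quad_rel (base_is_algebra k) base_common) => s _.
by rewrite /quad_ok !big1 ?scaler0 //= => p _; rewrite ?mulr0 // mulr1 subrr.
Qed.

Local Notation S := (anti a h).

Let SR r : quad_rel Rel c r -> ev_opp S r = 0.
Proof. exact: (ev_opp_anti X_conj X_odd Rel_prod Rel_braid algA quad_common quad_quad). Qed.

Lemma quad_is_hopf : is_hopf A.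
Proof.
have epsR := quad_eps_rel.
have e1 := presented_eps1 (R := quad_rel Rel c) (@quad_cop k n X) epsR.
have ee x := presented_eps_gen (R := quad_rel Rel c) (@quad_cop k n X) epsR x.
have copR := quad_value_rel.
have cop1 : tensor_eq (cop (hone A)) [:: (hone A, hone A)].
  exact: presented_cop1.
have copL : cop_linear A by exact: presented_cop_linear.
have coph g : tensor_eq (cop (h g)) [:: (h g, h g)].
  exact: (presented_cop_gen copR (inr g : quad_gen X)).
have copa i : tensor_eq (cop (a i)) [:: (a i, hone A); (h (val i), a i)].
  exact: (presented_cop_gen copR (inl i : quad_gen X)).
pose da (i : idx X) := (ga k i, 1 : free_alg k (quad_gen X)).
pose da' (i : idx X) := (gh k X (val i), ga k i).
pose dh g := (gh k X g, gh k X g).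
pose SS := qev_opp (R := quad_rel Rel c) S.
have SSa i : SS (a i) = anti_a a h i := qev_opp_gen algA SR (inl i : quad_gen X).
have SSh g : SS (h g) = h g^-1%g := qev_opp_gen algA SR (inr g : quad_gen X).
have SS1 : SS (hone A) = hone A := qev_opp1 algA SR.
pose Fl p : A := eps (proj (quad_rel Rel c) p.1 : A) *: (proj (quad_rel Rel c) p.2 : A).
pose Fr p : A := eps (proj (quad_rel Rel c) p.2 : A) *: (proj (quad_rel Rel c) p.1 : A).
pose Gl p : A := SS (proj (quad_rel Rel c) p.1) ** (proj (quad_rel Rel c) p.2 : A).
pose Gr p : A := (proj (quad_rel Rel c) p.1 : A) ** SS (proj (quad_rel Rel c) p.2).
apply: (presented_is_hopf copR epsR _ _ _ SR) => [[i|g]|[i|g]|[i|g]|[i|g]|[i|g]].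
- exact: skew_coassoc copL cop1 (coph _) (copa i).
- exact: grouplike_coassoc copL (coph g).
- exact: etrans (sum_two Fl (da i) (da' i))
    (skew_counitl (ee (inl i)) (ee (inr (val i)))).
- exact: etrans (sum_one Fl (dh g)) (grouplike_counit (ee (inr g))).
- exact: etrans (sum_two Fr (da i) (da' i))
    (skew_counitr (h (val i)) e1 (ee (inl i))).
- exact: etrans (sum_one Fr (dh g)) (grouplike_counit (ee (inr g))).
- exact: etrans (sum_two Gl (da i) (da' i)) (anti_a_left algA (SSa i) (SSh (val i))).
- exact: etrans (sum_one Gl (dh g)) (anti_h_left quad_common (SSh g)).
- exact: etrans (sum_two Gr (da i) (da' i)) (anti_a_right algA quad_common SS1 (SSa i)).
- exact: etrans (sum_one Gr (dh g)) (anti_h_right quad_common (SSh g)).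
Qed.

Lemma quad_hopf_struct : quad_struct Rel c a h.
Proof.
split; [exact: quad_is_hopf|exact: quad_common|exact: quad_quad|exact: quad_hopf_gen
  |move=> i|move=> g|move=> i|move=> g].
- exact: (presented_cop_gen quad_value_rel (inl i : quad_gen X)).
- exact: (presented_cop_gen quad_value_rel (inr g : quad_gen X)).
- exact: (presented_eps_gen (R := quad_rel Rel c) (@quad_cop k n X) quad_eps_rel (inl i)).
- exact: (presented_eps_gen (R := quad_rel Rel c) (@quad_cop k n X) quad_eps_rel (inr g)).
Qed.

End QuadraticHopf.

(** * The cocycle attached to a skew pair *)

Section Twist.
Variables (k : fieldType) (V : lmodType k) (m : V -> V -> V) (P D S : V -> V) (c : k).
Hypothesis mB : bilinear_map m.
Hypotheses (PL : linear P) (DL : linear D).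

(** A perturbation of the product by a pair of skew derivations. *)
Definition twist (x y : V) : V := m x y + c *: m (P x) (D y).

Lemma twist_bilinear : bilinear_map twist.
Proof.
have [ml mr] := mB.
split=> [y|x]; apply: is_linear_add => //; apply: is_linear_scale.
  exact: (is_linear_comp (ml _) PL).
exact: (is_linear_comp (mr _) DL).
Qed.

Definition right_derivation : Prop := forall y z, D (m y z) = m (D y) z + m (S y) (D z).
Definition left_derivation : Prop := forall y z, P (m y z) = m (P y) (S z) + m y (P z).

(** The Leibniz rules distribute the two terms that are linear in c over the three factors
in the same way on both sides; the terms in c^2 vanish because P and D kill the images of
P and D. *)
Lemma twist_assoc : associative m -> right_derivation -> left_derivation ->
  (forall x, P (P x) = 0) -> (forall x, P (D x) = 0) ->
  (forall x, D (P x) = 0) -> (forall x, D (D x) = 0) -> associative twist.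
Proof.
have [ml mr] := mB.
move=> mA Dm Pm PP PD DP DD x y z; rewrite /twist.
rewrite (linD (mr x)) (linZ (mr x)) (linD DL) (linZ DL) !Dm DP DD.
rewrite (lin0 (ml _)) (lin0 (mr _)) addr0 scaler0 addr0.
rewrite (linD (ml z)) (linZ (ml z)) (linD PL) (linZ PL) !Pm PP PD.
rewrite (lin0 (ml _)) (lin0 (mr _)) addr0 scaler0 addr0.
rewrite (linD (mr _)) (linD (ml _)) !scalerDr !mA -!addrA; congr (_ + _).
by rewrite [LHS]addrCA; congr (_ + _); rewrite addrC.
Qed.

End Twist.

Section TwistTwice.
Variables (k : fieldType) (V : lmodType k) (m : V -> V -> V).
Variables (P D S P' D' S' : V -> V) (c : k).
Hypothesis mB : bilinear_map m.
Hypotheses (PL : linear P') (DL : linear D').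
Hypotheses (Dm : right_derivation m D' S') (Pm : left_derivation m P' S').
Hypotheses (PP : forall x, P' (P x) = P (P' x)) (PD : forall x, P' (D x) = D (P' x)).
Hypotheses (DP : forall x, D' (P x) = P (D' x)) (DD : forall x, D' (D x) = D (D' x)).
Hypotheses (SP : forall x, S' (P x) = P (S' x)) (SD : forall x, S' (D x) = D (S' x)).

(** Skew derivations commuting with P, D remain skew derivations of the twisted product, so
that it can be twisted a second time. *)
Lemma twist_right_derivation : right_derivation (twist m P D c) D' S'.
Proof.
move=> y z; rewrite /twist (linD DL) (linZ DL) !Dm DP DD SP scalerDr.
by rewrite addrACA.
Qed.

Lemma twist_left_derivation : left_derivation (twist m P D c) P' S'.
Proof.
move=> y z; rewrite /twist (linD PL) (linZ PL) !Pm PP PD SD scalerDr.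
by rewrite addrACA.
Qed.

End TwistTwice.

Section Convolution.
Variables (k : fieldType) (A : hopf_data k).
Hypothesis hopfA : is_hopf A.
Let algA := hopf_algebra hopfA.
Implicit Types (f g : A -> k) (x y : A).

(** The product of the dual algebra; [lact] and [ract] are its two actions on A. *)
Definition conv1 f g x : k := \sum_(p <- cop x) f p.1 * g p.2.
Definition lact f x : A := copf (fun u v => f u *: v) x.
Definition ract f x : A := copf (fun u v => f v *: u) x.

Lemma form_sum f (J : Type) (s : seq J) (F : J -> A) : scalar f ->
  f (\sum_(j <- s) F j) = \sum_(j <- s) f (F j).
Proof. by move=> fL; exact: (@lin_sum k A k^o f fL). Qed.

Lemma formZ f c x : scalar f -> f (c *: x) = c * f x.
Proof. by move=> fL; exact: (@linZ k A k^o f fL). Qed.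

Lemma formD f x y : scalar f -> f (x + y) = f x + f y.
Proof. by move=> fL; exact: (@linD k A k^o f fL). Qed.

Lemma formN f x : scalar f -> f (- x) = - f x.
Proof. by move=> fL; exact: (@linN k A k^o f fL). Qed.

Lemma lact_linear f : scalar f -> linear (lact f).
Proof. by move=> fL; apply: hopf_copfL => //; exact: bilinear_scalel. Qed.

Lemma ract_linear f : scalar f -> linear (ract f).
Proof. by move=> fL; apply: hopf_copfL => //; exact: bilinear_scaler. Qed.

Lemma conv1_lact f g x : scalar g -> conv1 f g x = g (lact f x).
Proof.
by move=> gL; rewrite /lact /copf form_sum //; apply: eq_bigr => p _; rewrite formZ.
Qed.

Lemma conv1_ract f g x : scalar f -> conv1 f g x = f (ract g x).
Proof.
move=> fL; rewrite /ract /copf form_sum //; apply: eq_bigr => p _.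
by rewrite formZ // mulrC.
Qed.

Lemma conv1_linear f g : scalar f -> scalar g -> scalar (conv1 f g).
Proof.
move=> fL gL c x y; rewrite !conv1_lact // lact_linear //.
by rewrite formD // formZ.
Qed.

Lemma eq_conv1 f f' g g' : f =1 f' -> g =1 g' -> conv1 f g =1 conv1 f' g'.
Proof. by move=> ff gg x; apply: eq_bigr => p _; rewrite ff gg. Qed.

Lemma lact_eps x : lact (@eps _ A) x = x. Proof. exact: hopf_counitl. Qed.
Lemma ract_eps x : ract (@eps _ A) x = x. Proof. exact: hopf_counitr. Qed.

Lemma eq_lact f g : f =1 g -> lact f =1 lact g.
Proof. by move=> fg x; apply: eq_bigr => p _; rewrite fg. Qed.

Lemma eq_ract f g : f =1 g -> ract f =1 ract g.
Proof. by move=> fg x; apply: eq_bigr => p _; rewrite fg. Qed.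

Let epsL : scalar (@eps _ A) := hopf_eps_linear hopfA.

Lemma conv1_epsl f x : scalar f -> conv1 (@eps _ A) f x = f x.
Proof. by move=> fL; rewrite conv1_lact // lact_eps. Qed.

Lemma conv1_epsr f x : scalar f -> conv1 f (@eps _ A) x = f x.
Proof. by move=> fL; rewrite conv1_ract // ract_eps. Qed.

Lemma form_trilinear f g h (F : A -> A -> A -> A) : scalar f -> scalar g ->
  (forall x y z, F x y z = (f x * g y) *: h z) -> linear h -> trilinear_map F.
Proof.
move=> fL gL FE hL; split=> u v c x y; rewrite !FE.
- by rewrite fL mulrDl scalerDl scalerA mulrA.
- by rewrite gL mulrDr scalerDl scalerA mulrCA.
- by rewrite hL scalerDr !scalerA mulrC.
Qed.

Lemma lact_ract f g x : scalar f -> scalar g ->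
  lact f (ract g x) = ract g (lact f x).
Proof.
move=> fL gL; rewrite [ract g x]/(copf _ _) (lin_sum (lact_linear fL)).
rewrite [lact f x in RHS]/(copf _ _) (lin_sum (ract_linear gL)).
transitivity (\sum_(p <- cop x) \sum_(q <- cop p.1) (f q.1 * g p.2) *: q.2).
  apply: eq_bigr => p _; rewrite (linZ (lact_linear fL)) scaler_sumr.
  by apply: eq_bigr => q _; rewrite scalerA mulrC.
rewrite (@hopf_coassoc _ _ hopfA _ _ (fun u v w => (f u * g w) *: v)); last first.
  split=> u v c y z.
  - by rewrite fL mulrDl scalerDl scalerA mulrA.
  - by rewrite scalerDr !scalerA mulrC.
  - by rewrite gL mulrDr scalerDl scalerA mulrCA.
apply: eq_bigr => p _; rewrite (linZ (ract_linear gL)) scaler_sumr.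
by apply: eq_bigr => q _; rewrite scalerA.
Qed.

Lemma lact_lact f g x : scalar f -> scalar g ->
  lact f (lact g x) = lact (conv1 g f) x.
Proof.
move=> fL gL; rewrite [lact g x]/(copf _ _) (lin_sum (lact_linear fL)).
transitivity (\sum_(p <- cop x) \sum_(q <- cop p.2) (g p.1 * f q.1) *: q.2).
  apply: eq_bigr => p _; rewrite (linZ (lact_linear fL)) scaler_sumr.
  by apply: eq_bigr => q _; rewrite scalerA.
rewrite -(@hopf_coassoc _ _ hopfA _ _ (fun u v w => (g u * f v) *: w)); last first.
  by apply: (form_trilinear gL fL) => //; exact: is_linear_id.
by apply: eq_bigr => p _; rewrite -scaler_suml.
Qed.

Lemma ract_ract f g x : scalar f -> scalar g ->
  ract f (ract g x) = ract (conv1 f g) x.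
Proof.
move=> fL gL; rewrite [ract g x]/(copf _ _) (lin_sum (ract_linear fL)).
transitivity (\sum_(p <- cop x) \sum_(q <- cop p.1) (f q.2 * g p.2) *: q.1).
  apply: eq_bigr => p _; rewrite (linZ (ract_linear fL)) scaler_sumr.
  by apply: eq_bigr => q _; rewrite scalerA mulrC.
rewrite (@hopf_coassoc _ _ hopfA _ _ (fun u v w => (f v * g w) *: u)); last first.
  split=> u v c y z.
  - by rewrite scalerDr !scalerA mulrC.
  - by rewrite fL mulrDl scalerDl scalerA mulrA.
  - by rewrite gL mulrDr scalerDl scalerA mulrCA.
by apply: eq_bigr => p _; rewrite -scaler_suml.
Qed.

Lemma conv1A f g h x : scalar f -> scalar g -> scalar h ->
  conv1 (conv1 f g) h x = conv1 f (conv1 g h) x.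
Proof.
move=> fL gL hL; rewrite conv1_lact // -lact_lact //.
by rewrite conv1_lact ?conv1_lact //; exact: conv1_linear.
Qed.

(** The action on a product is governed by the coproduct of the functional in the dual; in
particular a skew-primitive functional acts by a skew derivation. *)
Lemma lactM f f1 g1 f2 g2 x y : scalar f ->
  (forall u v, f (u ** v) = f1 u * g1 v + f2 u * g2 v) ->
  lact f (x ** y) = lact f1 x ** lact g1 y + lact f2 x ** lact g2 y.
Proof.
move=> fL fM; rewrite [LHS](copfM (hopf_copM hopfA x y)); last exact: bilinear_scalel.
rewrite /lact /copf !hmul_suml // -big_split; apply: eq_bigr => p _ /=.
rewrite !hmul_sumr // -big_split; apply: eq_bigr => q _ /=.
by rewrite fM scalerDl !hmulZl // !hmulZr // !scalerA.
Qed.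

Lemma ractM f f1 g1 f2 g2 x y : scalar f ->
  (forall u v, f (u ** v) = f1 u * g1 v + f2 u * g2 v) ->
  ract f (x ** y) = ract f1 x ** ract g1 y + ract f2 x ** ract g2 y.
Proof.
move=> fL fM; rewrite [LHS](copfM (hopf_copM hopfA x y)); last exact: bilinear_scaler.
rewrite /ract /copf !hmul_suml // -big_split; apply: eq_bigr => p _ /=.
rewrite !hmul_sumr // -big_split; apply: eq_bigr => q _ /=.
by rewrite fM scalerDl !hmulZl // !hmulZr // !scalerA.
Qed.

End Convolution.

Section SkewPair.
Variables (k : fieldType) (A : hopf_data k).

(** A copy of the four-dimensional Sweedler Hopf algebra in the dual of A,
spanned by eps, s, d and s * d. *)
Record skew_pair (s d : A -> k) : Prop := SkewPair {
  sk_sL : scalar s;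
  sk_dL : scalar d;
  sk_s1 : s (hone A) = 1;
  sk_d1 : d (hone A) = 0;
  sk_sM : forall x y, s (x ** y) = s x * s y;
  sk_dM : forall x y, d (x ** y) = s x * d y + d x * eps y;
  sk_ss : conv1 s s =1 @eps _ A;
  sk_sd : forall x, conv1 s d x = - conv1 d s x;
  sk_dd : forall x, conv1 d d x = 0 }.

Hypothesis hopfA : is_hopf A.
Let algA := hopf_algebra hopfA.
Variables (s d : A -> k).
Hypothesis sk : skew_pair s d.

Let sL := sk_sL sk.
Let dL := sk_dL sk.
Let epsL : scalar (@eps _ A) := hopf_eps_linear hopfA.

(** The product s * d up to sign; it is skew-primitive on the other side. *)
Definition skew_left : A -> k := conv1 d s.
Local Notation d' := skew_left.

Lemma skew_left_linear : scalar d'.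
Proof. exact: conv1_linear. Qed.
Let d'L := skew_left_linear.

Lemma skew_left1 : d' (hone A) = 0.
Proof.
rewrite /d' conv1_ract // /ract (copf1 (hopf_cop1 hopfA) (bilinear_scaler A sL)).
by rewrite (sk_s1 sk) scale1r (sk_d1 sk).
Qed.

Lemma skew_leftM x y : d' (x ** y) = d' x * s y + eps x * d' y.
Proof.
rewrite /d' conv1_ract // (ractM hopfA (f1 := s) (g1 := s) (f2 := fun=> 0) (g2 := fun=> 0)) //.
  have -> u : ract (fun _ : A => 0) u = 0.
    by rewrite /ract /copf big1 // => p _; rewrite scale0r.
  rewrite hmul0l // addr0 (sk_dM sk) -!conv1_ract // addrC.
  congr (_ + _); last by rewrite (sk_ss sk).
  by congr (_ * _); rewrite -(conv1_epsl hopfA y sL) conv1_ract.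
by move=> u v; rewrite (sk_sM sk) mulr0 addr0.
Qed.

Let conv1N f g (x : A) : scalar f -> conv1 f (fun u => - g u) x = - conv1 f g x :> k.
Proof. by move=> _; rewrite /conv1 -sumrN; apply: eq_bigr => p _; rewrite mulrN. Qed.

Let conv1_0l g (x : A) : conv1 (fun _ : A => 0) g x = 0 :> k.
Proof. by rewrite /conv1 big1 // => p _; rewrite mul0r. Qed.

Lemma conv1_d'd x : conv1 d' d x = 0.
Proof.
rewrite (conv1A hopfA) // (eq_conv1 (f' := d) (g' := fun u => - d' u)) //; last exact: (sk_sd sk).
rewrite conv1N // -(conv1A hopfA) // (eq_conv1 (f' := fun=> 0) (g' := s)) ?conv1_0l ?oppr0 //.
exact: (sk_dd sk).
Qed.

Lemma conv1_dd' x : conv1 d d' x = 0.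
Proof.
rewrite -(conv1A hopfA) // (eq_conv1 (f' := fun=> 0) (g' := s)) ?conv1_0l //.
exact: (sk_dd sk).
Qed.

Lemma conv1_d'd' x : conv1 d' d' x = 0.
Proof.
rewrite -(conv1A hopfA) // (eq_conv1 (f' := fun=> 0) (g' := s)) ?conv1_0l //.
exact: conv1_d'd.
Qed.

(** The exponential of c d' (x) d, whose convolution square vanishes since d' * d' = 0. *)
Definition skew_cocycle (c : k) (x y : A) : k := eps x * eps y + c * (d' x * d y).

Lemma skew_cocycle_bilinear c : bilinear_form (skew_cocycle c).
Proof.
split=> [v|u] b x y; rewrite /skew_cocycle /=.
  by rewrite epsL d'L /GRing.scale /=; ring.
by rewrite epsL dL /GRing.scale /=; ring.
Qed.

Section TensorForms.
Implicit Types (f g : A -> k) (F G : A -> A -> k).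

Definition tens f g (x y : A) : k := f x * g y.

Lemma conv_tens f g f' g' x y :
  conv (tens f g) (tens f' g') x y = conv1 f f' x * conv1 g g' y.
Proof.
rewrite /conv /conv1 mulr_suml; apply: eq_bigr => p _; rewrite mulr_sumr.
by apply: eq_bigr => q _; rewrite mulrACA.
Qed.

Lemma convDl F F' G x y c :
  conv (fun u v => F u v + c * F' u v) G x y = conv F G x y + c * conv F' G x y.
Proof.
rewrite /conv mulr_sumr -big_split; apply: eq_bigr => p _ /=.
by rewrite mulr_sumr -big_split; apply: eq_bigr => q _ /=; rewrite mulrDl mulrA.
Qed.

Lemma convDr F F' G x y c :
  conv G (fun u v => F u v + c * F' u v) x y = conv G F x y + c * conv G F' x y.
Proof.
rewrite /conv mulr_sumr -big_split; apply: eq_bigr => p _ /=.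
by rewrite mulr_sumr -big_split; apply: eq_bigr => q _ /=; rewrite mulrDr mulrCA.
Qed.

Lemma eq_conv F F' G G' : F =2 F' -> G =2 G' -> conv F G =2 conv F' G'.
Proof.
by move=> FF GG x y; apply: eq_bigr => p _; apply: eq_bigr => q _; rewrite FF GG.
Qed.

Lemma convA F G K : bilinear_form F -> bilinear_form G -> bilinear_form K ->
  forall x y, conv F (conv G K) x y = conv (conv F G) K x y.
Proof.
move=> [Fl Fr] [Gl Gr] [Kl Kr] x y; rewrite /conv.
pose T (x1 x2 x3 y1 y2 y3 : A) : k^o := F x1 y1 * (G x2 y2 * K x3 y3).
transitivity (\sum_(q <- cop y) \sum_(q' <- cop q.2)
  \sum_(p <- cop x) \sum_(p' <- cop p.2) T p.1 p'.1 p'.2 q.1 q'.1 q'.2).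
  rewrite exchange_big; apply: eq_bigr => q _.
  rewrite (eq_bigr (fun p => \sum_(p' <- cop p.2) \sum_(q' <- cop q.2)
    T p.1 p'.1 p'.2 q.1 q'.1 q'.2)); last first.
    move=> p _; rewrite mulr_sumr; apply: eq_bigr => p' _.
    by rewrite mulr_sumr.
  rewrite exchange_big; apply: eq_bigr => p _; exact: exchange_big.
transitivity (\sum_(p <- cop x) \sum_(p' <- cop p.1)
  \sum_(q <- cop y) \sum_(q' <- cop q.1) T p'.1 p'.2 p.2 q'.1 q'.2 q.2); last first.
  apply: eq_bigr => p _; rewrite exchange_big; apply: eq_bigr => q _.
  rewrite mulr_suml; apply: eq_bigr => p' _; rewrite mulr_suml.
  by apply: eq_bigr => q' _; rewrite /T mulrA.
rewrite -(@hopf_coassoc _ _ hopfA _ k^o (fun y1 y2 y3 => \sum_(p <- cop x)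
  \sum_(p' <- cop p.2) T p.1 p'.1 p'.2 y1 y2 y3)); last first.
  split=> u v; apply: is_linear_sum => p; apply: is_linear_sum => p' b y1 y2.
  - by rewrite /T (Fr _ b y1 y2) /GRing.scale /=; ring.
  - by rewrite /T (Gr _ b y1 y2) /GRing.scale /=; ring.
  - by rewrite /T (Kr _ b y1 y2) /GRing.scale /=; ring.
transitivity (\sum_(q <- cop y) \sum_(q' <- cop q.1)
  \sum_(p <- cop x) \sum_(p' <- cop p.1) T p'.1 p'.2 p.2 q'.1 q'.2 q.2).
  apply: eq_bigr => q _; apply: eq_bigr => q' _.
  rewrite (@hopf_coassoc _ _ hopfA _ k^o (fun x1 x2 x3 => T x1 x2 x3 q'.1 q'.2 q.2)) //.
  split=> u v b x1 x2.
  - by rewrite /T (Fl _ b x1 x2) /GRing.scale /=; ring.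
  - by rewrite /T (Gl _ b x1 x2) /GRing.scale /=; ring.
  - by rewrite /T (Kl _ b x1 x2) /GRing.scale /=; ring.
rewrite [RHS](eq_bigr (fun p => \sum_(q <- cop y) \sum_(q' <- cop q.1)
   \sum_(p' <- cop p.1) T p'.1 p'.2 p.2 q'.1 q'.2 q.2)); last first.
  by move=> p _; rewrite exchange_big; apply: eq_bigr => q _; exact: exchange_big.
rewrite [RHS]exchange_big; apply: eq_bigr => q _; rewrite [RHS]exchange_big.
by [].
Qed.

End TensorForms.

Lemma conv_skew_tens c f g x y : scalar f -> scalar g ->
  conv (skew_cocycle c) (tens f g) x y = f x * g y + c * (conv1 d' f x * conv1 d g y).
Proof.
move=> fL gL; rewrite -[skew_cocycle c]/(fun x y =>
  tens (@eps _ A) (@eps _ A) x y + c * tens d' d x y).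
by rewrite convDl !conv_tens !conv1_epsl.
Qed.

Lemma conv_skew_skew c e x y :
  conv (skew_cocycle c) (skew_cocycle e) x y = skew_cocycle (c + e) x y.
Proof.
rewrite -[skew_cocycle e]/(fun x y =>
  tens (@eps _ A) (@eps _ A) x y + e * tens d' d x y).
rewrite convDr !conv_skew_tens // !conv1_epsr // conv1_d'd' mul0r mulr0 addr0.
by rewrite /skew_cocycle mulrDl addrA.
Qed.

Lemma skew_cocycle0 : skew_cocycle 0 =2 @conv_unit _ A.
Proof. by move=> x y; rewrite /skew_cocycle mul0r addr0. Qed.

(** An exponential is inverted by changing the sign of the exponent. *)
Lemma skew_cocycle_inverse c : is_conv_inverse (skew_cocycle c) (skew_cocycle (- c)).
Proof.
split; first exact: skew_cocycle_bilinear.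
  by move=> x y; rewrite conv_skew_skew subrr skew_cocycle0.
by move=> x y; rewrite conv_skew_skew addNr skew_cocycle0.
Qed.

Lemma conv_unitl F x y : bilinear_form F -> conv (@conv_unit _ A) F x y = F x y.
Proof.
case=> Fl Fr; rewrite /conv /conv_unit.
transitivity (\sum_(p <- cop x) eps p.1 * F p.2 y).
  apply: eq_bigr => p _; rewrite -[in RHS](lact_eps hopfA y).
  rewrite (@lin_sum k A k^o _ (Fr _)) mulr_sumr; apply: eq_bigr => q _.
  by rewrite (@linZ k A k^o _ (Fr _)) mulrA.
rewrite -[in RHS](lact_eps hopfA x) (@lin_sum k A k^o _ (Fl _)).
by apply: eq_bigr => p _; rewrite (@linZ k A k^o _ (Fl _)).
Qed.

Lemma conv_unitr F x y : bilinear_form F -> conv F (@conv_unit _ A) x y = F x y.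
Proof.
case=> Fl Fr; rewrite /conv /conv_unit.
transitivity (\sum_(p <- cop x) F p.1 y * eps p.2).
  apply: eq_bigr => p _; rewrite -[in RHS](ract_eps hopfA y).
  rewrite (@lin_sum k A k^o _ (Fr _)) mulr_suml; apply: eq_bigr => q _.
  by rewrite (@linZ k A k^o _ (Fr _)) /GRing.scale /=; ring.
rewrite -[in RHS](ract_eps hopfA x) (@lin_sum k A k^o _ (Fl _)).
by apply: eq_bigr => p _; rewrite (@linZ k A k^o _ (Fl _)) mulrC.
Qed.

(** The convolution inverse is a chosen one; it is unique because convolution of bilinear
forms is associative. *)
Lemma conv_inv_skew c : conv_inv (skew_cocycle c) =2 skew_cocycle (- c).
Proof.
have inv := skew_cocycle_inverse c.
have [gB fg gf] : is_conv_inverse (skew_cocycle c) (conv_inv (skew_cocycle c)).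
  by apply: xgetPex; exists (skew_cocycle (- c)).
case: inv => iB fi if_ x y.
rewrite -[LHS]conv_unitl // -(eq_conv if_ (fun _ _ => erefl)).
rewrite -convA //; last exact: skew_cocycle_bilinear.
by rewrite (eq_conv (fun _ _ => erefl) fg) conv_unitr.
Qed.

(** Expanding both sides by the rules for d and d' on products, each term in c^2 has one of
d * d, d' * d, d * d', d' * d' as a factor, all of which vanish; the terms of degree at
most one in c agree. *)
Lemma skew_cocycle_is_cocycle c : mult_cocycle (skew_cocycle c).
Proof.
split; first exact: skew_cocycle_bilinear.
- by exists (skew_cocycle (- c)); exact: skew_cocycle_inverse.
- move=> x y z.
  rewrite -[LHS]/(conv (skew_cocycle c) (fun u v => skew_cocycle c x (u ** v)) y z).
  rewrite -[RHS]/(conv (skew_cocycle c) (fun u v => skew_cocycle c (u ** v) z) x y).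
  transitivity (eps x * skew_cocycle c y z + c * d' x * (s y * d z + d y * eps z)).
    (* The summand 0 * 0 brings the expression to the form to which [convDr] applies. *)
    rewrite (eq_conv (F' := skew_cocycle c) (G' := fun u v =>
      (fun u v => (fun u v => 0 * 0 + eps x * tens (@eps _ A) (@eps _ A) u v) u v +
        (c * d' x) * tens s d u v) u v + (c * d' x) * tens d (@eps _ A) u v)) //; last first.
      move=> u v; rewrite /skew_cocycle (hopf_epsM hopfA) (sk_dM sk) /tens; ring.
    have zero u v : conv (skew_cocycle c) (fun _ _ : A => 0 * 0) u v = 0.
      by rewrite /conv big1 // => p _; rewrite big1 // => q _; rewrite !mulr0.
    rewrite !convDr zero !conv_skew_tens // !conv1_epsr // (sk_dd sk) conv1_d'd.
    by rewrite mulr0 mul0r !mulr0 /skew_cocycle; ring.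
  rewrite (eq_conv (F' := skew_cocycle c) (G' := fun u v =>
      (fun u v => (fun u v => 0 * 0 + eps z * tens (@eps _ A) (@eps _ A) u v) u v +
        (c * d z) * tens d' s u v) u v + (c * d z) * tens (@eps _ A) d' u v)) //; last first.
    move=> u v; rewrite /skew_cocycle (hopf_epsM hopfA) skew_leftM /tens; ring.
  have zero u v : conv (skew_cocycle c) (fun _ _ : A => 0 * 0) u v = 0.
    by rewrite /conv big1 // => p _; rewrite big1 // => q _; rewrite !mulr0.
  rewrite !convDr zero !conv_skew_tens // !conv1_epsr // conv1_dd' conv1_d'd'.
  by rewrite mulr0 mul0r !mulr0 /skew_cocycle; ring.
- move=> x; rewrite /skew_cocycle (hopf_eps1 hopfA) (sk_d1 sk) skew_left1.
  by split; ring.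
Qed.

(** The powers of exponent at least two vanish, so that the exponential series stops after
its linear term. *)
Lemma conv_exp_skew eta c : eta =2 (fun x y => c * (d' x * d y)) ->
  conv_exp eta =2 skew_cocycle c.
Proof.
move=> etaE x y; pose F := fun u v : A => 0 * 0 + c * tens d' d u v.
have FE : eta =2 F by move=> u v; rewrite etaE /F mul0r add0r.
have FB : bilinear_form F.
  split=> [v|u] b z t; rewrite /F /tens /=.
    by rewrite d'L /GRing.scale /=; ring.
  by rewrite dL /GRing.scale /=; ring.
have zero u v G : conv (fun _ _ : A => 0 * 0) G u v = 0.
  by rewrite /conv big1 // => p _; rewrite big1 // => q _; rewrite !mul0r.
have zeror u v G : conv G (fun _ _ : A => 0 * 0) u v = 0.
  by rewrite /conv big1 // => p _; rewrite big1 // => q _; rewrite !mulr0.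
have pow1 u v : conv_pow eta 1 u v = F u v.
  by rewrite /conv_pow /= (eq_conv FE (fun _ _ => erefl)) conv_unitr.
have pow2 i u v : conv_pow eta i.+2 u v = 0.
  elim: i u v => [|i IH] u v; rewrite /conv_pow iterS -/(conv_pow eta _).
    rewrite (eq_conv FE pow1) /F convDl zero convDr zeror conv_tens.
    by rewrite conv1_d'd' mul0r; ring.
  rewrite (eq_conv FE (G' := fun _ _ => 0 * 0)) ?zeror // => a b.
  by rewrite IH mul0r.
rewrite /conv_exp (@fsbigE _ _ _ _ _ [:: 0; 1]%N) //=; last first.
  by case=> [|[|i]] // _ _; rewrite pow2 mul0r.
rewrite !big_cons big_nil !ifT ?in_setT // pow1 /F /tens /conv_pow /= /conv_unit.
by rewrite /skew_cocycle !divr1 addr0 mul0r add0r.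
Qed.

End SkewPair.

Section Deformation.
Variables (k : fieldType) (A : hopf_data k) (s d : A -> k).
Hypotheses (hopfA : is_hopf A) (sk : skew_pair s d).
Variable c : k.
Let algA := hopf_algebra hopfA.
Let sL := sk_sL sk.
Let dL := sk_dL sk.
Let epsL : scalar (@eps _ A) := hopf_eps_linear hopfA.
Local Notation d' := (skew_left s d).
Let d'L := skew_left_linear hopfA sk.
Local Notation H := (deform (skew_cocycle s d c)).

Let quad_sum (x y : A) (F : A -> A -> A -> A -> k) : A :=
  \sum_(p <- cop x) \sum_(p' <- cop p.2) \sum_(q <- cop y) \sum_(q' <- cop q.2)
    F p.1 q.1 p'.2 q'.2 *: (p'.1 ** q'.1).

Let quad_sumD x y F G b : quad_sum x y (fun u v w t => F u v w t + b * G u v w t) =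
  quad_sum x y F + b *: quad_sum x y G.
Proof.
rewrite /quad_sum scaler_sumr -big_split; apply: eq_bigr => p _ /=.
rewrite scaler_sumr -big_split; apply: eq_bigr => p' _ /=.
rewrite scaler_sumr -big_split; apply: eq_bigr => q _ /=.
rewrite scaler_sumr -big_split; apply: eq_bigr => q' _ /=.
by rewrite scalerDl scalerA.
Qed.

Let quad_sum0 x y : quad_sum x y (fun _ _ _ _ => 0) = 0.
Proof. by do 4!rewrite [LHS]big1 // => ? _; rewrite scale0r. Qed.

Lemma ract_lactE f f' x : scalar f -> scalar f' ->
  ract f' (lact f x) =
  \sum_(p <- cop x) \sum_(p' <- cop p.2) (f p.1 * f' p'.2) *: p'.1 :> A.
Proof.
move=> fL fL'; rewrite [lact f x]/(copf _ _) (lin_sum (ract_linear hopfA fL')).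
apply: eq_bigr => p _; rewrite (linZ (ract_linear hopfA fL')) scaler_sumr.
by apply: eq_bigr => q _; rewrite scalerA.
Qed.

Let quad_sum_tens x y f g f' g' : scalar f -> scalar g -> scalar f' -> scalar g' ->
  quad_sum x y (fun u v w t => (f u * g v) * (f' w * g' t)) =
  ract f' (lact f x) ** ract g' (lact g y).
Proof.
move=> fL gL fL' gL'; rewrite !ract_lactE // hmul_suml //; apply: eq_bigr => p _.
rewrite hmul_suml //; apply: eq_bigr => p' _.
rewrite hmul_sumr //; apply: eq_bigr => q _.
rewrite hmul_sumr //; apply: eq_bigr => q' _.
by rewrite hmulZl // hmulZr // scalerA mulrACA.
Qed.

(** Expanding sigma on the left and its inverse on the right gives four terms, and the one in
c^2 is the correction of a correction: the composite of two twists. *)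
Lemma deform_mulE (x y : A) : deform_mul (skew_cocycle s d c) x y =
  twist (twist (@hmul _ A) (lact d') (lact d) c) (ract d') (ract d) (- c) x y.
Proof.
pose e := @eps _ A.
transitivity (quad_sum x y (fun u v w t =>
  (fun u v w t => (fun u v w t => (fun u v w t => (fun _ _ _ _ => 0) u v w t +
     1 * ((e u * e v) * (e w * e t))) u v w t
   + c * ((d' u * d v) * (e w * e t))) u v w t
   + (- c) * ((e u * e v) * (d' w * d t))) u v w t
   + (- c * c) * ((d' u * d v) * (d' w * d t)))).
  apply: eq_bigr => p _; apply: eq_bigr => p' _; apply: eq_bigr => q _.
  apply: eq_bigr => q' _; congr (_ *: _).
  by rewrite (conv_inv_skew hopfA sk) /skew_cocycle /e; ring.
rewrite !quad_sumD quad_sum0 add0r !quad_sum_tens // scale1r.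
by rewrite !lact_eps // !ract_eps // /twist scalerDr scalerA !(lact_ract hopfA) // !addrA.
Qed.

Let zero_lact (f : A -> k) x : f =1 (fun=> 0) -> lact f x = 0.
Proof. by move=> f0; rewrite /lact /copf big1 // => p _; rewrite f0 scale0r. Qed.
Let zero_ract (f : A -> k) x : f =1 (fun=> 0) -> ract f x = 0.
Proof. by move=> f0; rewrite /ract /copf big1 // => p _; rewrite f0 scale0r. Qed.

Let lact_right : right_derivation (@hmul _ A) (lact d) (lact s).
Proof.
move=> y z; rewrite (lactM hopfA (f1 := s) (g1 := d) (f2 := d) (g2 := @eps _ A)) //.
  by rewrite lact_eps // addrC.
exact: (sk_dM sk).
Qed.

Let ract_right : right_derivation (@hmul _ A) (ract d) (ract s).
Proof.
move=> y z; rewrite (ractM hopfA (f1 := s) (g1 := d) (f2 := d) (g2 := @eps _ A)) //.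
  by rewrite ract_eps // addrC.
exact: (sk_dM sk).
Qed.

Let lact_left : left_derivation (@hmul _ A) (lact d') (lact s).
Proof.
move=> y z; rewrite (lactM hopfA (f1 := d') (g1 := s) (f2 := @eps _ A) (g2 := d')) //.
  by rewrite lact_eps.
exact: (skew_leftM hopfA sk).
Qed.

Let ract_left : left_derivation (@hmul _ A) (ract d') (ract s).
Proof.
move=> y z; rewrite (ractM hopfA (f1 := d') (g1 := s) (f2 := @eps _ A) (g2 := d')) //.
  by rewrite ract_eps.
exact: (skew_leftM hopfA sk).
Qed.

Let m1 := twist (@hmul _ A) (lact d') (lact d) c.

Let m1_bilinear : bilinear_map m1.
Proof.
by apply: twist_bilinear; [case: algA|exact: lact_linear|exact: lact_linear].
Qed.

Let m1_assoc : associative m1.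
Proof.
apply: (twist_assoc (S := lact s)) => //; try exact: lact_linear; try by case: algA.
- by move=> x; rewrite lact_lact //; apply: zero_lact; exact: (conv1_d'd' hopfA sk).
- by move=> x; rewrite lact_lact //; apply: zero_lact; exact: (conv1_dd' hopfA sk).
- by move=> x; rewrite lact_lact //; apply: zero_lact; exact: (conv1_d'd hopfA sk).
- by move=> x; rewrite lact_lact //; apply: zero_lact; exact: (sk_dd sk).
Qed.

Lemma lact1 f : scalar f -> lact f (hone A) = f (hone A) *: hone A.
Proof. by move=> fL; rewrite /lact (copf1 (hopf_cop1 hopfA)) //; exact: bilinear_scalel. Qed.

Lemma ract1 f : scalar f -> ract f (hone A) = f (hone A) *: hone A.
Proof. by move=> fL; rewrite /ract (copf1 (hopf_cop1 hopfA)) //; exact: bilinear_scaler. Qed.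

Lemma deform_is_algebra : is_algebra H.
Proof.
have mB : bilinear_map (twist m1 (ract d') (ract d) (- c)).
  by apply: twist_bilinear => //; exact: ract_linear.
split.
- split=> [y b x z|x b y z]; rewrite /= !deform_mulE; first exact: mB.1.
  exact: mB.2.
- move=> x y z; rewrite /= !deform_mulE.
  apply: (twist_assoc (S := ract s)) => //; try exact: ract_linear.
  + by apply: twist_right_derivation => //; try exact: ract_linear;
      move=> t; rewrite -lact_ract.
  + by apply: twist_left_derivation => //; try exact: ract_linear;
      move=> t; rewrite -lact_ract.
  + by move=> t; rewrite ract_ract //; apply: zero_ract; exact: (conv1_d'd' hopfA sk).
  + by move=> t; rewrite ract_ract //; apply: zero_ract; exact: (conv1_d'd hopfA sk).
  + by move=> t; rewrite ract_ract //; apply: zero_ract; exact: (conv1_dd' hopfA sk).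
  + by move=> t; rewrite ract_ract //; apply: zero_ract; exact: (sk_dd sk).
- move=> x; rewrite /= deform_mulE /twist hmul1l // !lact1 // !ract1 //.
  rewrite (skew_left1 hopfA sk) !scale0r (lin0 (lact_linear hopfA d'L)).
  by rewrite !hmul0l // !scaler0 !addr0 scaler0 addr0.
- move=> x; rewrite /= deform_mulE /twist hmul1r // !lact1 // !ract1 //.
  rewrite (sk_d1 sk) !scale0r (lin0 (lact_linear hopfA dL)).
  by rewrite !hmul0r // !scaler0 !addr0 scaler0 addr0.
Qed.

Lemma lact_grouplike f g : scalar f -> tensor_eq (cop g) [:: (g, g)] ->
  lact f g = f g *: g :> A.
Proof. by move=> fL gg; rewrite /lact (copf_grouplike gg) //; exact: bilinear_scalel. Qed.

Lemma ract_grouplike f g : scalar f -> tensor_eq (cop g) [:: (g, g)] ->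
  ract f g = f g *: g :> A.
Proof. by move=> fL gg; rewrite /ract (copf_grouplike gg) //; exact: bilinear_scaler. Qed.

Lemma skew_left_grouplike g : tensor_eq (cop g) [:: (g, g)] ->
  d' g = d g * s g.
Proof. by move=> gg; rewrite /skew_left conv1_ract // ract_grouplike // formZ // mulrC. Qed.

Lemma deform_mul_grouplike g y : tensor_eq (cop g) [:: (g, g)] -> d g = 0 ->
  (g : H) ** (y : H) = (g : A) ** (y : A).
Proof.
move=> gg dg; have d'g : d' g = 0 by rewrite skew_left_grouplike // dg mul0r.
rewrite /= deform_mulE /twist lact_grouplike // ract_grouplike // d'g !scale0r.
by rewrite (lin0 (lact_linear hopfA d'L)) !hmul0l // !scaler0 !addr0 scaler0 addr0.
Qed.

Section SkewPrimitiveElement.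
Variables (a g : A).
Hypotheses (gg : tensor_eq (cop g) [:: (g, g)]).
Hypotheses (ag : tensor_eq (cop a) [:: (a, hone A); (g, a)]).
Hypotheses (sa : s a = 0) (da : d a = 1) (dg : d g = 0).

Lemma lact_skew f : scalar f -> lact f a = f a *: hone A + f g *: a.
Proof. by move=> fL; rewrite /lact (copf_skew ag) //; exact: bilinear_scalel. Qed.

Lemma ract_skew f : scalar f -> ract f a = f (hone A) *: a + f a *: g.
Proof. by move=> fL; rewrite /ract (copf_skew ag) //; exact: bilinear_scaler. Qed.

Lemma skew_left_skew : d' a = 1.
Proof.
rewrite /skew_left conv1_ract // ract_skew // (sk_s1 sk) sa scale1r scale0r addr0.
exact: da.
Qed.

(** For y = a_j the correction is c (1 - h_i h_j): this is what shifts the parameter of the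
quadratic relations. *)
Lemma deform_mul_skew y :
  (a : H) ** (y : H) = (a : A) ** (y : A) + c *: (lact d y - g ** ract d y).
Proof.
have d'g : d' g = 0 by rewrite skew_left_grouplike // dg mul0r.
rewrite /= deform_mulE /twist lact_skew // ract_skew // skew_left_skew d'g.
rewrite (skew_left1 hopfA sk) !scale1r !scale0r addr0 add0r hmul1l //.
rewrite (lact_grouplike d'L gg) d'g scale0r hmul0l // scaler0 addr0.
by rewrite scalerBr scaleNr addrA.
Qed.

End SkewPrimitiveElement.

End Deformation.

(** * Isomorphisms of Hopf algebras *)

Section Transport.
Variable k : fieldType.
Implicit Types A B : hopf_data k.

Definition coalg_map A B (phi : A -> B) : Prop :=
  forall x, tensor_eq (cop (phi x)) [seq (phi p.1, phi p.2) | p <- cop x].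

Record hopf_iso A B (phi : A -> B) : Prop := HopfIso {
  hi_linear : linear phi;
  hi_bij : bijective phi;
  hi_one : phi (hone A) = hone B;
  hi_mul : {morph phi : x y / x ** y >-> x ** y};
  hi_cop : coalg_map phi;
  hi_eps : forall x, eps (phi x) = eps x }.

Lemma copf_map A B (phi : A -> B) (W : lmodType k) (f : B -> B -> W) x :
  coalg_map phi -> bilinear_map f ->
  copf f (phi x) = copf (fun u v => f (phi u) (phi v)) x.
Proof. by move=> phiC fB; rewrite /copf (tensor_eqE (phiC x) fB) big_map. Qed.

Lemma coalg_map_copf A B (phi : A -> B) :
  (forall (W : lmodType k) (f : B -> B -> W) x, bilinear_map f ->
    copf f (phi x) = copf (fun u v => f (phi u) (phi v)) x) -> coalg_map phi.
Proof. by move=> H x W f fB; rewrite -[LHS]/(copf f _) H // big_map. Qed.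

Lemma linear_inverse (U V : lmodType k) (f : U -> V) g :
  linear f -> cancel f g -> cancel g f -> linear g.
Proof. by move=> fL fK gK c x y; apply: (can_inj fK); rewrite gK fL !gK. Qed.

Lemma hopf_iso_inverse A B (phi : A -> B) psi : hopf_iso phi ->
  cancel phi psi -> cancel psi phi -> hopf_iso psi.
Proof.
move=> [L _ phi1 phiM phiC phiE] phiK psiK.
have psiL := linear_inverse L phiK psiK.
split=> //.
- by exists phi.
- by rewrite -phi1 phiK.
- by move=> x y; apply: (can_inj phiK); rewrite phiM !psiK.
- apply: coalg_map_copf => W f x fB; rewrite -[in RHS](psiK x).
  rewrite (copf_map _ phiC); last exact: bilinear_comp.
  by apply: eq_bigr => p _; rewrite !phiK.
- by move=> x; rewrite -phiE psiK.
Qed.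

Lemma hopf_iso_comp A B (C : hopf_data k) (phi : A -> B) (psi : B -> C) :
  hopf_iso phi -> hopf_iso psi -> hopf_iso (fun x => psi (phi x)).
Proof.
move=> [L1 b1 o1 M1 C1 E1] [L2 b2 o2 M2 C2 E2]; split.
- exact: is_linear_comp.
- exact: bij_comp b2 b1.
- by rewrite o1.
- by move=> x y; rewrite M1 M2.
- apply: coalg_map_copf => W f x fB; rewrite (copf_map _ C2) // (copf_map _ C1) //.
  exact: bilinear_comp.
- by move=> x; rewrite E2.
Qed.

(** Transport of structure: all the axioms of A are read through phi. *)
Lemma hopf_iso_hopf A B (phi : A -> B) : hopf_iso phi -> is_hopf B -> is_hopf A.
Proof.
move=> iso hopfB; have [L [psi phiK psiK] phi1 phiM phiC phiE] := iso.
have [psiL _ psi1 psiM psiC psiE] := hopf_iso_inverse iso phiK psiK.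
have algB := hopf_algebra hopfB.
have copfE (W : lmodType k) (f : A -> A -> W) x : bilinear_map f ->
    copf f x = copf (fun u v => f (psi u) (psi v)) (phi x).
  by move=> fB; rewrite -{1}(phiK x) (copf_map _ psiC).
have copL : cop_linear A.
  move=> c x y W f fB; rewrite -[LHS]/(copf f _) copfE // L hopf_copfL //; last first.
    exact: bilinear_comp.
  rewrite -!copfE // big_cat big_map /= /copf; congr (_ + _).
  by rewrite scaler_sumr; apply: eq_bigr => p _; rewrite (linZ (fB.1 _)).
have inj := can_inj phiK.
split.
- split.
  + split=> [y c x z|x c y z]; apply: inj; rewrite !(phiM, L).
      by rewrite hmul_linl.
    by rewrite hmul_linr.
  + by move=> x y z; apply: inj; rewrite !phiM hmulA.
  + by move=> x; apply: inj; rewrite phiM phi1 hmul1l.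
  + by move=> x; apply: inj; rewrite phiM phi1 hmul1r.
- have epsL : scalar (@eps _ A).
    by move=> c x y; rewrite -!phiE L; exact: (hopf_eps_linear hopfB).
  split=> //.
  + move=> x W f fT.
    rewrite -[LHS]/(copf (fun u v => copf (fun s t => f s t v) u) _).
    rewrite -[RHS]/(copf (fun u v => copf (f u) v) _).
    rewrite (copfE _ _ _ (bilinear_copl copL fT)) (copfE _ _ _ (bilinear_copr copL fT)).
    have fT' : trilinear_map (fun u v w => f (psi u) (psi v) (psi w)).
      case: fT => f1 f2 f3; split=> u v.
      - exact: (is_linear_comp (f1 _ _) psiL).
      - exact: (is_linear_comp (f2 _ _) psiL).
      - exact: (is_linear_comp (f3 _ _) psiL).
    transitivity (\sum_(p <- cop (phi x)) \sum_(q <- cop p.1)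
        f (psi q.1) (psi q.2) (psi p.2)).
      apply: eq_bigr => p _; rewrite copfE ?psiK //; exact: trilinear12.
    rewrite (hopf_coassoc hopfB _ fT').
    apply: eq_bigr => p _; rewrite [RHS]copfE ?psiK //; exact: trilinear23.
  + move=> x; rewrite -[LHS]/(copf (fun u v => eps u *: v) x).
    rewrite copfE; last exact: bilinear_scalel.
    apply: inj; rewrite -[in RHS](hopf_counitl hopfB (phi x)) /copf (lin_sum L).
    by apply: eq_bigr => p _; rewrite (linZ L) psiK psiE.
  + move=> x; rewrite -[LHS]/(copf (fun u v => eps v *: u) x).
    rewrite copfE; last exact: bilinear_scaler.
    apply: inj; rewrite -[in RHS](hopf_counitr hopfB (phi x)) /copf (lin_sum L).
    by apply: eq_bigr => p _; rewrite (linZ L) psiK psiE.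
- split=> [|x y] W f fB.
    rewrite -[LHS]/(copf f _) copfE // phi1 (copf1 (hopf_cop1 hopfB)) ?psi1 ?big_seq1 //.
    exact: bilinear_comp.
  have fB' := bilinear_comp fB psiL psiL.
  rewrite -[LHS]/(copf f _) copfE // phiM (copfM (hopf_copM hopfB _ _) fB').
  rewrite -[LHS]/(copf (fun u v => copf (fun s t => f (psi (u ** s)) (psi (v ** t))) (phi y)) (phi x)).
  rewrite big_allpairs_dep (copf_map _ phiC); last first.
    split=> [v c u w|u c v w]; rewrite /copf scaler_sumr -big_split;
      apply: eq_bigr => p _ /=.
      by rewrite (hmul_linl algB) (fB'.1 _).
    by rewrite (hmul_linl algB) (fB'.2 _).
  apply: eq_bigr => p _; rewrite (copf_map _ phiC); last first.
    by apply: (bilinear_comp fB'); exact: hmul_linr.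
  by apply: eq_bigr => q _; rewrite -!phiM !phiK.
- split; first by rewrite -phiE phi1 hopf_eps1.
  by move=> x y; rewrite -!phiE phiM hopf_epsM.
- have [_ _ _ _ [S [SL Sl Sr]]] := hopfB.
  exists (fun x => psi (S (phi x))); split.
  + by apply: is_linear_comp => //; apply: is_linear_comp.
  + move=> x; rewrite -[LHS]/(copf (fun u v => psi (S (phi u)) ** v) x).
    apply: inj; rewrite (linZ L) phi1 -phiE -Sl (lin_sum L).
    rewrite -[RHS]/(copf (fun u v => S u ** v) (phi x)) (copf_map _ phiC).
      by apply: eq_bigr => p _; rewrite phiM psiK.
    by apply: (bilinear_hmul algB SL); exact: is_linear_id.
  + move=> x; rewrite -[LHS]/(copf (fun u v => u ** psi (S (phi v))) x).
    apply: inj; rewrite (linZ L) phi1 -phiE -Sr (lin_sum L).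
    rewrite -[RHS]/(copf (fun u v => u ** S v) (phi x)) (copf_map _ phiC).
      by apply: eq_bigr => p _; rewrite phiM psiK.
    by apply: (bilinear_hmul algB _ SL); exact: is_linear_id.
Qed.

Lemma hopf_iso_isomorphic A B (phi : A -> B) : hopf_iso phi -> is_hopf B ->
  hopf_isomorphic A B.
Proof.
move=> iso hopfB; split=> //; first exact: hopf_iso_hopf iso hopfB.
by case: iso => *; exists phi; split.
Qed.

End Transport.

(** * Skew pairs on quadratic Hopf algebras *)

Section QuadFunctionals.
Variables (n : nat) (X : {set 'S_n}) (k : fieldType).
Hypothesis X_odd : forall i : idx X, odd_perm (val i).
Variable Rel : seq (idx X * idx X) -> Prop.
Implicit Types (A B : hopf_data k).

(** Initiality among the algebras with elements satisfying the relations. *)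
Definition quad_universal (c : k) A (a : idx X -> A) (h : 'S_n -> A) : Prop :=
  forall B (b : idx X -> B) (l : 'S_n -> B), is_algebra B -> common_ok b l ->
    (forall r, Rel r -> quad_ok b l c r) ->
  exists phi : A -> B, [/\ linear phi, phi (hone A) = hone B,
    {morph phi : x y / x ** y >-> x ** y}, forall i, phi (a i) = b i
    & forall g, phi (h g) = l g].

Record skew_values A (a : idx X -> A) (h : 'S_n -> A) (s d : A -> k) : Prop :=
  SkewValues {
  sv_sa : forall i, s (a i) = 0;
  sv_sh : forall g, s (h g) = sgn k g;
  sv_da : forall i, d (a i) = 1;
  sv_dh : forall g, d (h g) = 0 }.

Section Existence.
Variables (c : k) (A : hopf_data k) (a : idx X -> A) (h : 'S_n -> A).
Hypotheses (qA : quad_struct Rel c a h) (uA : quad_universal c a h).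
Let hopfA := qs_hopf qA.
Let algA := hopf_algebra hopfA.

Let ta (i : idx X) : tri_alg k := (0 : k^o, 1 : k^o, 0 : k^o).
Let th (g : 'S_n) : tri_alg k := (sgn k g : k^o, 0 : k^o, 1 : k^o).

Let t_common : common_ok ta th.
Proof.
split=> [|r t|j i jt].
- by rewrite /th /sgn odd_perm1.
- by apply: triple_eq; rewrite /= ?mulr0 ?mul0r ?addr0 ?mulr1 // sgn_pmul.
- rewrite /= /tri_mul /ta /th /= sgn_transposition //.
  by apply: triple_eq; rewrite /= ?mulr0 ?mul0r ?add0r ?addr0 ?mulr1 ?mul1r ?oppr0.
Qed.

Let t_quad r : quad_ok ta th c r.
Proof.
rewrite /quad_ok big1 => [|p _]; last first.
  by apply: triple_eq; rewrite /= ?mulr0 ?mul0r ?add0r.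
rewrite big1 ?scaler0 // => p _; apply/eqP; rewrite subr_eq0; apply/eqP.
apply: triple_eq; rewrite /= ?mulr0 ?mul0r ?add0r ?mulr1 //.
by rewrite !sgn_idx // mulrNN mulr1.
Qed.

(** The functional d is the upper right entry of the two-dimensional
representation in which h_g acts by diag(sgn g, 1) and a_i by the strictly upper
triangular unit. The relations s * s = eps, s * d = - d * s and d * d = 0 are then checked
on products with a generator on the left, by induction. *)
Lemma quad_skew_pair : exists s d : A -> k, skew_pair s d /\ skew_values a h s d.
Proof.
have [phi [L one M pa ph]] := uA (tri_is_algebra k) t_common (fun r _ => t_quad r).
pose s x : k := (phi x).1.1; pose d x : k := (phi x).1.2; pose e x : k := (phi x).2.
have sL : scalar s by move=> b x y; rewrite /s L.
have dL : scalar d by move=> b x y; rewrite /d L.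
have eL : scalar e by move=> b x y; rewrite /e L.
have sM x y : s (x ** y) = s x * s y by rewrite /s M.
have eM x y : e (x ** y) = e x * e y by rewrite /e M.
have dM' x y : d (x ** y) = s x * d y + d x * e y by rewrite /d M.
have sa i : s (a i) = 0 by rewrite /s pa.
have sh g : s (h g) = sgn k g by rewrite /s ph.
have da i : d (a i) = 1 by rewrite /d pa.
have dh g : d (h g) = 0 by rewrite /d ph.
have ea i : e (a i) = 0 by rewrite /e pa.
have eh g : e (h g) = 1 by rewrite /e ph.
have epsL := hopf_eps_linear hopfA; have epsM := hopf_epsM hopfA.
have eE x : e x = eps x.
  move: x; apply: (qs_gen qA) => [|b x y Hx Hy|[i|g] x Hx].
  - by rewrite /e one hopf_eps1.
  - by rewrite eL epsL Hx Hy.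
  - by rewrite eM epsM ea (qs_eps_a qA) !mul0r.
  - by rewrite eM epsM eh (qs_eps_h qA) Hx !mul1r.
have dM x y : d (x ** y) = s x * d y + d x * eps y by rewrite dM' eE.
have s1 : s (hone A) = 1 by rewrite /s one.
have d1 : d (hone A) = 0 by rewrite /d one.
have conv_bil (f g : A -> k) : scalar f -> scalar g ->
    bilinear_map (W := k^o) (fun u v : A => f u * g v).
  move=> fL gL; split=> [v|u] b x y; rewrite ?fL ?gL /GRing.scale /=; ring.
have conv_h (f g : A -> k) t y : scalar f -> scalar g ->
    conv1 f g (h t ** y) = \sum_(q <- cop y) f (h t ** q.1) * g (h t ** q.2).
  move=> fL gL.
  exact: (copf_grouplikeM hopfA (qs_cop_h qA t) (conv_bil f g fL gL) y).
have conv_a (f g : A -> k) (i : idx X) y : scalar f -> scalar g ->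
    conv1 f g (a i ** y) = \sum_(q <- cop y) (f (a i ** q.1) * g q.2 +
      f (h (val i) ** q.1) * g (a i ** q.2)).
  move=> fL gL; rewrite big_split.
  exact: (copf_skewM hopfA (qs_cop_a qA i) (conv_bil f g fL gL) y).
have s_au i u : s (a i ** u) = 0 by rewrite sM sa mul0r.
have d_au i u : d (a i ** u) = eps u by rewrite dM sa da mul0r add0r mul1r.
have s_hu (i : idx X) u : s (h (val i) ** u) = - s u by rewrite sM sh sgn_idx // mulN1r.
have d_hu (i : idx X) u : d (h (val i) ** u) = - d u by rewrite dM sh dh sgn_idx // mulN1r mul0r addr0.
have s_gu t u : s (h t ** u) = sgn k t * s u by rewrite sM sh.
have d_gu t u : d (h t ** u) = sgn k t * d u by rewrite dM sh dh mul0r addr0.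
have conv_hh (f g : A -> k) t y : scalar f -> scalar g ->
    (forall u, f (h t ** u) = sgn k t * f u) -> (forall u, g (h t ** u) = sgn k t * g u) ->
    conv1 f g (h t ** y) = conv1 f g y.
  move=> fL gL fh gh; rewrite conv_h //; apply: eq_bigr => q _.
  by rewrite fh gh mulrACA sgn_sq mul1r.
have eps1 := hopf_eps1 hopfA.
have conv_one (f g : A -> k) : scalar f -> scalar g -> conv1 f g (hone A) = f (hone A) * g (hone A).
  move=> fL gL; rewrite -[LHS]/(copf (W := k^o) (fun u v => f u * g v) _).
  by rewrite (copf1 (hopf_cop1 hopfA)) //; exact: conv_bil.
have convL (f g : A -> k) : scalar f -> scalar g -> scalar (conv1 f g) by move=> fL gL; exact: (conv1_linear hopfA).
exists s, d; split; split=> // [x|x|x].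
- move: x; apply: (qs_gen qA) => [|b x y Hx Hy|[i|g] x Hx].
  + by rewrite conv_one // s1 mulr1 eps1.
  + by rewrite convL // epsL Hx Hy.
  + rewrite conv_a // epsM (qs_eps_a qA) mul0r big1 // => q _.
    by rewrite !s_au mul0r mulr0 addr0.
  + by rewrite conv_hh // Hx epsM (qs_eps_h qA) mul1r.
- move: x; apply: (qs_gen qA) => [|b x y Hx Hy|[i|g] x Hx].
  + by rewrite !conv_one // d1 mul0r mulr0 oppr0.
  + by rewrite !convL // Hx Hy opprD mulrN.
  + rewrite !conv_a //.
    transitivity (- conv1 s (@eps _ A) x).
      by rewrite /conv1 -sumrN; apply: eq_bigr => q _; rewrite s_au s_hu d_au mul0r add0r mulNr.
    rewrite conv1_epsr // -{1}(conv1_epsl hopfA x sL) /conv1; congr (- _).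
    by apply: eq_bigr => q _; rewrite d_au d_hu s_au mulr0 addr0.
  + by rewrite !conv_hh.
- move: x; apply: (qs_gen qA) => [|b x y Hx Hy|[i|g] x Hx].
  + by rewrite conv_one // d1 mul0r.
  + by rewrite !convL // Hx Hy mulr0 addr0.
  + rewrite conv_a //.
    transitivity (conv1 (@eps _ A) d x - conv1 d (@eps _ A) x).
      rewrite /conv1 -sumrN -big_split; apply: eq_bigr => q _ /=.
      by rewrite !d_au d_hu mulNr.
    by rewrite conv1_epsl // conv1_epsr // subrr.
  + by rewrite !conv_hh.
Qed.

End Existence.
End QuadFunctionals.

(** * The deformation shifts the parameter *)

Section CopActions.
Variables (k : fieldType) (A : hopf_data k).
Hypothesis hopfA : is_hopf A.
Variables (W : lmodType k) (f : A -> A -> W) (g : A -> k).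
Hypotheses (fB : bilinear_map f) (gL : scalar g).

Let tri1 : trilinear_map (fun u v w : A => g u *: f v w).
Proof.
split=> u v b x y; rewrite ?gL ?(fB.1 _ b x y) ?(fB.2 _ b x y).
- by rewrite scalerDl scalerA.
- by rewrite scalerDr !scalerA mulrC.
- by rewrite scalerDr !scalerA mulrC.
Qed.

Let tri2 : trilinear_map (fun u v w : A => g v *: f u w).
Proof.
split=> u v b x y; rewrite ?gL ?(fB.1 _ b x y) ?(fB.2 _ b x y).
- by rewrite scalerDr !scalerA mulrC.
- by rewrite scalerDl scalerA.
- by rewrite scalerDr !scalerA mulrC.
Qed.

Let tri3 : trilinear_map (fun u v w : A => g w *: f u v).
Proof.
split=> u v b x y; rewrite ?gL ?(fB.1 _ b x y) ?(fB.2 _ b x y).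
- by rewrite scalerDr !scalerA mulrC.
- by rewrite scalerDr !scalerA mulrC.
- by rewrite scalerDl scalerA.
Qed.

(** This and the next two lemmas are coassociativity, read as the compatibility of the
coproduct with the actions of the dual. *)
Lemma copf_lact x : copf f (lact g x) = copf (fun u v => f (lact g u) v) x.
Proof.
rewrite [lact g x]/(copf _ _) (lin_sum (hopf_copfL hopfA fB)).
transitivity (\sum_(p <- cop x) \sum_(q <- cop p.2) g p.1 *: f q.1 q.2).
  by apply: eq_bigr => p _; rewrite (linZ (hopf_copfL hopfA fB)) scaler_sumr.
rewrite -(@hopf_coassoc _ _ hopfA _ _ _ tri1).
apply: eq_bigr => p _; rewrite (lin_sum (fB.1 _)).
by apply: eq_bigr => q _; rewrite (linZ (fB.1 _)).
Qed.

Lemma copf_ract x : copf f (ract g x) = copf (fun u v => f u (ract g v)) x.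
Proof.
rewrite [ract g x]/(copf _ _) (lin_sum (hopf_copfL hopfA fB)).
transitivity (\sum_(p <- cop x) \sum_(q <- cop p.1) g p.2 *: f q.1 q.2).
  by apply: eq_bigr => p _; rewrite (linZ (hopf_copfL hopfA fB)) scaler_sumr.
rewrite (@hopf_coassoc _ _ hopfA _ _ _ tri3).
apply: eq_bigr => p _; rewrite (lin_sum (fB.2 _)).
by apply: eq_bigr => q _; rewrite (linZ (fB.2 _)).
Qed.

Lemma copf_ract_lact x :
  copf (fun u v => f (ract g u) v) x = copf (fun u v => f u (lact g v)) x.
Proof.
transitivity (\sum_(p <- cop x) \sum_(q <- cop p.1) g q.2 *: f q.1 p.2).
  apply: eq_bigr => p _; rewrite (lin_sum (fB.1 _)).
  by apply: eq_bigr => q _; rewrite (linZ (fB.1 _)).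
rewrite (@hopf_coassoc _ _ hopfA _ _ _ tri2).
apply: eq_bigr => p _; rewrite (lin_sum (fB.2 _)).
by apply: eq_bigr => q _; rewrite (linZ (fB.2 _)).
Qed.

End CopActions.

Lemma lact_map (k : fieldType) (A B : hopf_data k) (phi : A -> B) (f : B -> k) x :
  coalg_map phi -> linear phi -> scalar f -> lact f (phi x) = phi (lact (f \o phi) x).
Proof.
move=> phiC L fL; rewrite /lact (copf_map _ phiC); last exact: bilinear_scalel.
by rewrite /copf (lin_sum L); apply: eq_bigr => p _; rewrite (linZ L).
Qed.

Lemma ract_map (k : fieldType) (A B : hopf_data k) (phi : A -> B) (f : B -> k) x :
  coalg_map phi -> linear phi -> scalar f -> ract f (phi x) = phi (ract (f \o phi) x).
Proof.
move=> phiC L fL; rewrite /ract (copf_map _ phiC); last exact: bilinear_scaler.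
by rewrite /copf (lin_sum L); apply: eq_bigr => p _; rewrite (linZ L).
Qed.

Section QuadDeformation.
Variables (n : nat) (X : {set 'S_n}) (k : fieldType).
Hypothesis X_odd : forall i : idx X, odd_perm (val i).
Variable Rel : seq (idx X * idx X) -> Prop.

Section OneWay.
Variables (c0 c : k) (A A' : hopf_data k).
Variables (a : idx X -> A) (h : 'S_n -> A) (a' : idx X -> A') (h' : 'S_n -> A').
Hypotheses (qA : quad_struct Rel c0 a h) (qA' : quad_struct Rel (c0 + c) a' h').
Hypothesis uA' : quad_universal Rel (c0 + c) a' h'.
Variables (s d : A -> k) (s' d' : A' -> k).
Hypotheses (sk : skew_pair s d) (sv : skew_values a h s d).
Hypotheses (sk' : skew_pair s' d') (sv' : skew_values a' h' s' d').
Let hopfA := qs_hopf qA.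
Let algA := hopf_algebra hopfA.
Let hopfA' := qs_hopf qA'.
Let algA' := hopf_algebra hopfA'.
Let dL := sk_dL sk.
Local Notation sigma := (skew_cocycle s d c).
Let H := deform sigma.
Let algH : is_algebra H := deform_is_algebra hopfA sk c.

Let mul_h g y : (h g : H) ** (y : H) = h g ** y.
Proof. exact: (deform_mul_grouplike hopfA sk y (qs_cop_h qA g) (sv_dh sv g)). Qed.

Let mul_a i y : (a i : H) ** (y : H) = a i ** y + c *: (lact d y - h (val i) ** ract d y).
Proof.
exact: (deform_mul_skew hopfA sk (qs_cop_h qA (val i)) (qs_cop_a qA i)
  (sv_sa sv i) (sv_da sv i) (sv_dh sv _)).
Qed.

Let lact_h g : lact d (h g) = 0.
Proof. by rewrite (lact_grouplike dL (qs_cop_h qA g)) (sv_dh sv) scale0r. Qed.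
Let ract_h g : ract d (h g) = 0.
Proof. by rewrite (ract_grouplike dL (qs_cop_h qA g)) (sv_dh sv) scale0r. Qed.
Let lact_a i : lact d (a i) = hone A.
Proof.
by rewrite (lact_skew (qs_cop_a qA i) dL) (sv_dh sv) (sv_da sv) scale0r scale1r addr0.
Qed.
Let ract_a i : ract d (a i) = h (val i).
Proof.
by rewrite (ract_skew (qs_cop_a qA i) dL) (sk_d1 sk) (sv_da sv) scale0r scale1r add0r.
Qed.

(** The relations with parameter c0 in A become, for the deformed product, those with
parameter c0 + c ([deform_quad]). *)
Lemma deform_common : common_ok (A := H) a h.
Proof.
have [h1 hM ha] := qs_common qA.
split=> [|g t|j i jt]; first exact: h1.
  by rewrite mul_h hM.
rewrite mul_h mul_a ha // lact_h ract_h hmul0r // subr0 scaler0 addr0 //.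
Qed.

Lemma deform_quad r : Rel r -> quad_ok (A := H) a h (c0 + c) r.
Proof.
move=> Rr; rewrite /quad_ok.
transitivity (\sum_(p <- r) a p.1 ** a p.2 +
  c *: \sum_(p <- r) (hone A - h (val p.1) ** h (val p.2))).
  rewrite scaler_sumr -big_split; apply: eq_bigr => p _ /=.
  by rewrite [LHS]mul_a lact_a ract_a.
rewrite (qs_quad qA Rr) -scalerDl; congr (_ *: _).
by apply: eq_bigr => p _; congr (_ - _); rewrite [RHS]mul_h.
Qed.

Lemma quad_deform_map : exists psi : A' -> A, [/\ linear psi, psi (hone A') = hone A,
  forall x y, psi (x ** y) = deform_mul sigma (psi x) (psi y),
  forall i, psi (a' i) = a i & forall g, psi (h' g) = h g].
Proof. exact: (uA' algH deform_common deform_quad). Qed.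

Variable psi : A' -> A.
Hypotheses (psiL : linear psi) (psi1 : psi (hone A') = hone A).
Hypothesis psiM : forall x y, psi (x ** y) = deform_mul sigma (psi x) (psi y).
Hypotheses (psia : forall i, psi (a' i) = a i) (psih : forall g, psi (h' g) = h g).

Lemma psi_a i y : psi (a' i ** y) =
  a i ** psi y + c *: (lact d (psi y) - h (val i) ** ract d (psi y)).
Proof. by rewrite psiM psia; exact: mul_a. Qed.

Lemma psi_h g y : psi (h' g ** y) = h g ** psi y.
Proof. by rewrite psiM psih; exact: mul_h. Qed.

Let epsL := hopf_eps_linear hopfA.
Let epsL' := hopf_eps_linear hopfA'.
Let epsM := hopf_epsM hopfA.
Let epsM' := hopf_epsM hopfA'.

Lemma eps_lact (f : A -> k) x : scalar f -> eps (lact f x) = f x :> k.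
Proof. by move=> fL; rewrite -(conv1_lact _ _ epsL) (conv1_epsr hopfA). Qed.

Lemma eps_ract (f : A -> k) x : scalar f -> eps (ract f x) = f x :> k.
Proof. by move=> fL; rewrite -(conv1_ract _ _ epsL) (conv1_epsl hopfA). Qed.

Lemma psi_eps x : eps (psi x) = eps x.
Proof.
move: x; apply: (qs_gen qA') => [|b x y Hx Hy|[i|g] x Hx].
- by rewrite psi1 (hopf_eps1 hopfA) (hopf_eps1 hopfA').
- by rewrite psiL epsL epsL' Hx Hy.
- rewrite psi_a epsM' (qs_eps_a qA') mul0r formD // formZ // formD // formN //.
  by rewrite !epsM eps_lact // eps_ract // (qs_eps_a qA) (qs_eps_h qA) mul1r subrr mul0r mulr0 addr0.
- by rewrite psi_h epsM epsM' (qs_eps_h qA) (qs_eps_h qA') Hx.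
Qed.

Lemma psi_d x : d (psi x) = d' x.
Proof.
have dL' := sk_dL sk'.
move: x; apply: (qs_gen qA') => [|b x y Hx Hy|[i|g] x Hx].
- by rewrite psi1 (sk_d1 sk) (sk_d1 sk').
- by rewrite psiL dL dL' Hx Hy.
- rewrite psi_a formD // formZ // formD // formN // !(sk_dM sk) (sk_dM sk').
  have -> : d (lact d (psi x)) = 0 by rewrite -(conv1_lact _ _ dL) (sk_dd sk).
  have -> : d (ract d (psi x)) = 0 by rewrite -(conv1_ract _ _ dL) (sk_dd sk).
  rewrite (sv_dh sv) (sv_sa sv) (sv_sa sv') (sv_da sv) (sv_da sv') psi_eps.
  by rewrite !mul0r mulr0 addr0 subr0 mulr0 addr0.
- rewrite psi_h (sk_dM sk) (sk_dM sk') (sv_sh sv) (sv_sh sv') Hx.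
  by rewrite (sv_dh sv) (sv_dh sv') !mul0r.
Qed.

(** The coproduct of the deformation is that of A, but psi is multiplicative for the deformed
product only; compatibility on a product with a_i on the left therefore involves the
correction terms, two of which cancel. *)
Lemma psi_coalg : coalg_map psi.
Proof.
apply: coalg_map_copf => W f x; move: x W f.
apply: (qs_gen qA') => [|b x y Hx Hy|[i|g] x Hx] W f fB;
  have fB' := bilinear_comp fB psiL psiL.
- by rewrite psi1 (copf1 (hopf_cop1 hopfA) fB) (copf1 (hopf_cop1 hopfA') fB') psi1.
- by rewrite psiL !hopf_copfL // Hx // Hy.
- rewrite psi_a (linD (hopf_copfL hopfA fB)) (linZ (hopf_copfL hopfA fB)).
  rewrite (linB (hopf_copfL hopfA fB)).
  have lL := lact_linear hopfA dL; have rL := ract_linear hopfA dL.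
  have hr i0 := hmul_linr algA (h i0); have ar := hmul_linr algA (a i).
  have B1 : bilinear_map (fun u v => f (a i ** u) v).
    exact: (bilinear_comp fB ar (@is_linear_id _ A)).
  have B2 : bilinear_map (fun u v => f (h (val i) ** u) (a i ** v)).
    exact: (bilinear_comp fB (hr _) ar).
  have B3 : bilinear_map (fun u v => f (h (val i) ** u) (h (val i) ** v)).
    exact: (bilinear_comp fB (hr _) (hr _)).
  have B4 : bilinear_map (fun u v => f (h (val i) ** u) v).
    exact: (bilinear_comp fB (hr _) (@is_linear_id _ A)).
  set y := psi x.
  have -> : copf f (a i ** y) = copf (fun u v => f (a i ** u) v) y +
      copf (fun u v => f (h (val i) ** u) (a i ** v)) y.
    exact: (copf_skewM hopfA (qs_cop_a qA i) fB).
  have -> : copf f (h (val i) ** ract d y) =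
      copf (fun u v => f (h (val i) ** u) (h (val i) ** ract d v)) y.
    rewrite (copf_grouplikeM hopfA (qs_cop_h qA _) fB).
    exact: (copf_ract hopfA B3 dL).
  rewrite (copf_lact hopfA fB dL).
  have mid := copf_ract_lact hopfA B4 dL y.
  have -> : copf (fun u v => f (psi u) (psi v)) (a' i ** x) =
      copf (fun u v => f (psi (a' i ** u)) (psi v)) x +
      copf (fun u v => f (psi (h' (val i) ** u)) (psi (a' i ** v))) x.
    exact: (copf_skewM hopfA' (qs_cop_a qA' i) fB').
  pose F1 u v := f (a i ** u + c *: (lact d u - h (val i) ** ract d u)) v.
  pose F2 u v := f (h (val i) ** u) (a i ** v + c *: (lact d v - h (val i) ** ract d v)).
  have lin_op : linear (fun u => a i ** u + c *: (lact d u - h (val i) ** ract d u)).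
    apply: is_linear_add => //; apply: is_linear_scale => b u v.
    by rewrite lL rL (hr _) scalerBr opprD addrACA.
  have BF1 : bilinear_map F1 by exact: (bilinear_comp fB lin_op (@is_linear_id _ A)).
  have BF2 : bilinear_map F2 by exact: (bilinear_comp fB (hr _) lin_op).
  transitivity (copf F1 y + copf F2 y); last first.
    rewrite /y Hx // Hx //; congr (_ + _); apply: eq_bigr => q _.
      by rewrite psi_a.
    by rewrite psi_h psi_a.
  (* The two middle terms, in R u (x) v and in u (x) L v, cancel by coassociativity. *)
  transitivity (copf (fun u v => f (a i ** u) v) y +
     c *: (copf (fun u v => f (lact d u) v) y -
           copf (fun u v => f (h (val i) ** ract d u) v) y) +
    (copf (fun u v => f (h (val i) ** u) (a i ** v)) y +
     c *: (copf (fun u v => f (h (val i) ** u) (lact d v)) y -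
           copf (fun u v => f (h (val i) ** u) (h (val i) ** ract d v)) y))).
    rewrite -mid addrACA; congr (_ + _); rewrite -scalerDr; congr (_ *: _).
    by rewrite addrA subrK.
  rewrite /copf -!sumrB !scaler_sumr -!big_split.
  apply: eq_bigr => q _ /=; rewrite /F1 /F2.
  rewrite (linD (fB.1 _)) (linZ (fB.1 _)) (linB (fB.1 _)).
  by rewrite (linD (fB.2 _)) (linZ (fB.2 _)) (linB (fB.2 _)).
- have hr := hmul_linr algA (h g).
  rewrite psi_h (copf_grouplikeM hopfA (qs_cop_h qA g) fB).
  rewrite (copf_grouplikeM hopfA' (qs_cop_h qA' g) fB') Hx; last first.
    exact: (bilinear_comp fB hr hr).
  by apply: eq_bigr => q _; rewrite !psi_h.
Qed.

Lemma psi_lact x : psi (lact d' x) = lact d (psi x).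
Proof. by rewrite (lact_map _ psi_coalg) //; congr psi; apply: eq_lact => u /=; rewrite psi_d. Qed.

Lemma psi_ract x : psi (ract d' x) = ract d (psi x).
Proof. by rewrite (ract_map _ psi_coalg) //; congr psi; apply: eq_ract => u /=; rewrite psi_d. Qed.

(** Deforming by c and then by - c gives back the original product: the two corrections cancel
since psi commutes with the actions of d. *)
Lemma psi_inverse (e : k) (psi' : A -> A') : c + e = 0 -> linear psi' ->
  psi' (hone A) = hone A' ->
  (forall i y, psi' (a i ** y) =
     a' i ** psi' y + e *: (lact d' (psi' y) - h' (val i) ** ract d' (psi' y))) ->
  (forall g y, psi' (h g ** y) = h' g ** psi' y) ->
  forall x, psi (psi' x) = x.
Proof.
move=> ce L' one' pa' ph'; apply: (qs_gen qA) => [|b x y Hx Hy|[i|g] x Hx].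
- by rewrite one' psi1.
- by rewrite L' psiL Hx Hy.
- rewrite pa' (linD psiL) (linZ psiL) (linB psiL) psi_a psi_h psi_lact psi_ract Hx.
  by rewrite -addrA -scalerDl ce scale0r addr0.
- by rewrite ph' psi_h Hx.
Qed.

End OneWay.

(** The map out of A' given by its universal property and the one out of A, obtained in the
same way from the deformation of A' by - c, are inverse to each other. *)
Theorem quad_deform_iso (c0 c : k) (A A' : hopf_data k)
    (a : idx X -> A) (h : 'S_n -> A) (a' : idx X -> A') (h' : 'S_n -> A')
    (s d : A -> k) :
  quad_struct Rel c0 a h -> quad_universal Rel c0 a h ->
  quad_struct Rel (c0 + c) a' h' -> quad_universal Rel (c0 + c) a' h' ->
  skew_pair s d -> skew_values a h s d ->
  exists psi : A' -> deform (skew_cocycle s d c), hopf_iso psi.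
Proof.
move=> qA uA qA' uA' sk sv.
have [s' [d' [sk' sv']]] := quad_skew_pair X_odd qA' uA'.
have [psi [L one M pa ph]] := quad_deform_map qA uA' sk sv.
have cc : c0 = c0 + c + (- c) by rewrite addrK.
move: (qA) (uA); rewrite {1 2}cc => qA2 uA2.
have [psi' [L' one' M' pa' ph']] := quad_deform_map qA' uA2 sk' sv'.
have E1 := psi_a qA sk sv M pa; have E2 := psi_h qA sk sv M ph.
have E1' := psi_a qA' sk' sv' M' pa'; have E2' := psi_h qA' sk' sv' M' ph'.
exists psi; split=> //.
- exists psi' => x.
    apply: (psi_inverse qA' qA2 sk' sv' sk sv L' one' M' pa' ph' (addNr c) L one E1 E2).
  exact: (psi_inverse qA qA' sk sv sk' sv' L one M pa ph (subrr c) L' one' E1' E2').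
- exact: (psi_coalg qA qA' sk sv L one M pa ph).
- exact: (psi_eps qA qA' sk sv L one M pa ph).
Qed.

End QuadDeformation.

(** * Changing presentations and rescaling generators *)

Section QuadUniversal.
Variables (n : nat) (X : {set 'S_n}) (k : fieldType).
Variable Rel : seq (idx X * idx X) -> Prop.

Lemma quad_hopf_universal c :
  quad_universal Rel c (@qa n X k (quad_rel Rel c)) (@qh n X k (quad_rel Rel c)).
Proof.
move=> B b l algB bl bq.
pose v (x : quad_gen X) : B := match x with inl i => b i | inr g => l g end.
have vR r : quad_rel Rel c r -> ev v r = 0 by exact: (ev_quad_rel algB bl bq).
exists (qev (R := quad_rel Rel c) v); split.
- exact: qev_linear.
- exact: qev1.
- exact: qevM.
- by move=> i; rewrite /qa qev_gen.
- by move=> g; rewrite /qh qev_gen.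
Qed.

End QuadUniversal.

Section SamePresentation.
Variables (k : fieldType) (I : choiceType) (R R' : free_alg k I -> Prop).
Variables (d : I -> seq (free_alg k I * free_alg k I)) (e : I -> k).
Local Notation A := (presented_hopf R d e).
Local Notation A' := (presented_hopf R' d e).
Hypothesis RR' : forall t, R t -> gen_ideal R' t.
Hypothesis R'R : forall t, R' t -> gen_ideal R t.
Hypothesis copR' : forall (W : lmodType k) (f : A' -> A' -> W), bilinear_map f ->
  forall r, R' r -> free_copf (d := d) (e := e) f r = 0.
Hypothesis epsR' : forall r, R' r -> ev (A := base_alg k) e r = 0.

Definition change_rel (x : A) : A' := proj R' (rep x).

Lemma change_rel_proj t : change_rel (proj R t) = proj R' t.
Proof.
apply: (lin_rep (R := R) (g := proj R')); first exact: proj_is_linear.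
move=> s Rs; rewrite -[0 in RHS](lin0 (@proj_is_linear _ _ R')); apply/projE.
by rewrite subr0; apply: (gen_ideal_mono RR').
Qed.

(** The coproduct of A' is independent of representatives because its relations are killed,
so it may be computed on the representatives used for A. *)
Lemma change_rel_iso : hopf_iso change_rel.
Proof.
have pL := @proj_is_linear k I R; have pL' := @proj_is_linear k I R'.
split.
- move=> c x y; rewrite -[x]repK -[y]repK -(pL c) !change_rel_proj; exact: pL'.
- have cL : forall t, gen_ideal R' t -> proj R t = 0.
    move=> s Rs; rewrite -[0 in RHS](lin0 pL); apply/projE.
    by rewrite subr0; apply: (gen_ideal_mono R'R).
  exists (fun x : A' => proj R (rep x) : A) => x.
    rewrite -[x]repK change_rel_proj; exact: (lin_rep pL cL).
  by rewrite change_rel_proj repK.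
- exact: (change_rel_proj 1).
- move=> x y; rewrite -[x]repK -[y]repK -(proj_hmul R d e).
  rewrite !change_rel_proj; exact: proj_hmul.
- apply: coalg_map_copf => W f x fB; rewrite (copf_proj copR') //.
  rewrite /copf /= big_map /=.
  rewrite (eq_bigr (fun p => f (proj R' p.1 : A') (proj R' p.2 : A'))); last first.
    by move=> p _; rewrite !change_rel_proj.
  rewrite (sum_lin_ext _ _ (f := fun u v => f (proj R' u) (proj R' v))) //.
  exact: bilinear_comp.
- by move=> x; rewrite (presented_eps_proj d epsR') eps_rep.
Qed.

End SamePresentation.

Section AlgebraMap.
Variables (k : fieldType) (A B : hopf_data k) (I : Type) (a : I -> A).
Hypotheses (hopfA : is_hopf A) (hopfB : is_hopf B) (genA : generated a).
Variable phi : A -> B.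
Hypotheses (L : linear phi) (one : phi (hone A) = hone B).
Hypothesis M : {morph phi : x y / x ** y >-> x ** y}.
Hypothesis copg : forall i, tensor_eq (cop (phi (a i))) [seq (phi p.1, phi p.2) | p <- cop (a i)].
Hypothesis epsg : forall i, eps (phi (a i)) = eps (a i).

(** Coproducts are multiplicative, so that compatibility propagates from the generators. *)
Lemma coalg_map_of_generators : coalg_map phi.
Proof.
have algA := hopf_algebra hopfA; have algB := hopf_algebra hopfB.
apply: coalg_map_copf => W f x; move: x W f.
apply: genA => [|b x y Hx Hy|i x Hx] W f fB; have fB' := bilinear_comp fB L L.
- by rewrite one (copf1 (hopf_cop1 hopfB) fB) (copf1 (hopf_cop1 hopfA) fB') one.
- by rewrite L !hopf_copfL // Hx // Hy.
- rewrite M (copfM (hopf_copM hopfB _ _) fB) (copfM (hopf_copM hopfA _ _) fB').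
  transitivity (\sum_(p <- cop (a i))
     copf (fun u v => f (phi p.1 ** u) (phi p.2 ** v)) (phi x)).
    rewrite -[LHS]/(copf (fun u v => \sum_(q <- cop (phi x)) f (u ** q.1) (v ** q.2)) _).
    rewrite /copf (tensor_eqE (f := fun u v => \sum_(q <- cop (phi x)) f (u ** q.1) (v ** q.2)) (copg i)).
      by rewrite big_map.
    by apply: bilinear_sum => q; apply: (bilinear_comp fB); exact: hmul_linl.
  apply: eq_bigr => p _; rewrite Hx.
    by apply: eq_bigr => q _; rewrite !M.
  by apply: (bilinear_comp fB); exact: hmul_linr.
Qed.

Lemma eps_map_of_generators x : eps (phi x) = eps x.
Proof.
move: x; apply: genA => [|b x y Hx Hy|i x Hx].
- by rewrite one (hopf_eps1 hopfA) (hopf_eps1 hopfB).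
- by rewrite L (hopf_eps_linear hopfB) (hopf_eps_linear hopfA) Hx Hy.
- by rewrite M (hopf_epsM hopfA) (hopf_epsM hopfB) epsg Hx.
Qed.

End AlgebraMap.

Section Rescaling.
Variables (n : nat) (X : {set 'S_n}) (k : fieldType).
Variable Rel : seq (idx X * idx X) -> Prop.
Variables (c z : k) (A A' : hopf_data k).
Variables (a : idx X -> A) (h : 'S_n -> A) (a' : idx X -> A') (h' : 'S_n -> A').
Hypotheses (qA : quad_struct Rel c a h) (uA : quad_universal Rel c a h).
Hypotheses (qA' : quad_struct Rel (z ^+ 2 * c) a' h').
Hypothesis uA' : quad_universal Rel (z ^+ 2 * c) a' h'.
Hypothesis z0 : z != 0.

Let scaled (B : hopf_data k) (b : idx X -> B) (l : 'S_n -> B) (t e : k) :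
  is_algebra B -> common_ok b l -> (forall r, Rel r -> quad_ok b l e r) ->
  common_ok (fun i => t *: b i) l /\
  (forall r, Rel r -> quad_ok (fun i => t *: b i) l (t ^+ 2 * e) r).
Proof.
move=> algB [l1 lM lb] q; split; first split=> // [j i jt].
  by rewrite hmulZr // lb // scalerN hmulZl.
move=> r Rr; rewrite /quad_ok -scalerA -(q r Rr) scaler_sumr; apply: eq_bigr => p _.
by rewrite hmulZl // hmulZr // scalerA.
Qed.

(** The elements z a_i satisfy the relations with the parameter multiplied by z^2; the
inverse map is constructed in the same way from z^-1. *)
Lemma quad_rescale : exists phi : A' -> A, hopf_iso phi.
Proof.
have algA := hopf_algebra (qs_hopf qA); have algA' := hopf_algebra (qs_hopf qA').
have [C Q] := scaled z algA (qs_common qA) (qs_quad qA).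
have [C' Q'] := scaled z^-1 algA' (qs_common qA') (qs_quad qA').
have zz : z^-1 ^+ 2 * (z ^+ 2 * c) = c.
  by rewrite mulrA -exprMn mulVf // expr1n mul1r.
rewrite zz in Q'.
have [phi [L one M pa ph]] := uA' algA C Q.
have [psi [L' one' M' pa' ph']] := uA algA' C' Q'.
have copL := hopf_cop_linear (qs_hopf qA).
exists phi; split=> //.
- exists psi => x.
    move: x; apply: (qs_gen qA') => [|b x y Hx Hy|[i|g] x Hx].
    + by rewrite one one'.
    + by rewrite L L' Hx Hy.
    + by rewrite M M' pa (linZ L') pa' scalerA mulfV // scale1r Hx.
    + by rewrite M M' ph ph' Hx.
  move: x; apply: (qs_gen qA) => [|b x y Hx Hy|[i|g] x Hx].
  + by rewrite one' one.
  + by rewrite L' L Hx Hy.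
  + by rewrite M' M pa' (linZ L) pa scalerA mulVf // scale1r Hx.
  + by rewrite M' M ph' ph Hx.
- apply: (coalg_map_of_generators (qs_hopf qA') (qs_hopf qA) (qs_gen qA') L one M).
  case=> [i|g] W f fB; have fB' := bilinear_comp fB L L; rewrite big_map /=.
    rewrite pa -[LHS]/(copf f _) (linZ (copf_linear copL fB)).
    rewrite (copf_skew (qs_cop_a qA i) fB).
    rewrite -[RHS]/(copf (fun u v => f (phi u) (phi v)) _).
    rewrite (copf_skew (qs_cop_a qA' i) fB') one pa ph.
    by rewrite (linZ (fB.1 _)) (linZ (fB.2 _)) scalerDr.
  rewrite ph -[LHS]/(copf f _) (copf_grouplike (qs_cop_h qA g) fB).
  rewrite -[RHS]/(copf (fun u v => f (phi u) (phi v)) _).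
  by rewrite (copf_grouplike (qs_cop_h qA' g) fB') ph.
- apply: (eps_map_of_generators (qs_hopf qA') (qs_hopf qA) (qs_gen qA') L one M).
  case=> [i|g]; last by rewrite ph (qs_eps_h qA) (qs_eps_h qA').
  by rewrite pa formZ ?(qs_eps_a qA) ?(qs_eps_a qA') ?mulr0 //; exact: hopf_eps_linear (qs_hopf qA).
Qed.

End Rescaling.

(** * Transport of skew pairs and deformations *)

Section DeformTransport.
Variables (k : fieldType) (A B : hopf_data k) (phi : A -> B) (s d : B -> k).
Hypotheses (hopfB : is_hopf B) (iso : hopf_iso phi) (sk : skew_pair s d).

Let hopfA : is_hopf A := hopf_iso_hopf iso hopfB.
Let phiL := hi_linear iso.
Let phiC := hi_cop iso.

Let form_map (f : B -> k) : scalar f -> scalar (f \o phi).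
Proof. by move=> fL c x y; rewrite /= phiL fL. Qed.

Lemma conv1_map (f g : B -> k) x : scalar f -> scalar g ->
  conv1 (f \o phi) (g \o phi) x = conv1 f g (phi x).
Proof.
move=> fL gL; rewrite [RHS]conv1_ract // ract_map // (conv1_ract _ _ (form_map fL)) //.
Qed.

Lemma skew_pair_map : skew_pair (s \o phi) (d \o phi).
Proof.
have [sL dL s1 d1 sM dM ss sd dd] := sk.
split=> /= [||||x y|x y|x|x|x].
- exact: form_map.
- exact: form_map.
- by rewrite (hi_one iso).
- by rewrite (hi_one iso).
- by rewrite (hi_mul iso).
- by rewrite (hi_mul iso) dM (hi_eps iso).
- by rewrite conv1_map // ss (hi_eps iso).
- by rewrite !conv1_map.
- by rewrite conv1_map.
Qed.

Lemma skew_left_map x : skew_left (s \o phi) (d \o phi) x = skew_left s d (phi x).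
Proof. by rewrite /skew_left conv1_map; [|exact: sk_dL sk|exact: sk_sL sk]. Qed.

Lemma deform_iso c :
  hopf_iso (phi : deform (skew_cocycle (s \o phi) (d \o phi) c) ->
                  deform (skew_cocycle s d c)).
Proof.
have [L bij one M C E] := iso; have dL := sk_dL sk.
have d'L := skew_left_linear hopfB sk.
have lm f x : scalar f -> phi (lact (f \o phi) x) = lact f (phi x).
  by move=> fL; rewrite lact_map.
have rm f x : scalar f -> phi (ract (f \o phi) x) = ract f (phi x).
  by move=> fL; rewrite ract_map.
have lm' x : phi (lact (skew_left (s \o phi) (d \o phi)) x) = lact (skew_left s d) (phi x).
  by rewrite -lm //; congr phi; apply: eq_lact => u; exact: skew_left_map.
have rm' x : phi (ract (skew_left (s \o phi) (d \o phi)) x) = ract (skew_left s d) (phi x).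
  by rewrite -rm //; congr phi; apply: eq_ract => u; exact: skew_left_map.
split=> // x y; rewrite /= (deform_mulE hopfA skew_pair_map) (deform_mulE hopfB sk).
rewrite /twist (linD L) (linZ L) !(linD L) !(linZ L) !M.
by rewrite !lm' !rm' !lm // !rm.
Qed.

End DeformTransport.

(** * Bosonization *)

Section SmashProduct.
Variables (k : fieldType) (n : nat) (B : hopf_data k) (act : 'S_n -> B -> B).
Hypothesis algB : is_algebra B.
Hypothesis actL : forall g, linear (act g).
Hypothesis act_one : forall g, act g (hone B) = hone B.
Hypothesis actM : forall g x y, act g (x ** y) = act g x ** act g y.
Hypothesis act_pmul : forall g t x, act (pmul g t) x = act g (act t x).
Hypothesis act1 : forall x, act 1%g x = x.
Local Notation H := {ffun 'S_n -> B}.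

Definition sm (b : B) (g : 'S_n) : H := [ffun g' => if g' == g then b else 0].

Definition sm_mul (x y : H) : H :=
  \sum_g \sum_t sm (x g ** act g (y t)) (pmul g t).

Definition sm_alg : hopf_data k :=
  @HopfData k H sm_mul (sm (hone B) 1%g) (fun _ => [::]) (fun _ => 0).

Lemma sm_linear g : linear (sm^~ g).
Proof.
by move=> c x y; apply/ffunP => t; rewrite !ffunE; case: eqP => _; rewrite ?scaler0 ?addr0.
Qed.

Lemma smE (x : H) : x = \sum_g sm (x g) g.
Proof.
apply/ffunP => t; rewrite sum_ffunE (bigD1 t) //= ffunE eqxx big1 ?addr0 // => g gt.
by rewrite ffunE eq_sym (negPf gt).
Qed.

Lemma eq_linear_sm (W : lmodType k) (f f' : H -> W) : linear f -> linear f' ->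
  (forall b g, f (sm b g) = f' (sm b g)) -> f =1 f'.
Proof.
move=> fL fL' ff x; rewrite [x]smE (lin_sum fL) (lin_sum fL').
by apply: eq_bigr => g _.
Qed.

Lemma sm_mul_bilinear : bilinear_map sm_mul.
Proof.
split=> [y|x] c u v; rewrite /sm_mul.
  rewrite scaler_sumr -big_split; apply: eq_bigr => g _ /=.
  rewrite scaler_sumr -big_split; apply: eq_bigr => t _ /=.
  by rewrite !ffunE hmulDl // hmulZl // sm_linear.
rewrite scaler_sumr -big_split; apply: eq_bigr => g _ /=.
rewrite scaler_sumr -big_split; apply: eq_bigr => t _ /=.
by rewrite !ffunE actL hmulDr // hmulZr // sm_linear.
Qed.

Lemma sm_mulE b g b' t : sm_mul (sm b g) (sm b' t) = sm (b ** act g b') (pmul g t).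
Proof.
have sm0 r : sm 0 r = 0 by exact: (lin0 (sm_linear r)).
rewrite /sm_mul (bigD1 g) //= [X in _ + X]big1 ?addr0 => [|r rg]; last first.
  by rewrite big1 // => u _; rewrite ffunE (negPf rg) hmul0l // sm0.
rewrite (bigD1 t) //= [X in _ + X]big1 ?addr0 => [|r rg]; last first.
  by rewrite [sm b' t r]ffunE (negPf rg) (lin0 (actL g)) hmul0r // sm0.
by rewrite !ffunE !eqxx.
Qed.

Lemma sm_is_algebra : is_algebra sm_alg.
Proof.
have [ml mr] := sm_mul_bilinear.
split; first exact: sm_mul_bilinear.
- move=> x y z /=.
  move: x; apply: eq_linear_sm; [exact: ml|exact: is_linear_comp (ml z) (ml y)|].
  move=> b g; move: y; apply: eq_linear_sm.
  + exact: is_linear_comp (mr _) (ml z).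
  + exact: is_linear_comp (ml z) (mr _).
  move=> b' g'; move: z; apply: eq_linear_sm.
  + exact: is_linear_comp (mr _) (mr _).
  + exact: mr.
  move=> b'' g''; rewrite !sm_mulE actM act_pmul hmulA //.
  by rewrite /pmul mulgA.
- move=> x /=; move: x; apply: eq_linear_sm; [exact: mr|exact: is_linear_id|].
  by move=> b g; rewrite sm_mulE hmul1l // act1 /pmul mulg1.
- move=> x /=; move: x; apply: eq_linear_sm; [exact: ml|exact: is_linear_id|].
  by move=> b g; rewrite sm_mulE act_one hmul1r // /pmul mul1g.
Qed.

Section QuadSmash.
Variables (X : {set 'S_n}) (Rel : seq (idx X * idx X) -> Prop).
Hypothesis X_conj : forall (g t : 'S_n), t \in X -> rack g t \in X.
Variables (x : idx X -> B).
Hypothesis genB : generated x.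
Hypothesis act_x : forall g i, act g (x i) = sgn k g *: x (rack_idx g i).
Hypothesis quadB : forall r, Rel r -> \sum_(p <- r) x p.1 ** x p.2 = 0.
Variables (A : hopf_data k) (a : idx X -> A) (h : 'S_n -> A).
Hypotheses (qA : quad_struct Rel 0 a h) (uA : quad_universal Rel 0 a h).
Variable iota : B -> A.
Hypotheses (iL : linear iota) (i1 : iota (hone B) = hone A).
Hypothesis iM : {morph iota : u v / u ** v >-> u ** v}.
Hypothesis ix : forall i, iota (x i) = a i.

Let algA := hopf_algebra (qs_hopf qA).

Let xH (i : idx X) : sm_alg := sm (x i) 1%g.
Let hH (g : 'S_n) : sm_alg := sm (hone B) g.

Let sm_common : common_ok xH hH.
Proof.
split=> [//|r t|j i jt] /=.
  by rewrite /hH sm_mulE act_one hmul1l.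
rewrite /xH /hH !sm_mulE act_x act1 hmul1l // hmul1r // /pmul mulg1 mul1g.
by rewrite sgn_transposition // scaleN1r (linN (sm_linear _)).
Qed.

Let sm_quad r : Rel r -> quad_ok xH hH 0 r.
Proof.
move=> Rr; rewrite /quad_ok scale0r.
transitivity (sm (\sum_(p <- r) x p.1 ** x p.2) 1%g); last first.
  by rewrite quadB // (lin0 (sm_linear _)).
rewrite (lin_sum (sm_linear _)); apply: eq_bigr => p _.
by rewrite /= /xH sm_mulE act1 /pmul mulg1.
Qed.

(** b # g corresponds to iota b times h_g. *)
Definition sm_theta (y : H) : A := \sum_g iota (y g) ** h g.

Lemma sm_theta_linear : linear sm_theta.
Proof.
move=> c u v; rewrite /sm_theta scaler_sumr -big_split; apply: eq_bigr => g _ /=.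
by rewrite !ffunE iL hmulDl // hmulZl.
Qed.

Lemma sm_thetaE b g : sm_theta (sm b g) = iota b ** h g.
Proof.
rewrite /sm_theta (bigD1 g) //= ffunE eqxx big1 ?addr0 // => t tg.
by rewrite ffunE (negPf tg) (lin0 iL) hmul0l.
Qed.

Lemma h_iota g b : h g ** iota b = iota (act g b) ** h g.
Proof.
move: b; apply: genB => [|c u v Hu Hv|i u Hu].
- by rewrite act_one i1 hmul1l // hmul1r.
- by rewrite iL actL iL hmulDr // hmulZr // Hu Hv hmulDl // hmulZl.
- rewrite iM ix hmulA // (crossing X_conj algA (qs_common qA)) hmulZl // -hmulA // Hu.
  by rewrite actM act_x iM (linZ iL) ix !hmulZl // hmulA.
Qed.

(** The universal property of A gives a map xi to the smash product, and the two composites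
with [sm_theta] are the identity because they are so on generators. *)
Lemma smash_iso : exists xi : A -> sm_alg, [/\ linear xi, cancel xi sm_theta,
  cancel sm_theta xi, xi (hone A) = hone sm_alg
  & {morph xi : u v / u ** v >-> u ** v}].
Proof.
have algH := sm_is_algebra.
have [xi [L one M pa ph]] := uA algH sm_common sm_quad.
have [ml mr] := sm_mul_bilinear.
have tL := sm_theta_linear.
exists xi; split=> //.
- apply: (qs_gen qA) => [|c u v Hu Hv|[i|g] u Hu].
  + by rewrite one sm_thetaE i1 (ok_one (qs_common qA)) hmul1l.
  + by rewrite L tL Hu Hv.
  + rewrite M pa /= -[in RHS]Hu; move: (xi u); apply: eq_linear_sm.
    * exact: is_linear_comp tL (mr _).
    * exact: is_linear_comp (hmul_linr algA _) tL.
    by move=> b g; rewrite /xH sm_mulE !sm_thetaE act1 iM ix /pmul mulg1 hmulA.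
  + rewrite M ph /= -[in RHS]Hu; move: (xi u); apply: eq_linear_sm.
    * exact: is_linear_comp tL (mr _).
    * exact: is_linear_comp (hmul_linr algA _) tL.
    move=> b t; rewrite /hH sm_mulE !sm_thetaE hmul1l // hmulA // h_iota.
    by rewrite -hmulA // (ok_mul (qs_common qA)).
- have xiota b : xi (iota b) = sm b 1%g.
    move: b; apply: genB => [|c u v Hu Hv|i u Hu].
    + by rewrite i1 one.
    + by rewrite iL L Hu Hv sm_linear.
    + by rewrite iM M ix pa Hu /= /xH sm_mulE act1 /pmul mulg1.
  apply: eq_linear_sm; [exact: is_linear_comp L tL|exact: is_linear_id|].
  move=> b g; rewrite sm_thetaE M xiota ph /= /hH sm_mulE act_one hmul1r //.
  by rewrite /pmul mulg1.
Qed.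

End QuadSmash.
End SmashProduct.

Lemma hmul_scale_sq (k : fieldType) (C : hopf_data k) (c : k) (u v : C) :
  is_algebra C -> c * c = 1 -> (c *: u) ** (c *: v) = u ** v.
Proof. by move=> algC cc; rewrite hmulZl // hmulZr // scalerA cc scale1r. Qed.

Section BosonizationIso.
Variables (k : fieldType) (n : nat) (X : {set 'S_n}).
Variable Rel : seq (idx X * idx X) -> Prop.
Hypothesis X_conj : forall (g t : 'S_n), t \in X -> rack g t \in X.
Hypothesis Rel_conj : forall g r, Rel r ->
  Rel [seq (rack_idx g p.1, rack_idx g p.2) | p <- r].
Local Notation T := (free_alg k (idx X)).

(** The quadratic relations of the pre-Nichols algebra. *)
Definition braid_elt (r : seq (idx X * idx X)) : T := \sum_(p <- r) xT k p.1 * xT k p.2.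

Variable R : T -> Prop.
Hypothesis R_sub : forall t, R t -> gen_ideal (fun u => exists2 r, Rel r & u = braid_elt r) t.
Hypothesis R_sup : forall r, Rel r -> gen_ideal R (braid_elt r).

Local Notation B := (presented_hopf R (fun _ => [::]) (fun _ => 0)).
Let algB : is_algebra B := presented_is_algebra R _ _.
Let x (i : idx X) : B := qgen R i.

Lemma ev_braid (C : hopf_data k) (v : idx X -> C) r : is_algebra C ->
  ev v (braid_elt r) = \sum_(p <- r) v p.1 ** v p.2.
Proof.
move=> algC; rewrite /braid_elt (lin_sum (ev_linear v)); apply: eq_bigr => p _.
by rewrite (evM v algC) (ev_gen v algC) (ev_gen v algC).
Qed.

Lemma ev_relations (C : hopf_data k) (v : idx X -> C) : is_algebra C ->
  (forall r, Rel r -> \sum_(p <- r) v p.1 ** v p.2 = 0) ->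
  forall t, R t -> ev v t = 0.
Proof.
move=> algC vr t /R_sub; apply: (ev_ideal algC) => _ [r Rr ->].
by rewrite ev_braid // vr.
Qed.

Lemma ev_x t : ev (A := B) x t = proj R t.
Proof. exact: ev_proj. Qed.

Lemma quadB r : Rel r -> \sum_(p <- r) x p.1 ** x p.2 = 0.
Proof.
move=> Rr; rewrite -(ev_braid x r algB) ev_x -[RHS](lin0 (@proj_is_linear _ _ R)).
by apply/projE; rewrite subr0; exact: R_sup.
Qed.

Let gx g (i : idx X) : B := sgn k g *: x (rack_idx g i).

Let gx_quad g r : Rel r -> \sum_(p <- r) gx g p.1 ** gx g p.2 = 0.
Proof.
move=> Rr; rewrite -[RHS](quadB (Rel_conj g Rr)) big_map; apply: eq_bigr => p _.
exact: (hmul_scale_sq _ _ algB (sgn_sq k g)).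
Qed.

Let gxR g := ev_relations algB (@gx_quad g).

Lemma proj_actT g t : proj R (actT g t) = ev (A := B) (gx g) t.
Proof.
have pL := @proj_is_linear _ _ R.
rewrite /actT (lin_sum pL) /ev /wext; apply: eq_bigr => w _; rewrite (linZ pL).
congr (_ *: _); elim: (w : seq _) => [|i v IH]; first by rewrite big_nil.
by rewrite big_cons projMr IH (linZ pL).
Qed.

Lemma actBE g (b : B) : actB g b = qev (gx g) b.
Proof. exact: proj_actT. Qed.

Lemma actB_linear g : linear (actB g : B -> B).
Proof. by move=> c u v; rewrite !actBE (qev_linear algB (gxR g)). Qed.

Lemma actB_one g : actB g (hone B) = hone B.
Proof. by rewrite actBE (qev1 algB (gxR g)). Qed.

Lemma actBM g (u v : B) : actB g (u ** v) = (actB g u : B) ** (actB g v : B).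
Proof. by rewrite !actBE (qevM algB (gxR g)). Qed.

Lemma actB_x g i : actB g (x i) = sgn k g *: x (rack_idx g i).
Proof. by rewrite actBE (qev_gen algB (gxR g)). Qed.

Lemma genB : generated x. Proof. exact: (@pres_ind _ _ R). Qed.

Lemma actB_pmul g t (b : B) : actB (pmul g t) b = actB g (actB t b).
Proof.
move: b; apply: genB => [|c u v Hu Hv|i u Hu].
- by rewrite !actB_one.
- by rewrite !actB_linear Hu Hv.
- rewrite !actBM Hu !actB_x (linZ (actB_linear g)) actB_x scalerA.
  by rewrite (rack_idx_pmul X_conj) sgn_pmul (mulrC (sgn k t) (sgn k g)).
Qed.

Lemma actB1 (b : B) : actB 1%g b = b.
Proof.
move: b; apply: genB => [|c u v Hu Hv|i u Hu]; first exact: actB_one.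
  by rewrite actB_linear Hu Hv.
by rewrite actBM Hu actB_x (rack_idx1 X_conj) /sgn odd_perm1 scale1r.
Qed.

Variables (A : hopf_data k) (a : idx X -> A) (h : 'S_n -> A).
Hypotheses (qA : quad_struct Rel 0 a h) (uA : quad_universal Rel 0 a h).
Let hopfA := qs_hopf qA.
Let algA := hopf_algebra hopfA.

Let aR : forall t, R t -> ev a t = 0.
Proof.
apply: (ev_relations algA) => r Rr.
by rewrite (qs_quad qA Rr) scale0r.
Qed.

Definition iota (b : B) : A := qev (R := R) a b.

Lemma iota_linear : linear iota. Proof. exact: (qev_linear algA aR). Qed.
Lemma iota1 : iota (hone B) = hone A. Proof. exact: (qev1 algA aR). Qed.
Lemma iotaM (u v : B) : iota (u ** v) = iota u ** iota v.
Proof. exact: (qevM algA aR). Qed.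
Lemma iota_x i : iota (x i) = a i. Proof. exact: (qev_gen algA aR). Qed.
Lemma iota_proj t : iota (proj R t) = ev a t. Proof. exact: (qev_proj algA aR). Qed.

Local Notation H := (bosonization R).

Definition theta (y : H) : A := \sum_g iota ((y : {ffun 'S_n -> presented R}) g) ** h g.

Lemma bosonization_iso : exists xi : A -> H, [/\ linear xi, cancel xi theta,
  cancel theta xi, xi (hone A) = hone H
  & {morph xi : u v / u ** v >-> u ** v}].
Proof.
exact: (smash_iso algB actB_linear actB_one actBM actB_pmul actB1 X_conj genB
  actB_x quadB qA uA iota_linear iota1 iotaM iota_x).
Qed.

Lemma theta_smash (b : B) g : theta (smash b g) = iota b ** h g.
Proof. exact: (sm_thetaE qA iota_linear b g). Qed.

Lemma h_ev g t : h g ** ev a t = ev a (actT g t) ** h g.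
Proof.
have E : actB g (proj R t) = proj R (actT g t) :> B.
  by rewrite proj_actT actBE (qev_proj algB (gxR g)).
rewrite -(iota_proj (actT g t)) -E -(iota_proj t).
exact: (h_iota actB_linear actB_one actBM X_conj genB actB_x qA
  iota_linear iota1 iotaM iota_x g (proj R t)).
Qed.

Lemma ev_wordT w : ev a (wordT k w) = ev a (word k w).
Proof. by rewrite word_prod. Qed.

(** The braided coproduct followed by the coaction agrees with the coproduct of
the presented algebra, because both are computed by the same recursion on words. *)
Lemma copf_word (W : lmodType k) (F : A -> A -> W) w g : bilinear_map F ->
  \sum_(p <- bcop_word k w)
    F (ev a p.1 ** h (pmul (degT p.2) g)) (ev a (wordT k p.2) ** h g) =
  copf F (ev a (word k w) ** h g).
Proof.
have hM := ok_mul (qs_common qA).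
elim: w W F => [|i w IH] W F FB /=.
  rewrite big_seq1 /= /wordT big_nil word_nil ev1 !(hmul1l algA) /pmul mulg1.
  by rewrite (copf_grouplike (qs_cop_h qA g)).
have ar := hmul_linr algA (a i); have hr := hmul_linr algA (h (val i)).
have B1 : bilinear_map (fun u v => F (a i ** u) v).
  exact: (bilinear_comp FB ar (@is_linear_id _ A)).
have B2 : bilinear_map (fun u v => F (h (val i) ** u) (a i ** v)).
  exact: (bilinear_comp FB hr ar).
rewrite big_cat !big_map /= word_cons (ev_genM a algA) -hmulA //.
rewrite (copf_skewM hopfA (qs_cop_a qA i) FB); congr (_ + _).
  rewrite -(IH _ _ B1); apply: eq_bigr => p _.
  by rewrite (ev_genM a algA) hmulA.
rewrite -(IH _ _ B2); apply: eq_bigr => p _; congr (F _ _).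
  rewrite hmulA // h_ev -hmulA // hM; congr (_ ** h _).
  by rewrite /pmul mulgA.
by rewrite !ev_wordT word_cons (ev_genM a algA) hmulA.
Qed.

Lemma bos_copfE (W : lmodType k) (f : H -> H -> W) (y : H) : bilinear_map f ->
  copf f y = \sum_g wext (fun w => \sum_(p <- bcop_word k w)
    f (smash (proj R p.1) (pmul (degT p.2) g)) (smash (proj R (wordT k p.2)) g))
    (rep ((y : {ffun 'S_n -> presented R}) g)).
Proof.
move=> fB; rewrite /copf /= /bos_cop big_flatten big_map big_enum.
apply: eq_bigr => g _; rewrite (sum_lin_ext _ _ (f := f)) //.
by apply: eq_wext => w; rewrite big_map.
Qed.

Lemma wext_lin (W : lmodType k) (L : T -> W) t : linear L ->
  wext (fun w => L (word k w)) t = L t.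
Proof.
move=> LL; move: t; apply: eq_linear_words => // [|w]; first exact: wext_linear.
by rewrite wext_word.
Qed.

Let evh_linear g : linear (fun t => ev a t ** h g).
Proof. exact: (is_linear_comp (hmul_linl algA (h g)) (ev_linear a)). Qed.

Lemma eps_ev t : eps (ev a t) = t@_(fmone _) :> k.
Proof.
have eL := hopf_eps_linear hopfA.
suff E : (fun t => eps (ev a t) : k^o) =1 (fun t => t@_(fmone _) : k^o) by exact: E.
apply: eq_linear_words => [c u v|c u v|[|i w]].
- by rewrite ev_linear eL.
- by rewrite mcoeffD mcoeffZ.
- by rewrite /ev wext_word /= (hopf_eps1 hopfA) /word mcoeffU1 fmoneE eqxx.
- rewrite word_cons (ev_genM a algA) (hopf_epsM hopfA) (qs_eps_a qA) mul0r.
  by rewrite -word_cons /word mcoeffU1 fmoneE.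
Qed.

Theorem bosonization_hopf_iso : hopf_iso theta.
Proof.
have [xi [L thetaK xiK one M]] := bosonization_iso.
have xi_smash (b : B) g : xi (iota b ** h g) = smash b g by rewrite -theta_smash xiK.
have xi_iso : hopf_iso xi.
  split=> //.
  - by exists theta.
  - apply: coalg_map_copf => W f y fB; rewrite bos_copfE //.
    rewrite -[in RHS](thetaK y); set z := xi y.
    pose F u v := f (xi u) (xi v).
    have FB : bilinear_map F by exact: bilinear_comp.
    have copL := hopf_copfL hopfA FB.
    rewrite -[RHS]/(copf F (theta z)) /theta (lin_sum copL).
    apply: eq_bigr => g _.
    rewrite -[X in _ = copf F (iota X ** _)]repK iota_proj.
    rewrite -(wext_lin _ (is_linear_comp copL (evh_linear g))).
    apply: eq_wext => w; rewrite -copf_word //; apply: eq_bigr => p _.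
    by rewrite /F -!iota_proj !xi_smash.
  - move=> y; rewrite -[in RHS](thetaK y); set z := xi y.
    rewrite /theta (form_sum _ _ (hopf_eps_linear hopfA)).
    rewrite /= /bos_eps; apply: eq_bigr => g _.
    rewrite (hopf_epsM hopfA) (qs_eps_h qA) mulr1.
    by rewrite -[X in _ = eps (iota X)]repK iota_proj eps_ev.
exact: (hopf_iso_inverse xi_iso thetaK xiK).
Qed.

Variables (s d : A -> k).
Hypotheses (sk : skew_pair s d) (sv : skew_values a h s d).
Let sL := sk_sL sk.
Let dL := sk_dL sk.
Let d'L := skew_left_linear hopfA sk.
Local Notation d' := (skew_left s d).

Let d'_a i : d' (a i) = 1.
Proof.
exact: (skew_left_skew sk (qs_cop_a qA i) (sv_sa sv i) (sv_da sv i)).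
Qed.

Let d'_h g : d' (h g) = 0.
Proof. by rewrite (skew_left_grouplike sk (qs_cop_h qA g)) (sv_dh sv) mul0r. Qed.

(** On the subalgebra generated by the a_i, the characters s and eps both pick the constant
term, hence d and d' both pick the sum of the linear coefficients. *)
Lemma s_ev t : s (ev a t) = t@_(fmone _) :> k.
Proof.
suff E : (fun t => s (ev a t) : k^o) =1 (fun t => t@_(fmone _) : k^o) by exact: E.
apply: eq_linear_words => [c u v|c u v|[|i w]].
- by rewrite ev_linear sL.
- by rewrite mcoeffD mcoeffZ.
- by rewrite /ev wext_word /= (sk_s1 sk) /word mcoeffU1 fmoneE eqxx.
- rewrite word_cons (ev_genM a algA) (sk_sM sk) (sv_sa sv) mul0r.
  by rewrite -word_cons /word mcoeffU1 fmoneE.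
Qed.

Let coeff_fmu i w : \sum_(j : idx X) (word k (i :: w))@_(fmu j) = (word k w)@_(fmone _) :> k.
Proof.
rewrite (bigD1 i) //= /word !mcoeffU1 fmoneE fmuE !fmP /= eqseq_cons eqxx /=.
rewrite big1 ?addr0 // => j ji; rewrite mcoeffU1 fmuE fmP /= eqseq_cons.
by rewrite eq_sym (negPf ji).
Qed.

Lemma d_ev t : d (ev a t) = \sum_(i : idx X) t@_(fmu i) :> k.
Proof.
suff E : (fun t => d (ev a t) : k^o) =1 (fun t => \sum_(i : idx X) t@_(fmu i) : k^o).
  exact: E.
apply: eq_linear_words => [c u v|c u v|[|i w]].
- by rewrite ev_linear dL.
- rewrite /GRing.scale /= mulr_sumr -big_split; apply: eq_bigr => i _ /=.
  by rewrite mcoeffD mcoeffZ.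
- rewrite /ev wext_word /= (sk_d1 sk) big1 // => i _.
  by rewrite /word mcoeffU1 fmuE.
- rewrite word_cons (ev_genM a algA) (sk_dM sk) (sv_sa sv) (sv_da sv) eps_ev.
  by rewrite mul0r add0r mul1r -word_cons coeff_fmu.
Qed.

Lemma skew_left_ev t : d' (ev a t) = d (ev a t).
Proof.
suff E : (fun t => d' (ev a t) : k^o) =1 (fun t => d (ev a t) : k^o) by exact: E.
apply: eq_linear_words => [c u v|c u v|[|i w]].
- by rewrite ev_linear d'L.
- by rewrite ev_linear dL.
- by rewrite word_nil ev1 (skew_left1 hopfA sk) (sk_d1 sk).
- rewrite word_cons (ev_genM a algA) (skew_leftM hopfA sk) (sk_dM sk) d'_a s_ev.
  by rewrite (qs_eps_a qA) (sv_sa sv) (sv_da sv) eps_ev !mul0r addr0 add0r.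
Qed.

Let total (v : {ffun idx X -> k^o}) : k := \sum_i v i.

Let total_xV i : total (xV k i) = 1.
Proof.
rewrite /total (bigD1 i) //= ffunE eqxx big1 ?addr0 // => j ji.
by rewrite ffunE eq_sym (negPf ji).
Qed.

Let total_linear : scalar total.
Proof.
move=> c u v; rewrite /total mulr_sumr -big_split; apply: eq_bigr => i _ /=.
by rewrite !ffunE.
Qed.

Let total_actV g v : total (actV g v) = sgn k g * total v.
Proof.
rewrite /actV (@lin_sum k _ k^o total total_linear) [in RHS]/total mulr_sumr.
apply: eq_bigr => i _; rewrite !(@linZ k _ k^o total total_linear) total_xV.
by rewrite /GRing.scale /= mulr1 mulrC.
Qed.

Let eta_total lam v w : eta lam v w = lam / 3%:R * (total v * total w).
Proof.
rewrite /eta /dual; congr (_ * _); rewrite /total mulrC mulr_suml.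
by apply: eq_bigr => i _; rewrite mulr_sumr; apply: eq_bigr => j _; rewrite mulrC.
Qed.

Let total_degree1 (b : presented R) : total (degree1 b) = d (iota b).
Proof.
rewrite -[X in _ = d (iota X)]repK iota_proj d_ev /total.
by apply: eq_bigr => i _; rewrite ffunE.
Qed.

(** Both sides only see the components of degree one, on which d is the sum of the
coordinates; the sign by which d' differs from d on b # g is the one by which h_g acts on
the second argument in the definition of eta~. *)
Lemma eta_tilde_theta lam (y z : H) :
  eta_tilde lam y z = lam / 3%:R * (d' (theta y) * d (theta z)).
Proof.
rewrite /theta (form_sum _ _ d'L) (form_sum _ _ dL) mulr_suml mulr_sumr.
apply: eq_bigr => g _; rewrite mulr_sumr mulr_sumr; apply: eq_bigr => t _.
rewrite eta_total total_actV !total_degree1 (sk_dM sk) (sv_dh sv) mulr0 add0r.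
rewrite (qs_eps_h qA) mulr1 (skew_leftM hopfA sk) d'_h mulr0 addr0 (sv_sh sv).
set b := (y : {ffun 'S_n -> presented R}) g.
have -> : d' (iota b) = d (iota b) by rewrite -(repK b) iota_proj skew_left_ev.
by rewrite -!mulrA.
Qed.

End BosonizationIso.

Lemma hopf_iso_sym (k : fieldType) (A B : hopf_data k) (phi : A -> B) :
  hopf_iso phi -> exists psi : B -> A, hopf_iso psi.
Proof.
move=> iso; have [psi phiK psiK] := hi_bij iso.
by exists psi; exact: hopf_iso_inverse iso phiK psiK.
Qed.

(** * The deformed bosonization *)

Section DeformationOfBosonization.
Variables (k : fieldType) (n : nat) (X : {set 'S_n}).
Variable Rel : seq (idx X * idx X) -> Prop.
Hypothesis X_conj : forall (g t : 'S_n), t \in X -> rack g t \in X.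
Hypothesis X_odd : forall i : idx X, odd_perm (val i).
Hypothesis Rel_prod : forall r, Rel r -> same_product r.
Hypothesis Rel_braid : forall r, Rel r -> braid_closed r.
Hypothesis Rel_conj : forall g r, Rel r ->
  Rel [seq (rack_idx g p.1, rack_idx g p.2) | p <- r].
Variable R : free_alg k (idx X) -> Prop.
Hypothesis R_sub : forall t, R t ->
  gen_ideal (fun u => exists2 r, Rel r & u = braid_elt k r) t.
Hypothesis R_sup : forall r, Rel r -> gen_ideal R (braid_elt k r).
Variables (lam z : k) (R' : free_alg k (quad_gen X) -> Prop).
Hypothesis z0 : z != 0.
Local Notation rel' := (quad_rel Rel (z ^+ 2 * (lam / 3%:R))).
Hypothesis R'_sub : forall t, R' t -> gen_ideal rel' t.
Hypothesis R'_sup : forall t, rel' t -> gen_ideal R' t.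
Local Notation H := (bosonization R).
Local Notation sigma := (conv_exp (@eta_tilde k n X R lam)).

(** The bosonization is P_0, its deformation is P_(lam / 3), and rescaling turns the latter
into the algebra with parameter z^2 (lam / 3), which is the one presented by R'. *)
Theorem deform_bosonization :
  [/\ is_hopf H, mult_cocycle sigma & hopf_isomorphic (deform sigma) (quad_hopf R')].
Proof.
pose c := lam / 3%:R.
have qs e := quad_hopf_struct X_conj X_odd Rel_prod Rel_braid (k := k) e.
have un e := @quad_hopf_universal n X k Rel e.
have [s [d [sk sv]]] := quad_skew_pair X_odd (qs 0) (un 0).
have iso := bosonization_hopf_iso X_conj Rel_conj R_sub R_sup (qs 0) (un 0).
have hopfP e := qs_hopf (qs e).
have hopfH := hopf_iso_hopf iso (hopfP 0).
set th := theta _ _ in iso.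
have skH := skew_pair_map iso sk.
have sigmaE : sigma = skew_cocycle (s \o th) (d \o th) c.
  apply/funext => x; apply/funext => y; apply: (conv_exp_skew hopfH skH).
  move=> u v; rewrite (skew_left_map iso sk).
  exact: (eta_tilde_theta R_sub (qs 0) sk sv).
have isoD := deform_iso (hopfP 0) iso sk c.
have qsc : quad_struct Rel (0 + c) (qa (quad_rel Rel c)) (@qh n X k (quad_rel Rel c)).
  by rewrite add0r; exact: qs.
have unc : quad_universal Rel (0 + c) (qa (quad_rel Rel c)) (@qh n X k (quad_rel Rel c)).
  by rewrite add0r; exact: un.
have [psi ipsi] := quad_deform_iso X_odd (qs 0) (un 0) qsc unc sk sv.
have [psi' ipsi'] := hopf_iso_sym ipsi.
have [phi iphi] := quad_rescale (qs c) (un c) (qs (z ^+ 2 * c)) (un (z ^+ 2 * c)) z0.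
have [phi' iphi'] := hopf_iso_sym iphi.
have ichange := change_rel_iso R'_sub R'_sup
  (fun W f => @quad_value_rel n X k X_conj X_odd Rel Rel_prod Rel_braid _ W f) (@quad_eps_rel n X k Rel _).
have [chi ichi] := hopf_iso_sym ichange.
have hopfR' := hopf_iso_hopf ichange (hopfP _).
split; [exact: hopfH|by rewrite sigmaE; exact: skew_cocycle_is_cocycle|].
rewrite sigmaE.
exact: (hopf_iso_isomorphic (hopf_iso_comp (hopf_iso_comp (hopf_iso_comp isoD ipsi') iphi') ichi)).
Qed.

End DeformationOfBosonization.

(** * Relations made of one, two or three monomials *)

Section ThreeTerm.
Variables (n : nat) (X : {set 'S_n}).
Hypothesis X_conj : forall (g t : 'S_n), t \in X -> rack g t \in X.
Variables (P2 : idx X -> idx X -> Prop) (P3 : idx X -> idx X -> idx X -> Prop).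
Hypothesis P2_conj : forall g i j, P2 i j -> P2 (rack_idx g i) (rack_idx g j).
Hypothesis P3_conj : forall g i j l, P3 i j l ->
  P3 (rack_idx g i) (rack_idx g j) (rack_idx g l).
Hypothesis P2_rack : forall i j, P2 i j ->
  rack_idx (val i) j = j /\ rack_idx (val j) i = i.
Hypothesis P3_rack : forall i j l, P3 i j l ->
  [/\ rack_idx (val i) j = l, rack_idx (val j) l = i & rack_idx (val l) i = j].

(** In the relations with two or three terms the elements i, j (and l) act on each other
cyclically, by [P2_rack] and [P3_rack]; this makes the products agree and the lists
stable under the braiding. *)
Inductive three_rel : seq (idx X * idx X) -> Prop :=
| three_one i : three_rel [:: (i, i)]
| three_two i j : P2 i j -> three_rel [:: (i, j); (j, i)]
| three_three i j l : P3 i j l -> three_rel [:: (i, j); (j, l); (l, i)].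

Lemma rack_self (i : idx X) : rack_idx (val i) i = i.
Proof. by apply: val_inj; rewrite val_rack_idx // /rack conjgE mulgA mulVg mul1g. Qed.

Lemma three_conj g r : three_rel r ->
  three_rel [seq (rack_idx g p.1, rack_idx g p.2) | p <- r].
Proof.
by case=> [i|i j /P2_conj ij|i j l /P3_conj ijl] /=; constructor.
Qed.

Lemma three_prod r : three_rel r -> same_product r.
Proof.
case=> [i|i j /P2_rack[ij ji]|i j l /P3_rack[ij jl li]].
- by exists (pmul (val i) (val i)) => p; rewrite inE => /eqP ->.
- exists (pmul (val i) (val j)) => p; rewrite !inE => /orP[] /eqP -> //=.
  by rewrite (pmul_rack X_conj) ji.
- exists (pmul (val i) (val j)) => p; rewrite !inE => /or3P[] /eqP -> //=.
    by rewrite (pmul_rack X_conj) jl.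
  by rewrite (pmul_rack X_conj (val i)) ij.
Qed.

Lemma three_braid r : three_rel r -> braid_closed r.
Proof.
case=> [i|i j /P2_rack[ij ji]|i j l /P3_rack[ij jl li]]; rewrite /braid_closed /=.
- by rewrite rack_self.
- by rewrite ij ji; exact: (permEl (perm_catC [:: (j, i)] [:: (i, j)])).
- by rewrite ij jl li; exact: (permEl (perm_catC [:: (l, i)] [:: (i, j); (j, l)])).
Qed.

Section QuadOk.
Variables (k : fieldType) (A : hopf_data k) (a : idx X -> A) (h : 'S_n -> A) (c : k).
Hypotheses (algA : is_algebra A) (comm : common_ok a h).

(** Conjugating by h_g multiplies a_i a_j by the square of a sign: a single relation implies
all those in its orbit. *)
Lemma quad_ok_conj g r : quad_ok a h c r ->
  quad_ok a h c [seq (rack_idx g p.1, rack_idx g p.2) | p <- r].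
Proof.
move=> ok; rewrite /quad_ok !big_map /=.
have cancel (x y : A) : x ** h g = y ** h g -> x = y.
  move=> E; rewrite -(hmul1r algA x) -(h_mulV comm g) hmulA // E -hmulA //.
  by rewrite (h_mulV comm) hmul1r.
apply: cancel; transitivity (h g ** \sum_(p <- r) a p.1 ** a p.2).
  rewrite hmul_sumr // hmul_suml //; apply: eq_bigr => p _.
  rewrite hmulA // (crossing X_conj algA comm) hmulZl // -[in RHS]hmulA //.
  by rewrite (crossing X_conj algA comm) hmulZr // scalerA sgn_sq scale1r hmulA.
rewrite ok hmulZr // hmulZl //; congr (_ *: _).
rewrite hmul_sumr // hmul_suml //; apply: eq_bigr => p _.
rewrite hmulBr // hmulBl // hmul1r // hmul1l //; congr (_ - _).
rewrite !(ok_mul comm); congr h.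
rewrite /pmul !val_rack_idx // /rack -conjMg conjgE.
by rewrite !mulgA mulgV mul1g.
Qed.

Lemma quad_ok_conjV g r :
  quad_ok a h c [seq (rack_idx g p.1, rack_idx g p.2) | p <- r] -> quad_ok a h c r.
Proof.
move=> /(quad_ok_conj g^-1%g); rewrite -map_comp.
have -> // : [seq ((fun p => (rack_idx g^-1%g p.1, rack_idx g^-1%g p.2)) \o
  (fun p => (rack_idx g p.1, rack_idx g p.2))) p | p <- r] = r.
by rewrite -[RHS]map_id; apply: eq_map => -[i j]; rewrite /= !rack_idxK.
Qed.

Lemma quad_ok_one i : pmul (val i) (val i) = 1%g ->
  quad_ok a h c [:: (i, i)] <-> a i ** a i = 0.
Proof.
by move=> ii; rewrite /quad_ok !big_seq1 /= (ok_mul comm) ii (ok_one comm) subrr scaler0.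
Qed.

Lemma quad_ok_two i j : P2 i j -> quad_ok a h c [:: (i, j); (j, i)] <->
  a i ** a j + a j ** a i = (2%:R * c) *: (hone A - h (val i) ** h (val j)).
Proof.
move=> /three_two/three_prod[g rg].
have gij : pmul (val i) (val j) = g by apply: (rg (i, j) (mem_head _ _)).
have gji : pmul (val j) (val i) = g by apply: (rg (j, i) (mem_last (i, j) [:: (j, i)])).
rewrite /quad_ok !big_cons !big_nil !addr0 /= !(ok_mul comm) gij gji.
by rewrite -mulr2n -scaler_nat scalerA (mulrC c).
Qed.

Lemma quad_ok_three i j l : P3 i j l ->
  quad_ok a h c [:: (i, j); (j, l); (l, i)] <->
  a i ** a j + a j ** a l + a l ** a i =
    (3%:R * c) *: (hone A - h (val i) ** h (val j)).
Proof.
move=> /three_three/three_prod[g rg].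
have gij : pmul (val i) (val j) = g by apply: (rg (i, j) (mem_head _ _)).
have gjl : pmul (val j) (val l) = g by apply: (rg (j, l) (mem_behead (s := [:: (i, j); (j, l); (l, i)]) (mem_head _ _))).
have gli : pmul (val l) (val i) = g by apply: (rg (l, i) (mem_last (i, j) [:: (j, l); (l, i)])).
rewrite /quad_ok !big_cons !big_nil !addr0 /= !(ok_mul comm) gij gjl gli.
set u := (X in X + (X + X)).
have -> : u + (u + u) = 3%:R *: u by rewrite scaler_nat mulrSr mulr2n addrC.
by rewrite scalerA (mulrC c) addrA.
Qed.

End QuadOk.

End ThreeTerm.

Lemma gen_ideal_mem (k : fieldType) (I : choiceType) (R : free_alg k I -> Prop) t :
  R t -> gen_ideal R t.
Proof. by move=> Rt J _; apply. Qed.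

Section Presentations.
Variables (n : nat) (X : {set 'S_n}) (k : fieldType).
Variable R : free_alg k (quad_gen X) -> Prop.
Local Notation A := (quad_hopf R).
Local Notation a := (@qa n X k R).
Local Notation h := (@qh n X k R).
Let algA : is_algebra A := quad_hopf_algebra R.

Lemma gen_ideal_ev t : ev (A := A) (qgen R) t = 0 <-> gen_ideal R t.
Proof.
rewrite ev_qgen -[X in _ = X](lin0 (@proj_is_linear _ _ R)) projE.
by rewrite subr0.
Qed.

Lemma sub0P (V : zmodType) (x y : V) : x - y = 0 <-> x = y.
Proof. by split=> [/eqP|->]; rewrite ?subrr // subr_eq0 => /eqP. Qed.

Lemma gen_ideal_quad c r : gen_ideal R (quad_elt c r) <-> quad_ok a h c r.
Proof.
have E := ev_quad (A := A) (qgen R) algA c r.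
split=> [/gen_ideal_ev H|H]; first by apply/sub0P; exact: etrans (esym E) H.
by apply/gen_ideal_ev; exact: etrans E (iffRL (sub0P _ _) H).
Qed.

Let L := ev_linear (A := A) (qgen R).
Let g2 := ev_gen2 (A := A) (qgen R) algA.

Lemma ev_square i : ev (A := A) (qgen R) (ga k i ^+ 2) = a i ** a i.
Proof. exact: g2. Qed.

Lemma ev_pair i j :
  ev (A := A) (qgen R) (ga k i * ga k j + ga k j * ga k i) = a i ** a j + a j ** a i.
Proof. exact: etrans (linD L _ _) (congr2 +%R (g2 _ _) (g2 _ _)). Qed.

Lemma ev_triple i j l :
  ev (A := A) (qgen R) (ga k i * ga k j + ga k j * ga k l + ga k l * ga k i) =
  a i ** a j + a j ** a l + a l ** a i.
Proof.
exact: etrans (linD L _ _) (congr2 +%R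
  (etrans (linD L _ _) (congr2 +%R (g2 _ _) (g2 _ _))) (g2 _ _)).
Qed.

(** Membership in the ideal is an equation in the presented algebra; this covers all the
relations of the two families with a right-hand side. *)
Lemma gen_ideal_deform t v c (y z : 'S_n) : ev (A := A) (qgen R) t = v ->
  gen_ideal R (t - c *: (1 - gh k X y * gh k X z)) <->
  v = c *: (hone A - h y ** h z).
Proof.
move=> tv.
have E : ev (A := A) (qgen R) (t - c *: (1 - gh k X y * gh k X z)) =
         v - c *: (hone A - h y ** h z).
  exact: etrans (linB L _ _) (congr2 (fun p q => p - q) tv
    (etrans (linZ L _ _) (congr1 ( *:%R c)
      (etrans (linB L _ _) (congr2 (fun p q => p - q) (ev1 _) (g2 _ _)))))).
split=> [/gen_ideal_ev H|H]; first by apply/sub0P; exact: etrans (esym E) H.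
by apply/gen_ideal_ev; exact: etrans E (iffRL (sub0P _ _) H).
Qed.

End Presentations.

(** * Transpositions *)

Section Transpositions.
Variable n : nat.
Local Notation X := (cycles n 2).
Let X_conj : forall g t : 'S_n, t \in X -> rack g t \in X := @cycles_conj n 2.

Definition disjoint_pair (i j : idx X) : Prop := exists a b e f : 'I_n,
  [/\ uniq [:: a; b; e; f], val i = tperm a b & val j = tperm e f].

Definition triangle (i j l : idx X) : Prop := exists a b c : 'I_n,
  [/\ uniq [:: a; b; c], val i = tperm a b, val j = tperm b c & val l = tperm a c].

Local Notation rels := (three_rel disjoint_pair triangle).

Lemma rack_tperm (g : 'S_n) x y : rack g (tperm x y) = tperm (g x) (g y).
Proof. exact: tpermJ. Qed.

Lemma rack_idx_tperm g (i : idx X) x y : val i = tperm x y ->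
  val (rack_idx g i) = tperm (g x) (g y).
Proof. by move=> iE; rewrite (val_rack_idx X_conj) iE rack_tperm. Qed.

Lemma disjoint_pair_conj g i j : disjoint_pair i j ->
  disjoint_pair (rack_idx g i) (rack_idx g j).
Proof.
case=> a [b [e [f [U iE jE]]]]; exists (g a), (g b), (g e), (g f).
rewrite (rack_idx_tperm g iE) (rack_idx_tperm g jE); split=> //.
by rewrite -(map_inj_uniq (@perm_inj _ g)) in U.
Qed.

Lemma triangle_conj g i j l : triangle i j l ->
  triangle (rack_idx g i) (rack_idx g j) (rack_idx g l).
Proof.
case=> a [b [c [U iE jE lE]]]; exists (g a), (g b), (g c).
rewrite (rack_idx_tperm g iE) (rack_idx_tperm g jE) (rack_idx_tperm g lE).
by split=> //; rewrite -(map_inj_uniq (@perm_inj _ g)) in U.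
Qed.

Lemma disjoint_pair_rack i j : disjoint_pair i j ->
  rack_idx (val i) j = j /\ rack_idx (val j) i = i.
Proof.
case=> a [b [e [f [U iE jE]]]].
move: U; rewrite /= !inE !negb_or => /and4P[/and3P[ab ae af] /andP[be bf] ef _].
split; apply: val_inj.
  by rewrite (rack_idx_tperm _ jE) iE (tpermD ae be) (tpermD af bf) jE.
have [ea fa] : e != a /\ f != a by split; rewrite eq_sym.
have [eb fb] : e != b /\ f != b by split; rewrite eq_sym.
by rewrite (rack_idx_tperm _ iE) jE (tpermD ea fa) (tpermD eb fb) iE.
Qed.

Lemma triangle_rack i j l : triangle i j l ->
  [/\ rack_idx (val i) j = l, rack_idx (val j) l = i & rack_idx (val l) i = j].
Proof.
case=> a [b [c [U iE jE lE]]].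
move: U; rewrite /= !inE !negb_or => /and3P[/andP[ab ac] bc _].
have [ba [ca cb]] : b != a /\ (c != a /\ c != b) by do !split; rewrite eq_sym.
split; apply: val_inj.
- by rewrite (rack_idx_tperm _ jE) iE tpermR (tpermD ac bc) lE.
- by rewrite (rack_idx_tperm _ lE) jE tpermR (tpermD ba ca) iE.
- by rewrite (rack_idx_tperm _ iE) lE tpermL (tpermD ab cb) tpermC jE.
Qed.

Lemma transposition_square (i : idx X) : pmul (val i) (val i) = 1%g.
Proof. by have [x [y [_ ->]]] := cycles2P (valP i); rewrite /pmul tperm2. Qed.

Lemma ordinals_uniq (w : seq 'I_n) : uniq w -> (size w <= n)%N.
Proof.
move=> wU; have sub : {subset w <= enum 'I_n} by move=> x _; rewrite mem_enum.
by have := uniq_leq_size wU sub; rewrite size_enum_ord.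
Qed.

Section Orbits.
Variables (k : fieldType) (A : hopf_data k) (a : idx X -> A) (h : 'S_n -> A) (c : k).
Hypotheses (algA : is_algebra A) (comm : common_ok a h).
Variables x y z : 'I_n.
Hypothesis xyzU : uniq [:: x; y; z].
Hypothesis square : forall i : idx X, val i = tperm x y -> a i ** a i = 0.
Hypothesis pair : (4 <= n)%N -> exists u v, uniq [:: x; y; u; v] /\
  forall i j : idx X, val i = tperm x y -> val j = tperm u v ->
    a i ** a j + a j ** a i = (2%:R * c) *: (hone A - h (val i) ** h (val j)).
Hypothesis triple : forall i j l : idx X,
  val i = tperm x y -> val j = tperm y z -> val l = tperm x z ->
  a i ** a j + a j ** a l + a l ** a i =
    (3%:R * c) *: (hone A - h (val i) ** h (val j)).

(** Each kind of relation forms a single orbit: the points that occur in it can be moved to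
the given ones. *)
Lemma transposition_orbits r : rels r -> quad_ok a h c r.
Proof.
have moved (g : 'S_n) (i : idx X) (u v u' v' : 'I_n) : val i = tperm u v -> g u = u' -> g v = v' ->
    val (rack_idx g i) = tperm u' v'.
  by move=> iE <- <-; exact: rack_idx_tperm.
case=> [i|i j [s [t [e [f [U iE jE]]]]]|i j l [s [t [e [U iE jE lE]]]]].
- have [s [t [st iE]]] := cycles2P (valP i).
  have U : uniq [:: s; t] by rewrite /= inE st.
  have V : uniq [:: x; y] by move: xyzU; rewrite /= !inE !negb_or => /andP[/andP[->]].
  have [g [gs gt]] := perm_of_uniq U V (erefl _).
  apply: (quad_ok_conjV X_conj algA comm (g := g)) => /=.
  apply/(quad_ok_one _ comm (transposition_square _)).
  exact: square (moved g _ _ _ _ _ iE gs gt).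
- have [u [v [V E]]] := pair (ordinals_uniq U).
  have [g [gs gt ge gf]] := perm_of_uniq U V (erefl _).
  apply: (quad_ok_conjV X_conj algA comm (g := g)) => /=.
  have ijg : disjoint_pair (rack_idx g i) (rack_idx g j).
    by apply: disjoint_pair_conj; exists s, t, e, f.
  apply/(quad_ok_two X_conj disjoint_pair_rack triangle_rack _ comm ijg).
  exact: E (moved g _ _ _ _ _ iE gs gt) (moved g _ _ _ _ _ jE ge gf).
- have [g [gs gt ge]] := perm_of_uniq U xyzU (erefl _).
  apply: (quad_ok_conjV X_conj algA comm (g := g)) => /=.
  have ijlg : triangle (rack_idx g i) (rack_idx g j) (rack_idx g l).
    by apply: triangle_conj; exists s, t, e.
  apply/(quad_ok_three X_conj disjoint_pair_rack triangle_rack _ comm ijlg).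
  exact: triple (moved g _ _ _ _ _ iE gs gt) (moved g _ _ _ _ _ jE gt ge)
    (moved g _ _ _ _ _ lE gs ge).
Qed.

End Orbits.

Section Relations.
Variable k : fieldType.

(** The relations on the left are representatives of the orbits of those on the right. *)
Lemma quad_rel_Q Lam Gam c : (3 <= n)%N -> ((4 <= n)%N -> Lam = 2%:R * c) ->
  Gam = 3%:R * c ->
  (forall t, @Q_rel k Lam Gam n t -> gen_ideal (quad_rel rels c) t) /\
  (forall t, quad_rel rels c t -> gen_ideal (@Q_rel k Lam Gam n) t).
Proof.
move=> n3 Lam2 Gam3.
pose o (m : nat) (mn : (m < n)%N) := Ordinal mn.
have n2 : (1 < n)%N := ltnW n3.
pose x := o 0%N (ltnW n2); pose y := o 1%N n2; pose z := o 2%N n3.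
have xyzU : uniq [:: x; y; z] by [].
have cyc_tperm (p q : 'I_n) s : p != q ->
    s = tperm p q <-> is_cyc [:: (val p).+1; (val q).+1] s.
  by move=> pq; exact: iff_sym (is_cyc_tperm _ pq).
have xy := cyc_tperm x y _ isT; have yz := cyc_tperm y z _ isT.
have xz := cyc_tperm x z _ isT.
have comm R : (forall t, common_rel t -> R t) -> common_ok (qa R) (@qh n X k R).
  exact: quad_hopf_common.
split=> t.
- pose R := quad_rel rels c : free_alg k (quad_gen X) -> Prop.
  have {}comm := comm R (fun t => @quad_rel_common _ _ _ _ _ t).
  have ok r : rels r -> quad_ok (A := quad_hopf R) (qa R) (@qh n X k R) c r.
    move=> rr; apply: (iffLR (gen_ideal_quad R c r)); apply: gen_ideal_mem.
    exact: quad_rel_quad.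
  have two := quad_ok_two X_conj disjoint_pair_rack triangle_rack c comm.
  have three := quad_ok_three X_conj disjoint_pair_rack triangle_rack c comm.
  case=> [r rr|i iE|i j /xy iE jE|i j l /xy iE /yz jE /xz lE].
  + by apply: gen_ideal_mem; exact: quad_rel_common.
  + apply/gen_ideal_ev; apply: etrans (ev_square R i) _.
    exact: iffLR (quad_ok_one c comm (transposition_square i)) (ok _ (three_one _ _ i)).
  + (* No permutation of three points is the cycle (3 4). *)
    have [n4|n4] := leqP 4 n; last first.
      have := ltn_ord (val j z); rewrite -ltnS (jE z) ltnS => le.
      by move: (leq_ltn_trans le n4); rewrite ltnn.
    pose w := o 3%N n4.
    have {}jE : val j = tperm z w by apply/(is_cyc_tperm _ _).
    have ij : disjoint_pair i j by exists x, y, z, w.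
    apply/(gen_ideal_deform _ _ _ (ev_pair R i j)); rewrite (Lam2 n4).
    exact: iffLR (two _ _ ij) (ok _ (three_two _ ij)).
  + have ijl : triangle i j l by exists x, y, z.
    apply/(gen_ideal_deform _ _ _ (ev_triple R i j l)); rewrite Gam3.
    exact: iffLR (three _ _ _ ijl) (ok _ (three_three _ ijl)).
- pose R := @Q_rel k Lam Gam n.
  have {}comm := comm R (@Q_common _ _ _ _).
  case=> [r rr|r rr]; first by apply: gen_ideal_mem; exact: Q_common.
  apply/gen_ideal_quad.
  apply: (transposition_orbits (quad_hopf_algebra R) comm xyzU _ _ _ rr).
  + move=> i /xy iE; apply: etrans (esym (ev_square R i)) _.
    by apply/gen_ideal_ev; apply: gen_ideal_mem; exact: Q_sq.
  + move=> n4; pose w := o 3%N n4; exists z, w; split=> // i j /xy iE jE.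
    have {}jE : is_cyc [:: 3; 4] (val j) by apply/(@is_cyc_tperm _ _ z w).
    apply: (iffLR (gen_ideal_deform (2%:R * c) (val i) (val j) (ev_pair R i j))).
    by rewrite -(Lam2 n4); apply: gen_ideal_mem; exact: Q_comm.
  + move=> i j l /xy iE /yz jE /xz lE.
    apply: (iffLR (gen_ideal_deform (3%:R * c) (val i) (val j) (ev_triple R i j l))).
    by rewrite -Gam3; apply: gen_ideal_mem; exact: Q_braid.
Qed.

End Relations.

End Transpositions.

(** * Cycles of length four *)

Section FourCycles.
Local Notation X := (cycles 4 4).
Let X_conj : forall g t : 'S_4, t \in X -> rack g t \in X := @cycles_conj 4 4.
Implicit Types (i j l : idx X) (g : 'S_4) (a b c d : 'I_4).

Definition inverse_pair i j : Prop := val j = (val i)^-1%g.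

(** The cycles i = (a b c d), j = (a b d c) and l = (a d b c) permute each other cyclically
under conjugation. *)
Definition four_triple i j l : Prop := exists a b c d : 'I_4,
  [/\ uniq [:: a; b; c; d], maps4 (val i) a b c d, maps4 (val j) a b d c
    & maps4 (val l) a d b c].

Local Notation rels := (three_rel inverse_pair four_triple).

Lemma uniq_perm4 g a b c d : uniq [:: a; b; c; d] -> uniq [:: g a; g b; g c; g d].
Proof. by move=> U; rewrite -(map_inj_uniq (@perm_inj _ g)) in U. Qed.

Lemma rack_idx_maps4 g i a b c d : maps4 (val i) a b c d ->
  maps4 (val (rack_idx g i)) (g a) (g b) (g c) (g d).
Proof. by move=> iE; rewrite (val_rack_idx X_conj); exact: maps4_conj. Qed.

Lemma maps4_idx i j a b c d : uniq [:: a; b; c; d] ->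
  maps4 (val i) a b c d -> maps4 (val j) a b c d -> i = j.
Proof. by move=> U iE jE; apply: val_inj; exact: maps4_inj U iE jE. Qed.

Lemma inverse_pair_conj g i j : inverse_pair i j ->
  inverse_pair (rack_idx g i) (rack_idx g j).
Proof. by move=> ij; rewrite /inverse_pair !(val_rack_idx X_conj) ij /rack conjVg. Qed.

Lemma four_triple_conj g i j l : four_triple i j l ->
  four_triple (rack_idx g i) (rack_idx g j) (rack_idx g l).
Proof.
case=> a [b [c [d [U iE jE lE]]]]; exists (g a), (g b), (g c), (g d).
by split; [exact: uniq_perm4|exact: rack_idx_maps4..].
Qed.

Lemma inverse_pair_rack i j : inverse_pair i j ->
  rack_idx (val i) j = j /\ rack_idx (val j) i = i.
Proof.
move=> ij; split; apply: val_inj; rewrite (val_rack_idx X_conj) /rack ij.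
  by rewrite conjVg conjgE mulgA mulVg mul1g.
by rewrite conjgE invgK mulgV mulg1.
Qed.

Lemma uniq4_swap a b c d : uniq [:: a; b; c; d] ->
  uniq [:: a; b; d; c] /\ uniq [:: a; d; b; c].
Proof.
move=> U; split; rewrite -(perm_uniq (s1 := [:: a; b; c; d])) //.
  by rewrite !perm_cons (permEl (perm_catC [:: c] [:: d])).
by rewrite perm_cons (permEl (perm_catC [:: b; c] [:: d])).
Qed.

Lemma four_triple_rack i j l : four_triple i j l ->
  [/\ rack_idx (val i) j = l, rack_idx (val j) l = i & rack_idx (val l) i = j].
Proof.
case=> a [b [c [d [U iE jE lE]]]].
have [Uj Ul] := uniq4_swap U.
have [ia ib ic id] := iE; have [ja jb jd jc] := jE; have [la ld lb lc] := lE.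
split.
- apply: maps4_idx (uniq_perm4 (val i) Uj) (rack_idx_maps4 (val i) jE) _.
  by rewrite ia ib ic id.
- apply: maps4_idx (uniq_perm4 (val j) Ul) (rack_idx_maps4 (val j) lE) _.
  by rewrite ja jb jc jd.
- apply: maps4_idx (uniq_perm4 (val l) U) (rack_idx_maps4 (val l) iE) _.
  by rewrite la lb lc ld.
Qed.

(** A rack relation between 4-cycles that are neither equal nor inverse to each other
determines a four-triple: after a rotation, the second cycle is the first one with its
last two points exchanged. *)
Lemma four_tripleP i j l : pmul (val i) (val j) = pmul (val l) (val i) -> j != i ->
  ~ inverse_pair i j -> four_triple i j l.
Proof.
move=> ijl ji nij.
have lE : l = rack_idx (val i) j.
  apply: val_inj; apply: (mulgI (val i)).
  by rewrite -[LHS]/(pmul (val l) (val i)) -ijl (pmul_rack X_conj).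
have [a [b [c [d [U iE]]]]] := cycles4P (valP i).
have [p [q [r [V jE]]]] := maps4_start a (valP j).
have [Uj Ul] := uniq4_swap U.
have [ia ib ic id] := iE.
have r1 := maps4_rot iE; have r2 := maps4_rot r1; have r3 := maps4_rot r2.
have found x y z t : uniq [:: x; y; z; t] -> maps4 (val i) x y z t ->
    maps4 (val j) x y t z -> four_triple i j l.
  move=> W ixyzt jxytz; have [ix iy iz it] := ixyzt.
  exists x, y, z, t; split=> //; rewrite lE.
  have := rack_idx_maps4 (val i) jxytz; rewrite ix iy iz it.
  by move=> /maps4_rot/maps4_rot.
have rotU m : uniq (rot m [:: a; b; c; d]) by rewrite rot_uniq.
have s1 := maps4_rot jE; have s2 := maps4_rot s1; have s3 := maps4_rot s2.
have pE := mem_uniq4 p U; have qE := mem_uniq4 q U; have rE := mem_uniq4 r U.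
move: V; rewrite /= !inE !negb_or => /and4P[/and3P[ap aq ar] /andP[pq pr] qr _].
move: pE qE rE; rewrite !inE (eq_sym p) (eq_sym q) (eq_sym r).
rewrite (negPf ap) (negPf aq) (negPf ar) /=.
case/or3P=> /eqP pE; case/or3P=> /eqP qE; case/or3P=> /eqP rE;
  move: pq pr qr; rewrite ?pE ?qE ?rE ?eqxx // => _ _ _; move: jE s1 s2 s3;
  rewrite ?pE ?qE ?rE => jE s1 s2 s3.
- by case/negP: ji; apply/eqP; exact: esym (maps4_idx U iE jE).
- exact: found U iE jE.
- exact: found (rotU 3) r3 s3.
- exact: found (rotU 2) r2 s1.
- exact: found (rotU 1) r1 s2.
- case: nij; have [ja jd jc jb] := jE; apply: (eq_perm4 U).
  + by rewrite ja -id permK.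
  + by rewrite jb -ia permK.
  + by rewrite jc -ib permK.
  + by rewrite jd -ic permK.
Qed.

Lemma maps4_V (s : 'S_4) a b c d : maps4 s a b c d -> maps4 s^-1%g a d c b.
Proof.
case=> sa sb sc sd; split; first by rewrite -sd permK.
- by rewrite -sc permK.
- by rewrite -sb permK.
- by rewrite -sa permK.
Qed.

(** This and the next lemma identify the group-like elements of the presentation: they give
(13)(24) = (1234)(1234) and (12)(13) = (1234)(1243). *)
Lemma maps4_square (s : 'S_4) a b c d : uniq [:: a; b; c; d] -> maps4 s a b c d ->
  pmul s s = pmul (tperm a c) (tperm b d).
Proof.
move=> U [sa sb sc sd].
have := U; rewrite /= !inE !negb_or => /and4P[/and3P[ab ac ad] /andP[bc bd] cd _].
have [[ba da] [cb cd']] : (b != a /\ d != a) /\ (c != b /\ d != c).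
  by do !split; rewrite eq_sym.
rewrite /pmul; apply: (eq_perm4 U); rewrite !permM ?sa ?sb ?sc ?sd.
- by rewrite (tpermD ba da) tpermL.
- by rewrite tpermL (tpermD ad cd).
- by rewrite (tpermD bc cd') tpermR.
- by rewrite tpermR (tpermD ab cb).
Qed.

Lemma maps4_triple (s t : 'S_4) a b c d : uniq [:: a; b; c; d] ->
  maps4 s a b c d -> maps4 t a b d c -> pmul s t = pmul (tperm a b) (tperm a c).
Proof.
move=> U [sa sb sc sd] [ta tb td tc].
have := U; rewrite /= !inE !negb_or => /and4P[/and3P[ab ac ad] /andP[bc bd] cd _].
have cb : c != b by rewrite eq_sym.
rewrite /pmul; apply: (eq_perm4 U); rewrite !permM ?ta ?tb ?tc ?td.
- by rewrite tpermL (tpermD ac bc).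
- by rewrite (tpermD ab cb) tpermR.
- by rewrite tpermR tpermL.
- by rewrite (tpermD ad cd) (tpermD ad bd).
Qed.

Section Orbits.
Variables (k : fieldType) (A : hopf_data k) (a : idx X -> A) (h : 'S_4 -> A) (e : k).
Hypotheses (algA : is_algebra A) (comm : common_ok a h).
Variables x y z t : 'I_4.
Hypothesis xyztU : uniq [:: x; y; z; t].
Hypothesis square : forall i, maps4 (val i) x y z t ->
  a i ** a i = e *: (hone A - h (val i) ** h (val i)).
Hypothesis pair : forall i j, maps4 (val i) x y z t -> maps4 (val j) x t z y ->
  a i ** a j + a j ** a i = 0.
Hypothesis triple : forall i j l, maps4 (val i) x y z t -> maps4 (val j) x y t z ->
  maps4 (val l) x t y z ->
  a i ** a j + a j ** a l + a l ** a i =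
    (3%:R * e) *: (hone A - h (val i) ** h (val j)).

(** The right-hand side vanishes, since h_i h_j = 1. *)
Lemma quad_ok_inverse i j : inverse_pair i j ->
  quad_ok a h e [:: (i, j); (j, i)] <-> a i ** a j + a j ** a i = 0.
Proof.
move=> ij.
have := quad_ok_two X_conj inverse_pair_rack four_triple_rack e comm ij.
by rewrite ij (ok_mul comm) /pmul mulVg (ok_one comm) subrr scaler0.
Qed.

(** Any 4-cycle can be moved to (x y z t), and its inverse and the triples through it move
along. *)
Lemma four_cycle_orbits r : rels r -> quad_ok a h e r.
Proof.
have start i : exists g, maps4 (val (rack_idx g i)) x y z t.
  have [p [q [u [v [U iE]]]]] := cycles4P (valP i).
  have [g [<- <- <- <-]] := perm_of_uniq U xyztU (erefl _).
  by exists g; exact: rack_idx_maps4.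
case=> [i|i j ij|i j l [p [q [u [v [U iE jE lE]]]]]].
- have [g gi] := start i; apply: (quad_ok_conjV X_conj algA comm (g := g)) => /=.
  by rewrite /quad_ok !big_seq1; exact: square.
- have [g gi] := start i; apply: (quad_ok_conjV X_conj algA comm (g := g)) => /=.
  have ijg := inverse_pair_conj g ij.
  apply/(quad_ok_inverse ijg); apply: (pair gi).
  by rewrite ijg; exact: maps4_V gi.
- have [g [gp gq gu gv]] := perm_of_uniq U xyztU (erefl _).
  apply: (quad_ok_conjV X_conj algA comm (g := g)) => /=.
  have ijlg : four_triple (rack_idx g i) (rack_idx g j) (rack_idx g l).
    by apply: four_triple_conj; exists p, q, u, v.
  apply/(quad_ok_three X_conj inverse_pair_rack four_triple_rack _ comm ijlg).
  move: (rack_idx_maps4 g iE) (rack_idx_maps4 g jE) (rack_idx_maps4 g lE).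
  by rewrite gp gq gu gv; exact: triple.
Qed.

End Orbits.

Lemma quad_rel_D (k : fieldType) (e : k) :
  (forall t, D_rel e (3%:R * e) t -> gen_ideal (quad_rel rels e) t) /\
  (forall t, quad_rel rels e t -> gen_ideal (D_rel e (3%:R * e)) t).
Proof.
pose o (m : nat) (mn : (m < 4)%N) := Ordinal mn.
pose x := o 0%N isT; pose y := o 1%N isT; pose z := o 2%N isT; pose t := o 3%N isT.
have U : uniq [:: x; y; z; t] by [].
have [Uj Ul] := uniq4_swap U.
have Uv : uniq [:: x; t; z; y] by [].
have cyc (s : 'S_4) : is_cyc [:: 1; 2; 3; 4] s <-> maps4 s x y z t.
  exact: is_cyc_maps4 U.
have cycj (s : 'S_4) : is_cyc [:: 1; 2; 4; 3] s <-> maps4 s x y t z.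
  exact: is_cyc_maps4 Uj.
have cycl (s : 'S_4) : is_cyc [:: 1; 4; 2; 3] s <-> maps4 s x t y z.
  exact: is_cyc_maps4 Ul.
have cycv (s : 'S_4) : is_cyc [:: 1; 4; 3; 2] s <-> maps4 s x t z y.
  exact: is_cyc_maps4 Uv.
have tp (p q : 'I_4) (s : 'S_4) : p != q ->
    is_cyc [:: (val p).+1; (val q).+1] s <-> s = tperm p q.
  exact: is_cyc_tperm.
have xz := tp x z _ isT; have yt := tp y t _ isT; have xy := tp x y _ isT.
have comm R : (forall u, common_rel u -> R u) -> common_ok (qa R) (@qh 4 X k R).
  exact: quad_hopf_common.
split.
- pose R := quad_rel rels e : free_alg k (quad_gen X) -> Prop.
  have {}comm := comm R (fun u => @quad_rel_common _ _ _ _ _ u).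
  have ok r : rels r -> quad_ok (A := quad_hopf R) (qa R) (@qh 4 X k R) e r.
    move=> rr; apply: (iffLR (gen_ideal_quad R e r)); apply: gen_ideal_mem.
    exact: quad_rel_quad.
  move=> _ [r rr|i u v /cyc iE /xz uE /yt vE|i j /cyc iE /cycv jE|
            i j l u v /cyc iE /cycj jE /cycl lE /xy uE /xz vE].
  + by apply: gen_ideal_mem; exact: quad_rel_common.
  + apply/(gen_ideal_deform _ _ _ (ev_square R i)).
    rewrite (ok_mul comm) uE vE -(maps4_square U iE).
    have := ok _ (three_one _ _ i).
    by rewrite /quad_ok !big_seq1 (ok_mul comm).
  + have ij : inverse_pair i j by exact: maps4_inj Uv jE (maps4_V iE).
    apply/gen_ideal_ev; apply: etrans (ev_pair R i j) _.
    exact: iffLR (quad_ok_inverse e comm ij) (ok _ (three_two _ ij)).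
  + have ijl : four_triple i j l by exists x, y, z, t.
    apply/(gen_ideal_deform _ _ _ (ev_triple R i j l)).
    rewrite (ok_mul comm) uE vE -(maps4_triple U iE jE) -(ok_mul comm).
    exact: iffLR (quad_ok_three X_conj inverse_pair_rack four_triple_rack _ comm ijl)
      (ok _ (three_three _ ijl)).
- pose R := D_rel e (3%:R * e).
  have {}comm := comm R (@D_common _ _ _).
  move=> _ [r rr|r rr]; first by apply: gen_ideal_mem; exact: D_common.
  apply/gen_ideal_quad.
  apply: (four_cycle_orbits (quad_hopf_algebra R) comm U _ _ _ rr).
  + move=> i iE.
    rewrite (ok_mul comm) (maps4_square U iE) -(ok_mul comm).
    apply: (iffLR (gen_ideal_deform e (tperm x z) (tperm y t) (ev_square R i))).
    apply: gen_ideal_mem; apply: D_sq; first exact/cyc.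
      exact/xz.
    exact/yt.
  + move=> i j iE jE; apply: etrans (esym (ev_pair R i j)) _.
    apply/gen_ideal_ev; apply: gen_ideal_mem; apply: D_inv; first exact/cyc.
    exact/cycv.
  + move=> i j l iE jE lE.
    rewrite (ok_mul comm) (maps4_triple U iE jE) -(ok_mul comm).
    apply: (iffLR (gen_ideal_deform (3%:R * e) (tperm x y) (tperm x z) (ev_triple R i j l))).
    apply: gen_ideal_mem; apply: D_braid; first exact/cyc.
    * exact/cycj.
    * exact/cycl.
    * exact/xy.
    * exact/xz.
Qed.

End FourCycles.

(** * Braided relations and the theorem *)

Section BraidElements.
Variables (k : fieldType) (n : nat) (X : {set 'S_n}).
Implicit Types i j l : idx X.

Lemma braid_elt_one i : braid_elt k [:: (i, i)] = xT k i ^+ 2.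
Proof. exact: big_seq1. Qed.

Lemma braid_elt_two i j :
  braid_elt k [:: (i, j); (j, i)] = xT k i * xT k j + xT k j * xT k i.
Proof. exact: sum_two. Qed.

Lemma braid_elt_three i j l : braid_elt k [:: (i, j); (j, l); (l, i)] =
  xT k i * xT k j + xT k j * xT k l + xT k l * xT k i.
Proof. exact: sum_three. Qed.

Lemma defines_B_ideal (rel R : free_alg k (idx X) -> Prop) : defines_B rel R ->
  forall t, gen_ideal R t <-> gen_ideal rel t.
Proof. by case=> [->|[-> E]] t. Qed.

End BraidElements.

Lemma transp_rel_ideal (k : fieldType) n :
  (forall t, @transp_rel k n t -> exists2 r,
    three_rel (@disjoint_pair n) (@triangle n) r & t = braid_elt k r) /\
  (forall r, three_rel (@disjoint_pair n) (@triangle n) r ->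
    gen_ideal (@transp_rel k n) (braid_elt k r)).
Proof.
split=> [_ [i|i j a b e f U iE jE|i j l a b c U iE jE lE]|
         _ [i|i j [a [b [e [f [U iE jE]]]]]|i j l [a [b [c [U iE jE lE]]]]]].
- by exists [:: (i, i)]; [exact: three_one|exact: esym (braid_elt_one k i)].
- exists [:: (i, j); (j, i)]; last exact: esym (braid_elt_two k i j).
  by apply: three_two; exists a, b, e, f.
- exists [:: (i, j); (j, l); (l, i)]; last exact: esym (braid_elt_three k i j l).
  by apply: three_three; exists a, b, c.
- by apply: gen_ideal_mem; rewrite braid_elt_one; exact: transp_sq.
- by apply: gen_ideal_mem; rewrite braid_elt_two; exact: transp_comm U iE jE.
- by apply: gen_ideal_mem; rewrite braid_elt_three; exact: transp_braid U iE jE lE.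
Qed.

(** For j inverse to i the three-term relation is a consequence of the other two kinds; only
the remaining ones are four-triples. *)
Lemma fourcyc_rel_ideal (k : fieldType) (rels := three_rel inverse_pair four_triple) :
  (forall t, @fourcyc_rel k 4 t ->
    gen_ideal (fun u => exists2 r, rels r & u = braid_elt k r) t) /\
  (forall r, rels r -> gen_ideal (@fourcyc_rel k 4) (braid_elt k r)).
Proof.
pose R := fun u => exists2 r, rels r & u = braid_elt k r.
have one i : gen_ideal R (xT k i ^+ 2).
  apply: gen_ideal_mem; exists [:: (i, i)]; first exact: three_one.
  exact: esym (braid_elt_one k i).
have two i j : inverse_pair i j -> gen_ideal R (xT k i * xT k j + xT k j * xT k i).
  move=> ij; apply: gen_ideal_mem; exists [:: (i, j); (j, i)].
    exact: three_two.
  exact: esym (braid_elt_two k i j).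
have [_ idealD _] := gen_ideal_two_sided R.
split=> [_ [i|i j ij|i j l ijl ji il]|_ [i|i j ij|i j l ijl]].
- exact: one.
- exact: two.
- have [ij|nij] := pselect (inverse_pair i j).
    (* Here l = j, and the relation is x_i x_j + x_j x_i + x_j^2. *)
    have lj : l = j.
      apply: val_inj; apply: (mulgI (val i)).
      rewrite -[LHS]/(pmul (val l) (val i)) -ijl ij /pmul.
      by rewrite mulgV mulVg.
    rewrite lj; apply: idealD (two _ _ ij) (one j).
  have ijl3 := four_tripleP ijl ji nij.
  apply: gen_ideal_mem; exists [:: (i, j); (j, l); (l, i)]; first exact: three_three.
  exact: etrans (addrAC _ _ _) (esym (braid_elt_three k i j l)).
- by apply: gen_ideal_mem; rewrite braid_elt_one; exact: fourcyc_sq.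
- by apply: gen_ideal_mem; rewrite braid_elt_two; exact: fourcyc_inv.
- have [ijr jlr lir] := four_triple_rack ijl.
  apply: gen_ideal_mem; rewrite braid_elt_three.
  have -> : xT k i * xT k j + xT k j * xT k l + xT k l * xT k i =
            xT k i * xT k j + xT k l * xT k i + xT k j * xT k l by exact: addrAC.
  have ijl' : pmul (val i) (val j) = pmul (val l) (val i).
    by rewrite (pmul_rack (@cycles_conj 4 4)) ijr.
  have [a [b [c [d [U [_ ib _ id] [_ jb _ _] [_ ld _ _]]]]]] := ijl.
  move: U; rewrite /= !inE !negb_or => /and4P[/and3P[ab _ _] _ cd _].
  apply: fourcyc_braid => //.
    by apply: contraNneq cd => ji; rewrite -ib -ji jb.
  by apply: contraNneq ab => il; rewrite -id il ld.
Qed.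

Lemma closed_sqrt3 (k : closedFieldType) : exists z : k, z ^+ 2 = 3%:R.
Proof.
have [z zE] := solve_monicpoly (fun i => if i is 0%N then 3%:R else 0 : k) (n := 2) isT.
by exists z; rewrite zE !big_ord_recl big_ord0 /= expr0 mulr1 mul0r !addr0.
Qed.

Lemma char0_three (k : fieldType) : [pchar k] =i pred0 -> 3%:R != 0 :> k.
Proof. by move=> char0; have := char0 3%N; rewrite !inE /= => /negbT. Qed.

Theorem theorem4p10 (k : closedFieldType) (char0 : [pchar k] =i pred0) (lam : k) :
  [/\ forall (n : nat) (R : {malg k[{fmonom idx (cycles n 2)}]} -> Prop),
        (3 <= n)%N -> defines_B (@transp_rel k n) R ->
        let H := bosonization R in
        let sigma := conv_exp (@eta_tilde k n (cycles n 2) R lam) in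
        [/\ is_hopf H,
            mult_cocycle sigma,
            n = 3%N -> hopf_isomorphic (deform sigma) (H_Q 0 lam 3)
          & (4 <= n)%N ->
            hopf_isomorphic (deform sigma) (H_Q (2%:R * lam) (3%:R * lam) n)],
      forall R : {malg k[{fmonom idx (cycles 4 4)}]} -> Prop,
        defines_B (@fourcyc_rel k 4) R ->
        let H := bosonization R in
        let sigma := conv_exp (@eta_tilde k 4 (cycles 4 4) R lam) in
        [/\ is_hopf H,
            mult_cocycle sigma
          & hopf_isomorphic (deform sigma) (H_D lam (3%:R * lam))]
    & forall R : {malg k[{fmonom idx (cycles 3 2)}]} -> Prop,
        defines_B (@transp_rel k 3) R ->
        is_cocycle_deformation (bosonization R) (H_Q 0 lam 3)].
Proof.
have three0 := char0_three char0.
have [z zE] := closed_sqrt3 k.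
have z0 : z != 0 by apply: contraNneq three0 => z0; rewrite -zE z0 expr0n.
have zlam : z ^+ 2 * (lam / 3%:R) = lam by rewrite zE mulrCA mulfV // mulr1.
have onelam : (1 : k) ^+ 2 * (lam / 3%:R) = lam / 3%:R by rewrite expr1n mul1r.
have transp n R R' y c : defines_B (@transp_rel k n) R -> y != 0 :> k ->
    y ^+ 2 * (lam / 3%:R) = c ->
    (forall t, R' t ->
      gen_ideal (quad_rel (three_rel (@disjoint_pair n) (@triangle n)) c) t) ->
    (forall t, quad_rel (three_rel (@disjoint_pair n) (@triangle n)) c t ->
      gen_ideal R' t) ->
    [/\ is_hopf (bosonization R), mult_cocycle (conv_exp (@eta_tilde k n (cycles n 2) R lam))
      & hopf_isomorphic (deform (conv_exp (@eta_tilde k n (cycles n 2) R lam))) (quad_hopf R')].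
  move=> /defines_B_ideal RE y0 <- sub sup.
  have [rsub rsup] := transp_rel_ideal k n.
  apply: (deform_bosonization (@cycles_conj n 2) (fun i => cycles2_odd (valP i))
    (three_prod (@cycles_conj n 2) (@disjoint_pair_rack n) (@triangle_rack n))
    (three_braid (@cycles_conj n 2) (@disjoint_pair_rack n) (@triangle_rack n))
    (three_conj (@disjoint_pair_conj n) (@triangle_conj n)) _ _ y0 sub sup).
    move=> t /gen_ideal_mem/RE; apply: gen_ideal_mono => r /rsub.
    exact: gen_ideal_mem.
  by move=> r /rsup/RE.
have Q3 R : defines_B (@transp_rel k 3) R ->
    [/\ is_hopf (bosonization R), mult_cocycle (conv_exp (@eta_tilde k 3 (cycles 3 2) R lam))
      & hopf_isomorphic (deform (conv_exp (@eta_tilde k 3 (cycles 3 2) R lam))) (H_Q 0 lam 3)].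
  move=> RB.
  have [//||sub sup] := @quad_rel_Q 3 k 0 lam (lam / 3%:R) isT.
    by rewrite mulrCA mulfV // mulr1.
  exact: transp 3 R _ 1 _ RB (oner_neq0 k) onelam sub sup.
have D R : defines_B (@fourcyc_rel k 4) R ->
    [/\ is_hopf (bosonization R), mult_cocycle (conv_exp (@eta_tilde k 4 (cycles 4 4) R lam))
      & hopf_isomorphic (deform (conv_exp (@eta_tilde k 4 (cycles 4 4) R lam)))
          (H_D lam (3%:R * lam))].
  move=> /defines_B_ideal RE.
  have [sub sup] := quad_rel_D lam; have [rsub rsup] := fourcyc_rel_ideal k.
  apply: (deform_bosonization (@cycles_conj 4 4) (fun i => cycles4_odd (valP i))
    (three_prod (@cycles_conj 4 4) inverse_pair_rack four_triple_rack)
    (three_braid (@cycles_conj 4 4) inverse_pair_rack four_triple_rack)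
    (three_conj inverse_pair_conj four_triple_conj) _ _ z0); rewrite ?zlam //.
    by move=> t /gen_ideal_mem/RE; apply: gen_ideal_mono => r /rsub.
  by move=> r /rsup/RE.
split=> [n R n3 RB H sigma|//|R RB].
- have [n4|n3'] : (4 <= n)%N \/ n = 3%N.
    by move: n3; rewrite leq_eqVlt => /orP[/eqP <-|]; [right|left].
    have [//||sub sup] := @quad_rel_Q n k (2%:R * lam) (3%:R * lam) lam n3.
      by [].
    have [hopfH cocycle iso] := transp n R _ z _ RB z0 zlam sub sup.
    split; [exact: hopfH|exact: cocycle|by move=> nE; rewrite nE in n4|by move=> _; exact: iso].
  subst n; have [hopfH cocycle iso] := Q3 R RB.
  by split; [exact: hopfH|exact: cocycle|move=> _; exact: iso|].
- have [hopfH cocycle iso] := Q3 R RB; split; first exact: hopfH.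
  by exists (conv_exp (@eta_tilde k 3 (cycles 3 2) R lam)).
Qed.
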